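(* Let $\mathrm{QSym}$ be the $\mathbb{Q}$-algebra of quasisymmetric functions in $x_1,x_2,\dots$ and let $(\mathcal{E})$ be the ideal of $\mathrm{QSym}$ generated by the elementary symmetric functions of positive degree. Then the set (of images of) $\{\mathcal{RS}_\alpha \mid \alpha \text{ a pure and inverting composition}\}$ is a basis of the quotient $\mathrm{QSym}/(\mathcal{E})$ over $\mathbb{Q}$.
   Context: A (strong) composition is a finite sequence of positive integers (the empty sequence is allowed; it is pure and inverting, and $\mathcal{RS}_\emptyset=1$). The diagram of $\alpha$ has left-justified rows with $\alpha_i$ boxes in row $i$ from the top. Row-strict composition tableau (RCT) of shape $\alpha$ (with $k$ parts and largest part $m$): a filling $U$ of the diagram of $\alpha$ with positive integers such that (1) the first column is weakly increasing from top to bottom; (2) each row is strictly decreasing from left to right; (3) if $\hat U$ is the $k\times m$ array obtained by adding zeros at the ends of the rows of $U$, then for $1\le i_1<i_2\le k$ and $2\le j\le m$: if $\hat U(i_2,j)\ne0$ and $\hat U(i_2,j)>\hat U(i_1,j)$ then $\hat U(i_2,j)\ge\hat U(i_1,j-1)$. The row-strict quasisymmetric Schur function is $\mathcal{RS}_\alpha=\sum_U\prod_i x_i^{\#\{\text{entries of }U\text{ equal to }i\}}$, summed over all RCTs $U$ of shape $\alpha$; it lies in $\mathrm{QSym}$. A composition $\alpha$ with largest part $m$ is inverting if for each $1<i\le m$ there are indices $s<t$ with $\alpha_s=i$ and $\alpha_t=i-1$. Every composition factors uniquely as $\alpha=(\alpha',k^{i_k},\dots,2^{i_2},1^{i_1})$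 with all $i_j\ge1$, where $\alpha'$ has no parts of size $1,2,\dots,k$, and $k\ge0$ is maximal with this property ($k=0$ if the last part is not $1$). Here $j^{i_j}$ means $i_j$ consecutive parts equal to $j$. The composition $\alpha$ is pure if this $k$ is even. *)

(* Defs.v *)
From HB Require Import structures.
From mathcomp Require Import all_boot all_order all_algebra.
From mathcomp Require Import finmap multiset.
From mathcomp Require Import boolp classical_sets functions cardinality fsbigop.

Set Implicit Arguments.
Unset Strict Implicit.
Unset Printing Implicit Defensive.

Import GRing.Theory.

Local Open Scope classical_set_scope.
Local Open Scope ring_scope.

(* A monomial in x_1, x_2, ... is the finite multiset of the indices of its
   variables. Indices are shifted by one: [i : nat] stands for x_{i+1}. *)
Definition monomial := {mset nat}%mset.

HB.instance Definition _ := Choice.on monomial.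

(* Formal power series in x_1, x_2, ... over the rationals, given by their
   coefficients. *)
Definition fps := monomial -> rat^o.

HB.instance Definition _ := GRing.Lmodule.copy fps (monomial -> rat^o).

(* The index set is finite (see [finite_splits]), so this finitely supported
   sum is the usual Cauchy product. *)
Definition fps_mul (f g : fps) : fps := fun m =>
  \sum_(p \in [set p : monomial * monomial | msetD p.1 p.2 = m])
     (f p.1 * g p.2 : rat).

Definition fps_one : fps := fun m => (m == mset0)%:R.

Section FpsRing.

Fixpoint submsets (s : seq nat) : seq monomial :=
  if s is x :: s' then submsets s' ++ map (msetD (msetn 1 x)) (submsets s')
  else [:: mset0].

Lemma submsetsP (s : seq nat) (d : monomial) :
  msubset d (seq_mset s) -> d \in submsets s.
Proof.
elim: s d => [|x s IHs] d /= /msubsetP sub.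
  rewrite inE -msubset0; apply/msubsetP => y.
  by have := sub y; rewrite mset_seqE mset0E.
rewrite mem_cat; have [xd|xNd] := boolP (x \in d).
  apply/orP; right; apply/mapP; exists (msetB d (msetn 1 x)).
    apply: IHs; apply/msubsetP => y; have := sub y.
    by rewrite msetB1E !mset_seqE /= eq_sym leq_subLR.
  by rewrite msetB1K.
apply/orP; left; apply: IHs; apply/msubsetP => y; have := sub y.
rewrite !mset_seqE /=; have [<-|//] := eqVneq x y.
by rewrite (mset_eq0P xNd).
Qed.

Definition divisors_of (m : monomial) : seq monomial :=
  undup (submsets (enum_mset m)).

Lemma divisors_ofP (m d : monomial) : msubset d m -> d \in divisors_of m.
Proof. by move=> dm; rewrite mem_undup submsetsP// seq_mset_id. Qed.

Lemma divisors_of_l (m a b : monomial) :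
  msetD a b = m -> a \in divisors_of m.
Proof.
by move=> <-; apply/divisors_ofP/msubsetP => x; rewrite msetE2 leq_addr.
Qed.

Lemma divisors_of_r (m a b : monomial) :
  msetD a b = m -> b \in divisors_of m.
Proof. by rewrite msetDC => /divisors_of_l. Qed.

Lemma finite_splits (m : monomial) :
  finite_set [set p : monomial * monomial | msetD p.1 p.2 = m].
Proof.
apply/(sub_finite_set _ (finite_seq
  [seq (a, b) | a <- divisors_of m, b <- divisors_of m])).
move=> [a b] /= abm; apply/allpairsP; exists (a, b).
by rewrite (divisors_of_l abm) (divisors_of_r abm).
Qed.

Lemma fps_mulE (f g : fps) (m : monomial) (S : seq monomial) :
    uniq S -> (forall a b, msetD a b = m -> a \in S /\ b \in S) ->
  fps_mul f g m =
  \sum_(a <- S) \sum_(b <- S | msetD a b == m) (f a * g b : rat).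
Proof.
move=> uS mS.
pose r := [seq p <- [seq (a, b) | a <- S, b <- S] | msetD p.1 p.2 == m].
rewrite /fps_mul (fsbig_fwiden r).
- rewrite big_filter big_mkcond big_allpairs /=.
  by apply: eq_bigr => a _; rewrite -big_mkcond.
- move=> [a b] /= abm; rewrite mem_filter /= abm eqxx /=.
  by apply/allpairsP; exists (a, b); have [? ?] := mS _ _ abm.
- by rewrite filter_uniq// allpairs_uniq// => -[? ?] [? ?] _ _ [-> ->].
- by move=> [a b] [] /=; rewrite mem_filter /= => /andP[/eqP abm _] /(_ abm).
Qed.

Lemma fps_mulC : commutative fps_mul.
Proof.
move=> f g; apply/funext => m; have uS := undup_uniq (submsets (enum_mset m)).
have mS a b : msetD a b = m -> a \in divisors_of m /\ b \in divisors_of m.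
  by move=> abm; rewrite (divisors_of_l abm) (divisors_of_r abm).
rewrite !(fps_mulE _ _ uS mS) (exchange_big_dep xpredT) //=.
apply: eq_bigr => b _; apply: eq_big => [a|a _]; first by rewrite msetDC.
by rewrite mulrC.
Qed.

Lemma fps_mul1 : left_id fps_one fps_mul.
Proof.
move=> f; apply/funext => m; have uS := undup_uniq (submsets (enum_mset m)).
have mS a b : msetD a b = m -> a \in divisors_of m /\ b \in divisors_of m.
  by move=> abm; rewrite (divisors_of_l abm) (divisors_of_r abm).
have [S0 Sm] := mS _ _ (mset0D m).
rewrite (fps_mulE _ _ uS mS) (bigD1_seq mset0)//=.
rewrite [X in _ + X]big1 ?addr0 => [|a /negPf a0]; last first.
  by rewrite big1// => b _; rewrite /fps_one a0 mul0r.
under eq_bigl do rewrite mset0D.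
by rewrite big_mkcond (bigD1_seq m)//= eqxx /fps_one eqxx mul1r big1 ?addr0// =>
  b /negPf ->.
Qed.

Lemma fps_mulDl : left_distributive fps_mul (@GRing.add fps).
Proof.
move=> f g h; apply/funext => m; have uS := undup_uniq (submsets (enum_mset m)).
have mS a b : msetD a b = m -> a \in divisors_of m /\ b \in divisors_of m.
  by move=> abm; rewrite (divisors_of_l abm) (divisors_of_r abm).
transitivity (fps_mul f h m + fps_mul g h m : rat) => //.
rewrite !(fps_mulE _ _ uS mS) -big_split /=.
by apply: eq_bigr => a _; rewrite -big_split; apply: eq_bigr => b _; exact: mulrDl.
Qed.

Lemma fps_mulZ (c : rat) (f g : fps) : c *: fps_mul f g = fps_mul (c *: f) g.
Proof.
apply/funext => m; have uS := undup_uniq (submsets (enum_mset m)).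
have mS a b : msetD a b = m -> a \in divisors_of m /\ b \in divisors_of m.
  by move=> abm; rewrite (divisors_of_l abm) (divisors_of_r abm).
transitivity (c * fps_mul f g m : rat) => //.
rewrite !(fps_mulE _ _ uS mS) mulr_sumr.
by apply: eq_bigr => a _; rewrite mulr_sumr; apply: eq_bigr => b _; exact: mulrA.
Qed.

Lemma fps_mulA : associative fps_mul.
Proof.
have assoc f g h (m : monomial) : fps_mul f (fps_mul g h) m =
    \sum_(a <- divisors_of m) \sum_(b <- divisors_of m)
    \sum_(c <- divisors_of m | msetD a (msetD b c) == m) (f a * (g b * h c) : rat).
  have uS := undup_uniq (submsets (enum_mset m)).
  have mS a b : msetD a b = m -> a \in divisors_of m /\ b \in divisors_of m.
    by move=> abm; rewrite (divisors_of_l abm) (divisors_of_r abm).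
  rewrite (fps_mulE _ _ uS mS); apply: eq_bigr => a _.
  transitivity (\sum_(x <- divisors_of m | msetD a x == m)
     \sum_(b <- divisors_of m) \sum_(c <- divisors_of m | msetD b c == x)
       (f a * (g b * h c) : rat)).
    apply: eq_bigr => x /eqP axm; rewrite (fps_mulE _ _ uS).
      by rewrite mulr_sumr; apply: eq_bigr => b _; rewrite mulr_sumr.
    move=> b c bcx; split; [apply: (@divisors_of_l m b (msetD a c))|
      apply: (@divisors_of_r m (msetD a b) c)].
      by rewrite msetDCA bcx.
    by rewrite -msetDA bcx.
  rewrite (exchange_big_dep xpredT) //=; apply: eq_bigr => b _.
  rewrite (exchange_big_dep xpredT) //= [RHS]big_mkcond /=.
  apply: eq_bigr => c _; have [abcm|abcNm] := eqVneq (msetD a (msetD b c)) m.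
    have [_ bcS] := mS _ _ abcm.
    rewrite big_mkcond (bigD1_seq (msetD b c))//= abcm !eqxx /= big1 ?addr0//.
    by move=> x /negPf; rewrite eq_sym => ->; rewrite andbF.
  rewrite big1// => x /andP[/andP[/eqP axm _] /eqP bcx].
  by rewrite bcx axm eqxx in abcNm.
move=> f g h; apply/funext => m.
rewrite assoc [fps_mul f g]fps_mulC [RHS](congr1 (@^~ m) (fps_mulC _ h)) assoc.
rewrite exchange_big [RHS]exchange_big; apply: eq_bigr => b _ /=.
apply/esym; under eq_bigr do rewrite big_mkcond.
rewrite exchange_big; apply: eq_bigr => a _; rewrite [RHS]big_mkcond.
apply: eq_bigr => c _; rewrite [msetD b a]msetDC msetDCA [msetD c b]msetDC.
by congr (if _ then _ else _); rewrite mulrC -mulrA mulrCA.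
Qed.

Lemma fps_one_neq0 : fps_one != 0 :> fps.
Proof.
by apply/eqP => /(congr1 (@^~ mset0)); rewrite /fps_one eqxx => /eqP.
Qed.

End FpsRing.

HB.instance Definition _ := GRing.Zmodule_isComNzRing.Build fps
  fps_mulA fps_mulC fps_mul1 fps_mulDl fps_one_neq0.
HB.instance Definition _ := GRing.Lmodule_isLalgebra.Build rat fps fps_mulZ.
HB.instance Definition _ := GRing.Lalgebra_isComAlgebra.Build rat fps.

(* The series \sum_{u in A} x^{w u}; it is meant for weights [w] with finite
   fibres over [A], as the coefficients would otherwise collapse to 0 (see
   [finite_elementary] and [finite_RCT_content]). *)
Definition gen_series (T : choiceType) (A : set T) (w : T -> monomial) : fps :=
  fun m => \sum_(u \in [set u | A u /\ w u = m]) (1 : rat).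

Definition elementary (k : nat) : fps :=
  gen_series [set s : {fset nat} | #|` s|%fset = k]
             (fun s => seq_mset (enum_fset s)).

Lemma finite_elementary (k : nat) (m : monomial) :
  finite_set [set s : {fset nat} | #|` s|%fset = k /\
                                   seq_mset (enum_fset s) = m].
Proof.
apply/(sub_finite_set _ (finite_seq [:: [fset x in enum_mset m]%fset])).
move=> s /= [_ <-]; rewrite inE; apply/eqP/fsetP => x; rewrite !inE.
by rewrite (perm_mem (perm_eq_seq_mset _)).
Qed.

(* The monomial x_{i_1}^{a_1} ... x_{i_k}^{a_k}, with [i] the shifted
   indices. *)
Definition xpow (i a : seq nat) : monomial :=
  seq_mset (flatten [seq nseq p.2 p.1 | p <- zip i a]).

Definition bounded_degree : set fps :=
  [set f | exists d : nat, forall m : monomial,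
     (d < size (enum_mset m))%N -> f m = 0].

Definition QSym : set fps :=
  [set f | bounded_degree f /\
     forall a i j : seq nat, all (ltn 0%N) a ->
       sorted ltn i -> sorted ltn j -> size i = size a -> size j = size a ->
       f (xpow i a) = f (xpow j a)].

(* The ideal of A generated by G, for a subring A of R containing G. *)
Definition ideal_gen (R : comNzRingType) (A G : set R) : set R :=
  [set f | exists s : seq (R * R),
     (forall p, p \in s -> A p.1 /\ G p.2) /\ f = \sum_(p <- s) p.1 * p.2].

Definition E_ideal : set fps :=
  ideal_gen QSym [set elementary k | k in [set k | (0 < k)%N]].

(* The classes of the family [b], indexed by [B], form a basis of the quotient
   A / I, for submodules I of A of V; in particular the classes of distinct
   members are distinct. *)
Definition quotient_basis (K : fieldType) (V : lmodType K) (A I : set V)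
    (T : choiceType) (B : set T) (b : T -> V) : Prop :=
  [/\ forall t, B t -> A (b t),
      forall (s : seq T) (c : T -> K), uniq s -> (forall t, t \in s -> B t) ->
        I (\sum_(t <- s) c t *: b t) -> forall t, t \in s -> c t = 0
    & forall v, A v -> exists (s : seq T) (c : T -> K),
        (forall t, t \in s -> B t) /\ I (v - \sum_(t <- s) c t *: b t)].

Definition composition (al : seq nat) : bool := all (ltn 0%N) al.

Definition largest_part (al : seq nat) : nat := \max_(p <- al) p.

(* [U] lists the rows from top to bottom. The padded array is read off with the
   default value 0; rows and columns are numbered from 0. *)
Definition padded (U : seq (seq nat)) (i j : nat) : nat :=
  nth 0%N (nth [::] U i) j.

Definition is_RCT (al : seq nat) (U : seq (seq nat)) : Prop :=
  [/\ shape U = al /\ all (all (ltn 0%N)) U,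
      sorted leq [seq head 0%N row | row <- U],
      all (sorted gtn) U
    & forall i1 i2 j : nat,
        (i1 < i2 < size al)%N -> (1 <= j < largest_part al)%N ->
        padded U i2 j <> 0%N -> (padded U i2 j > padded U i1 j)%N ->
        (padded U i2 j >= padded U i1 j.-1)%N].

(* [predn] accounts for the shift in the indices of the variables. *)
Definition content (U : seq (seq nat)) : monomial :=
  seq_mset [seq e.-1 | e <- flatten U].

Definition RS (al : seq nat) : fps := gen_series (is_RCT al) content.

Lemma finite_RCT_content (al : seq nat) (m : monomial) :
  finite_set [set U | is_RCT al U /\ content U = m].
Proof.
apply/(sub_finite_set _ (finite_seq
  [seq reshape al [seq e.+1 | e <- s] | s <- permutations (enum_mset m)])).
move=> U /= [[[<- U_gt0] _ _ _] <-]; apply/mapP.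
exists [seq e.-1 | e <- flatten U].
  by rewrite mem_permutations perm_sym perm_eq_seq_mset.
rewrite -map_comp map_id_in ?flattenK// => e /flattenP[r rU er] /=.
by apply: prednK; apply: (allP (allP U_gt0 _ rU)).
Qed.

Definition inverting (al : seq nat) : Prop :=
  forall i : nat, (1 < i <= largest_part al)%N ->
    exists s t : nat, [/\ (s < t < size al)%N,
      nth 0%N al s = i & nth 0%N al t = i.-1].

(* al = (al', k^{i_k}, ..., 2^{i_2}, 1^{i_1}) with all i_j >= 1 and no part of
   al' in {1, ..., k}. *)
Definition staircase_suffix (al : seq nat) (k : nat) : Prop :=
  exists (al' : seq nat) (mult : nat -> nat),
    [/\ al = al' ++ flatten [seq nseq (mult j) j | j <- rev (iota 1 k)],
        forall j : nat, (1 <= j <= k)%N -> (1 <= mult j)%N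
      & forall p : nat, p \in al' -> ~~ (1 <= p <= k)%N].

Definition pure (al : seq nat) : Prop :=
  exists k : nat, [/\ staircase_suffix al k,
    forall k' : nat, staircase_suffix al k' -> (k' <= k)%N & ~~ odd k].

(* Main.v *)
(* Read a quasisymmetric function as a function on compositions. The map Phi, a
   signed sum over refinements, is an involution that preserves the span of the
   multiples of the e_k. Standardizing tableaux shows that Phi (RS_a) counts, up
   to sign, the standard fillings of shape a whose blocks of sizes g decrease in
   reading order. The cells of such a block lie in distinct columns, so Phi (RS_a)
   is supported on a itself and on compositions of smaller weight
   sum_i (2^{a_i} - 1).

   Let a functional kill the ideal and all RS_b, b pure and inverting. After
   composition with Phi, weight by weight, it becomes a function f on the
   rearrangements of a multiset of parts such that the sum of f vanishes over the
   words that agree once the letters i and i - 1 are identified (i > 1), and over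
   those that agree once the letters 1 are deleted, and such that f vanishes on
   pure inverting words. A long induction on words shows f = 0. Hence the
   products e_l RS_b, l a partition and b pure and inverting, span.

   They are independent because there are not too many of them: adding the
   columns of l to b, to the positions of the largest parts first, maps the pairs
   (l, b) injectively to compositions; if the largest column is longer than b,
   then b is first replaced by (b + 1, 1, ..., 1), which is inverting but not
   pure. *)

Require Import Defs.
From mathcomp Require Import all_boot all_order all_algebra.
From mathcomp Require Import finmap multiset.
From mathcomp Require Import boolp classical_sets functions cardinality fsbigop.
From mathcomp Require Import zify lra ring.

Set Implicit Arguments.
Unset Strict Implicit.
Unset Printing Implicit Defensive.

Import GRing.Theory Num.Theory.

(** Straightening would settle the words if only inversions mattered: a word without an inversion of
    [i] has the largest [word_val] in its class of [fuse i], so [f] there is minus a sum over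
    smaller words. Purity is the obstacle: at an inverting word whose letters 1 are all at its end,
    [f] vanishes by hypothesis only if the staircase is even. For these words, sums of [f] over
    fibres of suitable keys are shown to vanish, trading the relation that deletes the [r] letters 1
    for the one that fuses 2 with 1 on a suffix starting [r] places later. What resists are words
    ending in 2...2 1...1. Cutting off this end and subtracting 2 leads to the same problem with the
    largest letter lowered by 2, which is where the parity comes from.

    In the weight, a cell of column j counts 2^j. Powers of 2 serve twice: distinct columns weigh
    least when they are 0, ..., x - 1, and lowering a part x costs 2^(x - 1), so that lowering all
    parts at least i is the dearest way to reach its result. *)

Local Notation comp := (all (ltn 0%N)).

(** * Words and the classes of their letters *)

Local Open Scope nat_scope.

Definition fuse i (w : seq nat) : seq nat := [seq if x == i then i.-1 else x | x <- w].

(* False when i does not occur in w, as index i w is then size w. *)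
Definition has_inv i (w : seq nat) : bool := i.-1 \in drop (index i w) w.

(* All the letters 1 of w are at its end. *)
Definition trail (w : seq nat) : bool := 1 \notin take (size w - count_mem 1 w) w.

Definition strip1 (w : seq nat) : seq nat := [seq x <- w | x != 1].

Definition gt2 (w : seq nat) : seq nat := [seq x <- w | 2 < x].

(* The last letter is the most significant digit, so that within a class of
   [fuse i] the words without [has_inv i] have the largest value. *)
Definition word_val (B : nat) (w : seq nat) : nat := foldr (fun x acc => x + B * acc) 0 w.

Definition wsum (T : seq nat) (f : seq nat -> rat) (P : pred (seq nat)) : rat :=
  (\sum_(w <- permutations T | P w) f w)%R.

Lemma size_fuse i w : size (fuse i w) = size w. Proof. exact: size_map. Qed.

Lemma fuse_cat i u v : fuse i (u ++ v) = fuse i u ++ fuse i v.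
Proof. exact: map_cat. Qed.

Lemma take_fuse i k w : take k (fuse i w) = fuse i (take k w).
Proof. by rewrite /fuse map_take. Qed.

Lemma drop_fuse i k w : drop k (fuse i w) = fuse i (drop k w).
Proof. by rewrite /fuse map_drop. Qed.

Lemma has_inv_cons i x w : has_inv i (x :: w) = if x == i then i.-1 \in x :: w else has_inv i w.
Proof. by rewrite /has_inv /= ; case: eqP. Qed.

Lemma has_inv_mem i w : has_inv i w -> i.-1 \in w.
Proof. exact: mem_drop. Qed.

(** Every fused place of [w] carries [i], the larger of its two possible letters. *)
Lemma word_val_mono B i w w' : fuse i w' = fuse i w -> i.-1 \notin w ->
  word_val B w' <= word_val B w.
Proof.
elim: w w' => [|x w IH] [|x' w'] //= [hx hw]; rewrite inE negb_or => /andP[xi wi].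
have {}IH := IH _ hw wi.
have : x' <= x by move: hx xi; case: eqP; case: eqP; lia.
nia.
Qed.

(** In [w] every [i - 1] precedes every [i], so the letters [i] occupy the most significant of the
    places where the class leaves a choice. The bound on [count_mem i w'] excludes class mates with
    more of them. *)
Lemma word_val_class B i w w' : 1 < B -> 0 < i -> fuse i w' = fuse i w -> ~~ has_inv i w ->
  count_mem i w' <= count_mem i w -> w' = w \/ word_val B w' < word_val B w.
Proof.
move=> B1 i0; elim: w w' => [|x w IH] [|x' w'] //=; first by left.
move=> [hx hw]; rewrite has_inv_cons => ni.
case: (eqVneq x i) ni hx => [->|xi] ni; case: (eqVneq x' i) => [->|x'i] hx hc.
- have ni' : ~~ has_inv i w by apply: contra ni => /has_inv_mem; rewrite inE orbC => ->.
  by have [->|lt] := IH _ hw ni' hc; [left|right; nia].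
- right; move: ni; rewrite inE negb_or => /andP[ii iw].
  by have := word_val_mono B hw iw; nia.
- have [e|lt] := IH _ hw ni (ltnW hc); first by move: hc; rewrite e; lia.
  by right; nia.
- by rewrite hx; have [->|lt] := IH _ hw ni hc; [left|right; nia].
Qed.

Section Sums.
Variables (T : seq nat) (f : seq nat -> rat).
Local Notation Sg := (wsum T f).
Local Notation W := (permutations T).

Lemma wsum_ext (P Q : pred (seq nat)) : {in W, P =1 Q} -> Sg P = Sg Q.
Proof. by move=> PQ; rewrite /wsum big_seq_cond [RHS]big_seq_cond; apply: eq_bigl => w;
 case: (boolP (w \in W)) => //= /PQ ->. Qed.

Lemma wsum0 (P : pred (seq nat)) : {in W, forall w, P w -> f w = 0%R} -> Sg P = 0%R.
Proof. by move=> h; rewrite /wsum big_seq_cond big1 // => w /andP[/h]. Qed.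

Lemma wsumID (P Q : pred (seq nat)) : Sg P = (Sg (fun w => P w && Q w) + Sg (fun w =>
  P w && ~~ Q w))%R.
Proof. exact: bigID. Qed.

Lemma wsum_fib (A : eqType) (h : seq nat -> A) (P : pred (seq nat)) :
  {in W, forall w, P w -> Sg (fun x => P x && (h x == h w)) = 0%R} -> Sg P = 0%R.
Proof.
move=> hP; pose V := undup [seq h w | w <- W & P w].
transitivity (\sum_(v <- V) Sg (fun x => P x && (h x == v)))%R.
  rewrite /wsum [RHS](exchange_big_dep P) /= => [|v w _ /andP[]//].
  rewrite big_seq_cond [RHS]big_seq_cond; apply: eq_bigr => w /andP[wW Pw].
  under eq_bigl do rewrite Pw /= eq_sym.
  rewrite -big_filter filter_pred1_uniq ?undup_uniq ?big_seq1 //.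
  by rewrite mem_undup; apply/mapP; exists w; rewrite // mem_filter Pw.
rewrite big_seq big1 // => v; rewrite mem_undup => /mapP[w].
by rewrite mem_filter => /andP[Pw wW] ->; apply: hP.
Qed.

(** The common form of all straightening steps: with [h] the identity it expresses one value of [f]
    by others, with a coarser key it does so for fibre sums. *)
Lemma wsum_fib1 (A : eqType) (h : seq nat -> A) (c : pred A) v0 :
  Sg (fun w => c (h w)) = 0%R ->
  {in W, forall w, c (h w) -> h w != v0 -> Sg (fun x => h x == h w) = 0%R} ->
  c v0 -> Sg (fun x => h x == v0) = 0%R.
Proof.
move=> h0 hc cv0.
have z : Sg (fun w => c (h w) && ~~ (h w == v0)) = 0%R.
  apply: (wsum_fib (h := h)) => w wW /= /andP[cw nw].
  rewrite -(hc w wW cw nw); apply: wsum_ext => x _ /=.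
  by case: (h x =P h w) => [->|_]; rewrite ?cw ?nw ?andbF.
have := wsumID (fun w => c (h w)) (fun w => h w == v0); rewrite h0 z addr0 => ->.
by apply: wsum_ext => w _ /=; case: (h w =P v0) => [->|_]; rewrite ?cv0 ?andbF.
Qed.

End Sums.

Lemma fuse_filter i (p : pred nat) w : (forall x, p (if x == i then i.-1 else x) = p x) ->
  [seq x <- fuse i w | p x] = fuse i [seq x <- w | p x].
Proof.
by move=> h; rewrite /fuse filter_map /=; congr map; apply: eq_filter => x /=; rewrite h.
Qed.

Lemma count_fuse i (p : pred nat) w : (forall x, p (if x == i then i.-1 else x) = p x) ->
  count p (fuse i w) = count p w.
Proof. by move=> h; rewrite count_map; apply: eq_count => x /=; rewrite h. Qed.

Lemma mem_fuse i x w : x != i -> x != i.-1 -> (x \in fuse i w) = (x \in w).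
Proof.
move=> xi xi1; rewrite -!has_pred1 has_map; apply: eq_has => y /=.
by case: (y =P i) => [->|]//; rewrite ![_ == x]eq_sym (negbTE xi) (negbTE xi1).
Qed.

Lemma strip1_fuse i w : 2 < i -> strip1 (fuse i w) = fuse i (strip1 w).
Proof. by move=> i2; apply: fuse_filter => x /=; case: (x =P i); lia. Qed.

Lemma gt2_fuse i w : i != 3 -> gt2 (fuse i w) = fuse i (gt2 w).
Proof. by move=> i3; apply: fuse_filter => x /=; case: (x =P i); lia. Qed.

Lemma gt2_merge2 w : gt2 (fuse 2 w) = gt2 w.
Proof.
rewrite gt2_fuse // /fuse -[RHS]map_id; apply/eq_in_map => x.
by rewrite mem_filter; case: eqP => [->|].
Qed.

Lemma trail_fuse i w : 2 < i -> trail (fuse i w) = trail w.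
Proof.
move=> i2; rewrite /trail size_fuse take_fuse count_fuse; last by move=> x /=; case: (x =P i);
  lia.
by rewrite mem_fuse //; lia.
Qed.

Lemma gt2_strip1 w : gt2 (strip1 w) = gt2 w.
Proof. by rewrite /gt2 /strip1 -filter_predI; apply: eq_filter => x /=; lia. Qed.

Lemma size_strip1 w : size (strip1 w) = size w - count_mem 1 w.
Proof. by rewrite size_filter -(count_predC (pred1 1) w) addnC addnK. Qed.

Lemma trailP w : reflect (w = strip1 w ++ nseq (count_mem 1 w) 1) (trail w).
Proof.
apply: (iffP idP) => [h|h]; last first.
  by rewrite /trail -size_strip1 {2}h take_size_cat // mem_filter.
rewrite /trail in h; move: h; set k := size w - count_mem 1 w => h.
have c0 : count_mem 1 (take k w) = 0 by apply/count_memPn.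
have sd : size (drop k w) = count_mem 1 w.
  by rewrite size_drop /k subKn // count_size.
have cd : count_mem 1 (drop k w) = count_mem 1 w.
  by rewrite -{2}(cat_take_drop k w) count_cat c0.
have ad : drop k w = nseq (count_mem 1 w) 1.
  have /all_pred1P : all (pred1 1) (drop k w) by rewrite all_count cd sd.
  by rewrite sd.
have ft : strip1 (take k w) = take k w.
  by apply/all_filterP/allP => x xw; apply: contraNneq h => <-.
have fw : strip1 w = take k w.
  by rewrite -{1}(cat_take_drop k w) /strip1 filter_cat -/(strip1 _) ft ad filter_nseq /= cats0.
by rewrite fw -ad cat_take_drop.
Qed.

Lemma has_inv_filter i (p : pred nat) w : p i -> p i.-1 -> has_inv i (filter p w) = has_inv i w.
Proof.
move=> pi pi1; elim: w => [|x w IH] //=; case: ifP => px.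
  by rewrite !has_inv_cons IH; case: eqP => // _; rewrite !inE mem_filter pi1.
by rewrite has_inv_cons IH; case: eqP px => [->|] //; rewrite pi.
Qed.

Lemma has_inv_strip1 i w : 2 < i -> has_inv i (strip1 w) = has_inv i w.
Proof. by move=> i2; apply: has_inv_filter; lia. Qed.

Lemma has_inv_gt2 i w : 3 < i -> has_inv i (gt2 w) = has_inv i w.
Proof. by move=> i2; apply: has_inv_filter; lia. Qed.

Lemma has_inv_fuse i j w : j < i.-1 -> has_inv j (fuse i w) = has_inv j w.
Proof.
move=> ji; elim: w => [|x w IH] //=; rewrite !has_inv_cons IH.
have -> : (((if x == i then i.-1 else x) == j) = (x == j)) by case: (x =P i); lia.
case: eqP => // _; rewrite !inE mem_fuse; [|lia|lia].
by congr (_ || _); case: (x =P i); lia.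
Qed.

Lemma has_inv_cat i u v : has_inv i (u ++ v) = if i \in u then (i.-1 \in v) || has_inv i u else
  has_inv i v.
Proof.
elim: u => [|x u IH] //=; rewrite !has_inv_cons IH !in_cons [i == x]eq_sym.
case: (x =P i) => [->|_] //=; rewrite mem_cat.
by case: (i.-1 \in u); case: (i.-1 \in v); rewrite ?orbT ?orbF.
Qed.

Lemma has_inv_last i w : 0 < i -> i \in w -> last 0 w = i.-1 -> has_inv i w.
Proof.
move=> i0; elim/last_ind: w => // w x _; rewrite last_rcons -cats1 has_inv_cat => /[swap] -> iw.
case: ifP => iw'; first by rewrite inE eqxx.
by move: iw; rewrite mem_cat iw' inE /= => /eqP; lia.
Qed.

Lemma last_fuse i w : last 0 (fuse i w) = if (last 0 w == i) && (w != [::]) then i.-1 else last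
  0 w.
Proof.
by case: w => [|x w] /=; rewrite ?andbF // andbT (last_map (fun y =>
  if y == i then i.-1 else y)).
Qed.

Lemma word_val_lt B w : 0 < B -> all (fun x => x < B) w -> word_val B w < B ^ size w.
Proof.
move=> B0; elim: w => //= x w IH /andP[xB /IH]; rewrite expnS; set a := word_val B w; nia.
Qed.

Lemma word_val_cat B u v : word_val B (u ++ v) = word_val B u + B ^ size u * word_val B v.
Proof. by elim: u => [|x u IH] /=; rewrite ?mul1n // IH expnS; lia. Qed.

Lemma word_val_lex B u u' v v' : 0 < B -> all (fun x => x < B) u -> all (fun x => x < B) u' ->
  size u' = size u -> word_val B (u' ++ v') < word_val B (u ++ v) ->
  word_val B v' < word_val B v \/ word_val B v' = word_val B v /\ word_val B u' < word_val B u.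
Proof.
move=> B0 uB u'B sz; rewrite !word_val_cat sz => lt.
have := word_val_lt B0 uB; have := word_val_lt B0 u'B; rewrite sz; move: lt.
set X := B ^ _; move: (word_val B u) (word_val B u') (word_val B v) (word_val B v') =>
  a a' b b'.
case: (ltngtP b' b) => [|h|->]; [by left| |by right; split=> //; lia].
nia.
Qed.

(** * The vanishing theorem on words *)

Lemma wsum_supp T f (P Q : pred (seq nat)) :
  {in permutations T, forall w, f w != 0%R -> P w = Q w} -> wsum T f P = wsum T f Q.
Proof.
move=> h; rewrite /wsum big_mkcond [RHS]big_mkcond /= big_seq [RHS]big_seq.
by apply: eq_bigr => w /h; case: (eqVneq (f w) 0%R) => [->|_ ->//]; rewrite !if_same.
Qed.

Lemma fuse2_inj u v : 1 \notin u -> 1 \notin v -> fuse 2 u = fuse 2 v -> u = v.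
Proof.
elim: u v => [|x u IH] [|y v] //=; rewrite !inE !negb_or => /andP[x1 u1] /andP[y1 v1] [xy uv].
by rewrite (IH v) //; congr (_ :: _); move: xy; case: eqP; case: eqP; lia.
Qed.

Lemma last_class i w w' : fuse i w' = fuse i w -> 0 < i -> last 0 w != i -> last 0 w != i.-1 ->
  last 0 w' = last 0 w.
Proof.
move=> e i0; have := congr1 (last 0) e; rewrite !last_fuse.
case: (w' =P [::]) => [->|_]; case: (w =P [::]) => [->|_]; rewrite ?andbF ?andbT //=;
 do ?case: ifP; lia.
Qed.

Lemma has_inv2E l w : 1 \in drop l w -> has_inv 2 w = (2 \in take l w) || has_inv 2 (drop l w).
Proof. by move=> h; rewrite -{1}(cat_take_drop l w) has_inv_cat h; case: ifP. Qed.

Lemma last_strip1 w : last 0 w != 1 -> last 0 w = last 0 (strip1 w).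
Proof.
by elim/last_ind: w => // w x _; rewrite last_rcons /strip1 filter_rcons => ->;
  rewrite last_rcons.
Qed.

Lemma size_gt2 w : 0 \notin w -> size w = size (gt2 w) + count_mem 1 w + count_mem 2 w.
Proof.
elim: w => //= x w IH; rewrite inE negb_or => /andP[x0 /IH ->].
by case: x x0 => [|[|[|x]]] //= _; lia.
Qed.

Lemma trail_last w : trail w -> 1 \in w -> last 0 w = 1.
Proof.
move=> /trailP ->; rewrite mem_cat mem_filter /= mem_nseq eqxx andbT last_cat.
case: (count_mem 1 w) => //= k _; have := mem_last 1 (nseq k 1).
by rewrite inE mem_nseq => /orP[/eqP|/andP[_ /eqP]].
Qed.

Lemma take_nseq_min (a : nat) n k : take k (nseq n a) = nseq (minn k n) a.
Proof. by elim: n k => [|n IH] [|k] //=; rewrite ?minn0 // IH minnSS. Qed.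

Lemma drop_nseq_sub (a : nat) n k : drop k (nseq n a) = nseq (n - k) a.
Proof. by elim: n k => [|n IH] [|k] //=. Qed.

Lemma strip1_id u : 1 \notin u -> strip1 u = u.
Proof. by move=> h; apply/all_filterP/allP => a au; apply: contraNneq h => <-. Qed.

(** Each of two different such words would be strictly below the other in [word_val]; the base 2 is
    arbitrary. *)
Lemma noninv_inj i u v : 0 < i -> fuse i u = fuse i v -> ~~ has_inv i u -> ~~ has_inv i v ->
  count_mem i u = count_mem i v -> u = v.
Proof.
move=> i0 e nu nv ec; have [//|lt1] := @word_val_class 2 i v u isT i0 e nv (eq_leq ec).
have [//|lt2] := @word_val_class 2 i u v isT i0 (esym e) nu (eq_leq (esym ec)).
by have := ltn_trans lt1 lt2; rewrite ltnn.
Qed.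

Lemma count_merge2 u : count_mem 1 (fuse 2 u) = count_mem 1 u + count_mem 2 u.
Proof. by elim: u => //= x u ->; rewrite addnACA; congr (_ + _); case: x => [|[|[|x]]]. Qed.

Lemma no2_strip1_gt2 u : 0 \notin u -> 2 \notin u -> strip1 u = gt2 u.
Proof.
move=> u0 u2; apply: eq_in_filter => a au; case: a au => [|[|[|a]]] //.
  by rewrite (negbTE u0).
by rewrite (negbTE u2).
Qed.

Section Main.
Variables (m : nat) (T : seq nat) (f : seq nat -> rat).
Local Notation Sg := (wsum T f).
Local Notation W := (permutations T).
Local Notation N := (size T).
Local Notation r := (count_mem 1 T).
Local Notation s := (count_mem 2 T).
Local Notation B := m.+1.
Hypothesis m2 : 1 < m.
Hypothesis mT : forall x, (x \in T) = (0 < x <= m).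
Hypothesis HR : forall i (P : pred (seq nat)), 1 < i <= m -> Sg (fun w => P (fuse i w)) = 0%R.
Hypothesis HR1 : forall P : pred (seq nat), Sg (fun w => P (strip1 w)) = 0%R.
Hypothesis f_pure_inv : {in W, forall w, (forall i, 1 < i <= m -> has_inv i w) -> ~~ trail w ->
  f w = 0%R}.

Lemma Wcount p w : w \in W -> count p w = count p T.
Proof. by rewrite mem_permutations => /permP. Qed.

Lemma Wsize w : w \in W -> size w = N.
Proof. by rewrite mem_permutations => /perm_size. Qed.

Lemma Wmem w x : w \in W -> (x \in w) = (0 < x <= m).
Proof. by rewrite mem_permutations => /perm_mem ->. Qed.

Lemma W0 w : w \in W -> 0 \notin w.
Proof. by move=> /Wmem ->. Qed.

Lemma WB w : w \in W -> all (fun x => x < B) w.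
Proof. by move=> wW; apply/allP => x; rewrite (Wmem _ wW) ltnS => /andP[]. Qed.

Lemma r_gt0 : 0 < r. Proof. by rewrite -has_count has_pred1 mT; lia. Qed.
Lemma s_gt0 : 0 < s. Proof. by rewrite -has_count has_pred1 mT; lia. Qed.
Lemma rN : r <= N. Proof. exact: count_size. Qed.

Lemma wsum1 w : w \in W -> Sg (fun x => x == w) = f w.
Proof.
move=> wW; rewrite /wsum -big_filter filter_pred1_uniq ?big_seq1 //.
exact: permutations_uniq.
Qed.

Lemma class_lt i w w' : 1 < i -> w \in W -> w' \in W -> fuse i w' = fuse i w ->
  ~~ has_inv i w -> w' != w -> word_val B w' < word_val B w.
Proof.
move=> i1 wW w'W e ni; have [|||->|//] := @word_val_class B i w w' _ _ e ni; try lia.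
  by rewrite !Wcount.
by rewrite eqxx.
Qed.

Lemma straighten i w : 1 < i <= m -> w \in W -> ~~ has_inv i w ->
  {in W, forall w', fuse i w' = fuse i w -> word_val B w' < word_val B w -> f w' = 0%R} ->
    f w = 0%R.
Proof.
move=> im wW ni h; rewrite -wsum1 //.
apply: (@wsum_fib1 _ _ _ id (fun x => fuse i x == fuse i w)) => //.
  exact: (HR (fun z => z == fuse i w)).
move=> w' w'W /eqP e nw; rewrite wsum1 //; apply: h => //.
by apply: class_lt e ni nw => //; case/andP: im.
Qed.

Lemma has_inv_case k w : (forall i, k < i <= m ->
  has_inv i w) \/ exists2 i, k < i <= m & ~~ has_inv i w.
Proof.
case: (boolP (all (fun i => has_inv i w) (iota k.+1 (m - k)))) => [/allP h|/allPn[i]].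
  by left=> i im; apply: h; rewrite mem_iota; lia.
by rewrite mem_iota => im; right; exists i => //; lia.
Qed.

(** A final 1 gives the inversion of 2 for free, and fusing some [i > 2] affects neither the final 1
    nor [trail], so straightening stays among these words. *)
Lemma last1_eq0 w : w \in W -> last 0 w = 1 -> ~~ trail w -> f w = 0%R.
Proof.
have [n] := ubnP (word_val B w); elim: n w => // n IH w vn wW l1 nt.
have [h|[i im ni]] := has_inv_case 2 w.
  apply: f_pure_inv => // i im; have [i2|i2] := eqVneq i 2; last by apply: h; lia.
  by rewrite i2; apply: has_inv_last => //; rewrite (Wmem _ wW); lia.
apply: (straighten _ wW ni); first lia.
move=> w' w'W e lt; apply: IH => //; first lia.
  by rewrite (last_class e) ?l1; lia.
by rewrite -(@trail_fuse i) ?e ?trail_fuse //; lia.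
Qed.

(** A final 2 supplies the inversion of 3, so only some [i > 3] can lack one. Fusing such an [i]
    keeps the final 2 and, since [2 < i.-1], the inversion of 2. *)
Lemma last2_eq0 w : w \in W -> last 0 w = 2 -> has_inv 2 w -> f w = 0%R.
Proof.
have [n] := ubnP (word_val B w); elim: n w => // n IH w vn wW l2 i2.
have [h|[i im ni]] := has_inv_case 2 w.
  apply: f_pure_inv => // [i im|]; first by have [->//|ni2] := eqVneq i 2; apply: h; lia.
  apply/negP => /trail_last; rewrite (Wmem _ wW) l2 => l1.
  by suff: 2 = 1 by []; apply: l1; lia.
have i4 : 3 < i.
  rewrite ltnNge; apply/negP => i3; case/negP: ni; have -> : i = 3 by lia.
  by apply: has_inv_last => //; rewrite (Wmem _ wW); lia.
apply: (straighten _ wW ni); first lia.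
move=> w' w'W e lt; apply: IH => //; first lia.
  by rewrite (last_class e) ?l2; lia.
by rewrite -(@has_inv_fuse i) ?e ?has_inv_fuse //; lia.
Qed.

(* Sums over the fibres of these keys are shown to vanish, down to the key
   [trail_key 0], which determines a word. The prefix of length l counts only
   through its letters > 1, resp. > 2. *)
Definition prefix_key l (x : seq nat) := (strip1 (take l x), drop l x).
Definition trail_key l (x : seq nat) := (trail x, (gt2 (take l x), drop l x)).
Definition fused_key l (x : seq nat) := (gt2 (take l x), fuse 2 (drop l x)).

Lemma trailW x : x \in W -> trail x -> x = strip1 x ++ nseq r 1.
Proof. by move=> xW /trailP; rewrite (Wcount _ xW). Qed.

Lemma size_fltW x : x \in W -> size (strip1 x) = N - r.
Proof. by move=> xW; rewrite size_strip1 (Wsize xW) (Wcount _ xW). Qed.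

Lemma strip1_no1 x : 1 \notin strip1 x. Proof. by rewrite mem_filter. Qed.

Lemma trail_take l x : x \in W -> trail x -> l <= N - r -> take l x = take l (strip1 x).
Proof. by move=> xW /trailW -/(_ xW) {1}-> lN; rewrite takel_cat // size_fltW. Qed.

Lemma trail_drop l x : x \in W -> trail x -> l <= N - r ->
  drop l x = drop l (strip1 x) ++ nseq r 1.
Proof.
move=> xW /trailW -/(_ xW) {1}-> lN; rewrite drop_cat size_fltW //; case: ltnP => // lN'.
have -> : l = N - r by lia.
by rewrite subnn drop0 drop_oversize // size_fltW.
Qed.

(** In a trailing word the letters 1 are exactly those from place [N - r] on, so fusing 2 with 1
    loses nothing. A cut beyond [N - r] falls into the block of letters 1, which [gt2] ignores;
    hence the minimum. *)
Lemma fused_key_trail_key l x y : x \in W -> y \in W -> trail x -> trail y ->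
  (fused_key l x == fused_key l y) = (trail_key (minn l (N - r)) x == trail_key (minn l (N -
    r)) y).
Proof.
move=> xW yW tx ty; case: (leqP l (N - r)) => lN.
  rewrite /fused_key /trail_key !xpair_eqE tx ty (trail_drop xW tx lN) (trail_drop yW ty lN)
    !fuse_cat /=.
  congr andb.
  rewrite !eqseq_cat ?size_fuse ?size_drop ?size_fltW // !eqxx !andbT.
  have nd z : 1 \notin drop l (strip1 z) by apply: contra (strip1_no1 z) => /mem_drop.
  by apply/eqP/eqP => [|->//]; apply: fuse2_inj.
rewrite /fused_key /trail_key !xpair_eqE tx ty (trail_drop xW tx (leqnn _)) (trail_drop yW ty
  (leqnn _)).
rewrite !(@drop_oversize _ (N - r) (strip1 _)) ?size_fltW //= eqxx andbT.
have H z : z \in W -> trail z -> gt2 (take l z) = gt2 (take (N - r) z) /\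
    drop l z = nseq (N - l) 1.
  move=> zW tz; have et : take l z = strip1 z ++ nseq (minn (l - (N - r)) r) 1.
    by rewrite {1}(trailW zW tz) take_cat size_fltW // ltnNge (ltnW lN) /= take_nseq_min.
  have ed : drop l z = nseq (r - (l - (N - r))) 1.
    by rewrite {1}(trailW zW tz) drop_cat size_fltW // ltnNge (ltnW lN) /= drop_nseq_sub.
  rewrite et ed (trail_take zW tz (leqnn _)) take_oversize ?size_fltW //; split.
    by rewrite /gt2 filter_cat filter_nseq /= cats0.
  by congr nseq; have := rN; lia.
by have [-> ->] := H x xW tx; have [-> ->] := H y yW ty; rewrite eqxx andbT.
Qed.

Lemma trail_sum0 l v :
  {in W, forall x, trail x -> fused_key l x = v ->
    Sg (fun y => trail_key (minn l (N - r)) y == trail_key (minn l (N - r)) x) = 0%R} ->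
  Sg (fun x => trail x && (fused_key l x == v)) = 0%R.
Proof.
move=> h; apply: (wsum_fib (h := trail_key (minn l (N - r)))) => x xW /= /andP[tx /eqP hx].
rewrite -(h x xW tx hx); apply: wsum_ext => y yW /=; case: (boolP (trail y)) => ty /=.
  by rewrite -hx fused_key_trail_key // andbb.
by apply/esym/negP => /eqP[e]; rewrite e tx in ty.
Qed.

Lemma trail_sumE l x : x \in W -> trail x ->
  Sg (fun y => trail y && (fused_key l y == fused_key l x)) =
  Sg (fun y => trail_key (minn l (N - r)) y == trail_key (minn l (N - r)) x).
Proof.
move=> xW tx; apply: wsum_ext => y yW /=; case: (boolP (trail y)) => ty /=.
  by rewrite fused_key_trail_key.
by apply/esym/negP => /eqP[e]; rewrite e tx in ty.
Qed.

Definition trail_match l (y z : seq nat) := (gt2 (take l z) == gt2 (take l y)) && (drop l z ==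
  drop l y).
(** Here [y] has lost its letters 1 and [x] has not, whence the shift by [r]: the two cuts
    correspond when all letters 1 of [x] lie before its cut. *)
Definition fused_match l (y x : seq nat) :=
  (gt2 (take (l + r) x) == gt2 (take l y)) && (fuse 2 (drop (l + r) x) == fuse 2 (drop l y)).

Lemma no1_size_gt2 u : 1 \notin u -> 0 \notin u -> size u = size (gt2 u) + count_mem 2 u.
Proof. by move=> /count_memPn u1 /size_gt2; rewrite u1; lia. Qed.

(** Without an inversion of 2, all letters 1 of [x] precede its first 2. If a 2 occurs among the
    first [l + 1] letters of [strip1 x], then all [r] letters 1 are among the first [l + r] letters
    of [x], and cutting [strip1 x] at [l] amounts to cutting [x] at [l + r]. *)
Lemma trail_fused_match l (w x : seq nat) : w \in W -> x \in W -> l <= N - r ->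
  2 \in take l.+1 (strip1 w) -> ~~ has_inv 2 x ->
  trail_match l (strip1 w) (strip1 x) = fused_match l (strip1 w) x.
Proof.
move=> wW xW lN; move: (size_fltW wW) (strip1_no1 w).
have: 0 \notin strip1 w by rewrite mem_filter (negbTE (W0 wW)) andbF.
move: (strip1 w) => y y0 sy y1 w2 nx; have Nr := rN.
have lrN : l + r <= N by move: lN Nr; clear; lia.
have sz : size (strip1 x) = N - r by rewrite size_fltW.
have z1 : 1 \notin strip1 x by rewrite strip1_no1.
have z0 : 0 \notin strip1 x by rewrite mem_filter (negbTE (W0 xW)) andbF.
have nt (u : seq nat) a k : a \notin u -> a \notin take k u by apply: contra => /mem_take.
have nd (u : seq nat) a k : a \notin u -> a \notin drop k u by apply: contra => /mem_drop.
have key : 1 \notin drop (l + r) x ->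
    take l (strip1 x) = strip1 (take (l + r) x) /\ drop l (strip1 x) = drop (l + r) x.
  move=> d1; have fd := strip1_id d1.
  have fx : strip1 x = strip1 (take (l + r) x) ++ drop (l + r) x.
    by rewrite -{1}(cat_take_drop (l + r) x) /strip1 filter_cat -/(strip1 _) -/(strip1 _) fd.
  have sl : size (strip1 (take (l + r) x)) = l.
    move: sz; rewrite fx size_cat size_drop (Wsize xW); move: lrN; clear; lia.
  by rewrite fx take_size_cat // drop_size_cat.
apply/idP/idP.
  move=> /andP[/eqP hb /eqP hd].
  (* The two prefixes of length [l] agree after [gt2] and contain no 1, so they have equally many
     letters 2. *)
  have t2 : 2 \in take l.+1 (strip1 x).
    have E u : size u = N - r -> take l.+1 u = take l u ++ take 1 (drop l u).
      by move=> su; rewrite -addn1 takeD.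
    rewrite (E _ _ sz) mem_cat hd; move: w2; rewrite (E _ _ sy) mem_cat.
    case/orP=> [|->]; last by rewrite orbT.
    rewrite -!has_pred1 !has_count => c2.
    have := no1_size_gt2 (nt _ _ l y1) (nt _ _ l y0).
    have := no1_size_gt2 (nt _ _ l z1) (nt _ _ l z0).
    rewrite hb !size_takel ?sy ?sz // => e1 e2; apply/orP; left.
    by move: c2 e1 e2; clear; lia.
  have x2 : 2 \in x by rewrite (Wmem _ xW).
  have d1 : 1 \notin drop (index 2 x) x by exact: nx.
  have kx : index 2 x <= l + r.
    have i2 : index 2 (strip1 x) <= l.
      by rewrite -ltnS; exact: index_ltn.
    apply: leq_trans (_ : index 2 (strip1 x) + r <= _); last by rewrite leq_add2r.
    have ti : index 2 (strip1 (take (index 2 x) x)) = size (strip1 (take (index 2 x) x)).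
      by apply: memNindex; rewrite mem_filter /=; apply/negP => /index_ltn; rewrite ltnn.
    rewrite -{2}(cat_take_drop (index 2 x) x) /strip1 filter_cat -/(strip1 _) index_cat.
    case: ifP => [|_]; first by rewrite -index_mem ti ltnn.
    rewrite size_strip1 size_takel ?index_size //.
    have : count_mem 1 (take (index 2 x) x) <= r.
      rewrite -(Wcount _ xW) -[leqRHS](congr1 _ (cat_take_drop (index 2 x) x)) count_cat.
      exact: leq_addr.
    by have := index_size 2 x; have := count_size (pred1 1) (take (index 2 x) x); clear; lia.
  have dd : 1 \notin drop (l + r) x.
    rewrite -(subnK kx) -drop_drop; exact: nd.
  have [e1 e2] := key dd.
  by rewrite /fused_match -e2 hd eqxx andbT -hb e1 gt2_strip1.
move=> /andP[/eqP hb /eqP hd].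
(* A 1 beyond [l + r] would leave the prefix without a 2, with fewer than [r] letters 1 and with at
   most [l] letters above 2, too few to fill [l + r] places. *)
have dd : 1 \notin drop (l + r) x.
  apply/negP => d1; have t2 : 2 \notin take (l + r) x.
    by apply: contra nx => t2; rewrite (has_inv2E d1) t2.
  have := size_gt2 (nt _ _ (l + r) (W0 xW)).
  rewrite (count_memPn t2) hb size_takel; last by rewrite (Wsize xW).
  have := no1_size_gt2 (nt _ _ l y1) (nt _ _ l y0); rewrite size_takel ?sy // => e1 e2.
  have cd : 0 < count_mem 1 (drop (l + r) x) by rewrite -has_count has_pred1.
  have ct : count_mem 1 (take (l + r) x) + count_mem 1 (drop (l + r) x) = r.
    by rewrite -count_cat cat_take_drop Wcount.
  have A a b k i c d : 0 < b -> a + b = k -> i = c + d -> i + k = c + a + 0 -> False by clear;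
    lia.
  exact: A cd ct e1 e2.
have [e1 e2] := key dd.
rewrite /trail_match e1 gt2_strip1 hb eqxx /= e2; apply/eqP; apply: fuse2_inj => //; exact: nd.
Qed.

Definition lexlt (u' v' u v : seq nat) :=
  word_val B v' < word_val B v \/ word_val B v' = word_val B v /\ word_val B u' < word_val B u.

Lemma class_lex i u v u' v' : 1 < i -> fuse i u' = fuse i u -> fuse i v' = fuse i v ->
  all (fun x => x < B) (u ++ v) -> all (fun x => x < B) (u' ++ v') ->
  ~~ has_inv i (u ++ v) -> count_mem i (u' ++ v') = count_mem i (u ++ v) ->
    (u', v') <> (u, v) ->
  lexlt u' v' u v.
Proof.
move=> i1 eu ev aB aB' ni ec ne.
have su : size u' = size u by rewrite -(size_fuse i u') eu size_fuse.
apply: word_val_lex => //; first by move: aB; rewrite all_cat => /andP[].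
  by move: aB'; rewrite all_cat => /andP[].
have em : fuse i (u' ++ v') = fuse i (u ++ v) by rewrite !fuse_cat eu ev.
have B1 : 1 < B by apply: ltn_trans m2 _.
have [e|//] := word_val_class B1 (ltnW i1) em ni (eq_leq ec).
by case: ne; move/eqP: e; rewrite eqseq_cat // => /andP[/eqP-> /eqP->].
Qed.

(** For [i > 2] the key, read as the word [strip1 (take l w) ++ drop l w], keeps all letters [i] and
    [i - 1]; so it is inverted at [i] exactly when [w] is, and straightens like a word. *)
Lemma prefix_key_class i l w : 2 < i <= m -> w \in W -> ~~ has_inv i w ->
  {in W, forall w', fuse i (strip1 (take l w')) = fuse i (strip1 (take l w)) ->
     fuse i (drop l w') = fuse i (drop l w) ->
     lexlt (strip1 (take l w')) (drop l w') (strip1 (take l w)) (drop l w) ->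
     Sg (fun x => prefix_key l x == prefix_key l w') = 0%R} ->
  Sg (fun x => prefix_key l x == prefix_key l w) = 0%R.
Proof.
move=> im wW ni h.
pose c (v : seq nat * seq nat) := (fuse i v.1 == fuse i (strip1 (take l w))) &&
  (fuse i v.2 == fuse i (drop l w)).
have fu z : strip1 (strip1 (take l z) ++ drop l z) = strip1 z.
  by rewrite {1}/strip1 filter_cat filter_id -/(strip1 (drop l z)) -filter_cat cat_take_drop.
have ac z : z \in W -> all (fun x => x < B) (strip1 (take l z) ++ drop l z).
  move=> zW; have := WB zW; rewrite -{1}(cat_take_drop l z) !all_cat => /andP[h1 ->].
  by rewrite andbT; apply/allP => a; rewrite mem_filter => /andP[_ /(allP h1)].
have cc z : z \in W -> count_mem i (strip1 (take l z) ++ drop l z) = count_mem i T.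
  move=> zW; rewrite -(Wcount _ zW) -[in RHS](cat_take_drop l z) !count_cat /strip1
    count_filter.
  by congr (_ + _); apply: eq_count => a /=; move: im; clear; lia.
apply: (@wsum_fib1 _ _ _ (prefix_key l) c) => [|x xW /andP[/eqP e1 /eqP e2] nx|].
- rewrite -[RHS](@HR i (fun z => (strip1 (take l z) == fuse i (strip1 (take l w))) &&
     (drop l z == fuse i (drop l w)))); last lia.
  by apply: wsum_ext => x _; rewrite take_fuse drop_fuse strip1_fuse //; lia.
- apply: h => //; apply: (class_lex _ e1 e2); rewrite ?ac ?cc //; first lia.
    by rewrite -has_inv_strip1 ?fu ?has_inv_strip1 //; lia.
  by move=> e; move/eqP: nx; apply; exact: e.
- by rewrite /c !eqxx.
Qed.

(** As for [prefix_key_class], but [gt2] keeps the letter [i - 1] only for [i > 3]; the letter 3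
    needs an argument of its own. *)
Lemma trail_key_class i l w : 3 < i <= m -> w \in W -> trail w -> ~~ has_inv i w ->
  {in W, forall w', trail w' -> fuse i (gt2 (take l w')) = fuse i (gt2 (take l w)) ->
     fuse i (drop l w') = fuse i (drop l w) ->
     lexlt (gt2 (take l w')) (drop l w') (gt2 (take l w)) (drop l w) ->
     Sg (fun x => trail_key l x == trail_key l w') = 0%R} ->
  Sg (fun x => trail_key l x == trail_key l w) = 0%R.
Proof.
move=> im wW tw ni h.
pose c (v : bool * (seq nat * seq nat)) := [&& v.1, fuse i v.2.1 == fuse i (gt2 (take l w)) &
  fuse i v.2.2 == fuse i (drop l w)].
have fu z : gt2 (gt2 (take l z) ++ drop l z) = gt2 z.
  by rewrite {1}/gt2 filter_cat filter_id -/(gt2 (drop l z)) -filter_cat cat_take_drop.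
have ac z : z \in W -> all (fun x => x < B) (gt2 (take l z) ++ drop l z).
  move=> zW; have := WB zW; rewrite -{1}(cat_take_drop l z) !all_cat => /andP[h1 ->].
  by rewrite andbT; apply/allP => a; rewrite mem_filter => /andP[_ /(allP h1)].
have cc z : z \in W -> count_mem i (gt2 (take l z) ++ drop l z) = count_mem i T.
  move=> zW; rewrite -(Wcount _ zW) -[in RHS](cat_take_drop l z) !count_cat /gt2 count_filter.
  by congr (_ + _); apply: eq_count => a /=; move: im; clear; lia.
apply: (@wsum_fib1 _ _ _ (trail_key l) c) => [|x xW /and3P[tx /eqP e1 /eqP e2] nx|].
- rewrite -[RHS](@HR i (fun z => [&& trail z, gt2 (take l z) == fuse i (gt2 (take l w)) &
     drop l z == fuse i (drop l w)])); last lia.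
  by apply: wsum_ext => x _; rewrite take_fuse drop_fuse gt2_fuse ?trail_fuse //; lia.
- apply: h => //; apply: (class_lex _ e1 e2); rewrite ?ac ?cc //; first lia.
    by rewrite -has_inv_gt2 ?fu ?has_inv_gt2 //; lia.
  by move=> [e e']; move/eqP: nx; apply; rewrite /trail_key e e' tw; congr pair; exact: tx.
- by rewrite /c !eqxx /= tw.
Qed.

(** As [gt2] forgets the letters 2 of the prefix, the relation at 3 is visible only when the letters
    3 of the prefix are forgotten too. Another key in the class either has moved letters 3 into the
    prefix, leaving fewer letters above 2 in the suffix, or has the same prefix part and as many
    letters 3 in the suffix. *)
Lemma trail_key_class3 l w : 2 < m -> w \in W -> trail w -> 3 \notin take l w ->
  {in W, forall w', trail w' -> fuse 3 (drop l w') = fuse 3 (drop l w) ->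
     trail_key l w' != trail_key l w ->
     size (gt2 (drop l w')) < size (gt2 (drop l w)) \/
     [/\ 3 \notin take l w', gt2 (take l w') = gt2 (take l w) &
      count_mem 3 (drop l w') = count_mem 3 (drop l w)] ->
     Sg (fun x => trail_key l x == trail_key l w') = 0%R} ->
  Sg (fun x => trail_key l x == trail_key l w) = 0%R.
Proof.
move=> m3 wW tw n3 h.
pose c (v : bool * (seq nat * seq nat)) :=
  [&& v.1, [seq x <- v.2.1 | 3 < x] == gt2 (take l w) & fuse 3 v.2.2 == fuse 3 (drop l w)].
have f3 z : [seq x <- gt2 z | 3 < x] = [seq x <- z | 3 < x].
  by rewrite -filter_predI; apply: eq_filter => x /=; lia.
apply: (@wsum_fib1 _ _ _ (trail_key l) c) => [|x xW /and3P[/= tx /eqP e1 /eqP e2] nx|].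
- rewrite -[RHS](@HR 3 (fun z => [&& trail z, [seq x <- take l z | 3 < x] == gt2 (take l w) &
     drop l z == fuse 3 (drop l w)])); last lia.
  apply: wsum_ext => x _; rewrite take_fuse drop_fuse trail_fuse // /c /= f3.
  congr (_ && (_ && _)); rewrite fuse_filter; last by move=> a /=; case: (a =P 3); lia.
  congr (_ == _); rewrite /fuse -[LHS]map_id; apply/eq_in_map => a.
  by rewrite mem_filter; case: (a =P 3) => [->|].
- apply: h => //.
  have sb z : size (gt2 z) = count_mem 3 z + size [seq x <- z | 3 < x].
    rewrite !size_filter; elim: z => //= a z ->; rewrite addnACA; congr (_ + _).
    by case: a => [|[|[|[|a]]]].
  have s3 z z' : fuse 3 z = fuse 3 z' ->
     size [seq x <- z | 3 < x] = size [seq x <- z' | 3 < x].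
    move=> e; have E v : size [seq x <- v | 3 < x] = size [seq x <- fuse 3 v | 3 < x].
      by rewrite fuse_filter ?size_fuse // => a /=; case: (a =P 3); lia.
    by rewrite E e -E.
  have c3 : count_mem 3 (take l x) + count_mem 3 (drop l x) = count_mem 3 (drop l w).
    rewrite -count_cat cat_take_drop (Wcount _ xW) -(Wcount _ wW).
    by rewrite -[in LHS](cat_take_drop l w) count_cat (count_memPn n3).
  have [c0|c0] := posnP (count_mem 3 (take l x)); last by left;
    rewrite !sb (s3 _ _ e2) ltn_add2r -c3 -[ltnLHS]add0n ltn_add2r.
  right; have nt : 3 \notin take l x by apply/count_memPn.
  split=> //; last by rewrite -c3 c0.
  rewrite -e1 f3; apply: eq_in_filter => a ax; apply/idP/idP; last lia.
  by move=> a2; rewrite ltn_neqAle a2 andbT; apply: contraNneq nt => ->.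
- rewrite /c /= tw eqxx andbT /= f3; apply/eqP; apply: eq_in_filter => a ax.
  apply/idP/idP; first lia.
  by move=> a2; rewrite ltn_neqAle a2 andbT; apply: contraNneq n3 => ->.
Qed.

(** The fibres of [fused_key l] are unions of classes of [fuse 2], because fusing 2 with 1 does not
    affect [gt2]. *)
Lemma sum_fused_key l v : Sg (fun x => fused_key l x == v) = 0%R.
Proof.
rewrite -[RHS](@HR 2 (fun z => (gt2 (take l z) == v.1) && (drop l z == v.2))); last
  by rewrite m2.
by apply: wsum_ext => x _; rewrite take_fuse drop_fuse gt2_merge2; case: v.
Qed.

Lemma prefix_key_inv2 l x w : prefix_key l x = prefix_key l w -> 1 \in drop l w ->
  has_inv 2 x = has_inv 2 w.
Proof.
move=> [e1 e2] d1; rewrite (has_inv2E d1) (@has_inv2E l x) e2 //; congr orb.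
have E z : (2 \in take l z) = (2 \in strip1 (take l z)) by rewrite mem_filter.
by rewrite E e1 -E.
Qed.

Lemma last_drop l (x : seq nat) : drop l x != [::] -> last 0 x = last 0 (drop l x).
Proof. by move=> d; rewrite -{1}(cat_take_drop l x) last_cat; case: (drop l x) d. Qed.

Lemma prefix_key_last l x w : prefix_key l x = prefix_key l w -> drop l w != [::] ->
  last 0 x = last 0 w.
Proof. by move=> [_ e2] d; rewrite (last_drop d) (@last_drop l x) e2. Qed.

Lemma not_trail w : w \in W -> last 0 w != 1 -> ~~ trail w.
Proof.
by move=> wW; apply: contraNN => tw; rewrite (trail_last tw) // (Wmem _ wW); move: m2; clear;
  lia.
Qed.

Lemma count_split p l w : w \in W -> count p (take l w) + count p (drop l w) = count p T.
Proof. by move=> wW; rewrite -count_cat cat_take_drop Wcount. Qed.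

Lemma not_inv2_take l w : 1 \in drop l w -> ~~ has_inv 2 w -> 2 \notin take l w.
Proof. by move=> d1; rewrite (has_inv2E d1) negb_or => /andP[]. Qed.

Lemma not_inv2_drop l w : 1 \in drop l w -> ~~ has_inv 2 w -> ~~ has_inv 2 (drop l w).
Proof. by move=> d1; rewrite (has_inv2E d1) negb_or => /andP[]. Qed.

Lemma not_inv2_count l w : w \in W -> 1 \in drop l w -> ~~ has_inv 2 w ->
  count_mem 2 (drop l w) = s.
Proof. by move=> wW d1 n2; rewrite -(count_split _ l wW) (count_memPn (not_inv2_take d1 n2)).
  Qed.

Lemma prefix_key_fused_key l x w : prefix_key l x = prefix_key l w ->
  fused_key l x = fused_key l w.
Proof. by move=> [e1 e2]; rewrite /fused_key e2 -gt2_strip1 e1 gt2_strip1. Qed.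

Lemma no0_take l w : w \in W -> 0 \notin take l w.
Proof. by move=> wW; apply: contra (W0 wW) => /mem_take. Qed.

Lemma opp_sum P Q : (Sg P + Sg Q)%R = 0%R -> Sg P = (- Sg Q)%R.
Proof. by move/eqP; rewrite addr_eq0 => /eqP. Qed.

(** The words whose stripped form matches [strip1 w] are a union of classes of [strip1], and the
    trailing ones among them are the fibre of [trail_key l]. *)
Lemma trail_key_strip1 l w : w \in W -> trail w -> l <= N - r ->
  Sg (fun x => trail_key l x == trail_key l w) = (- Sg (fun x =>
    trail_match l (strip1 w) (strip1 x) && ~~ trail x))%R.
Proof.
move=> wW tw lN; apply: opp_sum.
rewrite -(HR1 (trail_match l (strip1 w))) [RHS](wsumID _ _ _ trail); congr (_ + _)%R.
apply: wsum_ext => x xW; rewrite andbC /trail_key tw !xpair_eqE eqb_id.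
case: (boolP (trail x)) => //= tx.
rewrite (trail_drop xW tx lN) (trail_drop wW tw lN) (trail_take xW tx lN) (trail_take wW tw lN).
by rewrite eqseq_cat ?size_drop ?size_fltW // eqxx andbT.
Qed.

Lemma fused_matchE l w x : fused_match l (strip1 w) x = (fused_key (l + r) x == (gt2 (take l
  (strip1 w)), fuse 2 (drop l (strip1 w)))).
Proof. by rewrite xpair_eqE. Qed.

Lemma sum_fused_match l w : Sg (fused_match l (strip1 w)) = 0%R.
Proof.
rewrite -[RHS](sum_fused_key (l + r) (gt2 (take l (strip1 w)), fuse 2 (drop l (strip1 w)))).
by apply: wsum_ext => x _; rewrite fused_matchE.
Qed.

Lemma drop_strip1_nil l w : w \in W -> l < N - r -> drop l (strip1 w) != [::].
Proof. by move=> wW lN; rewrite -size_eq0 size_drop size_fltW // subn_eq0 -ltnNge. Qed.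

Lemma trail_match_last l w x : w \in W -> l < N - r -> last 0 x != 1 ->
  trail_match l (strip1 w) (strip1 x) ->
  last 0 x = last 0 (strip1 w).
Proof.
move=> wW lN l1 /andP[_ /eqP e]; have d := drop_strip1_nil wW lN.
by rewrite (last_strip1 l1) (last_drop d) -e (@last_drop l) // e.
Qed.

Lemma fused_match_last l w x : w \in W -> l < N - r -> fused_match l (strip1 w) x ->
  fuse 2 [:: last 0 x] = fuse 2 [:: last 0 (strip1 w)] /\ drop (l + r) x != [::].
Proof.
move=> wW lN /andP[_ /eqP e]; have d := drop_strip1_nil wW lN.
have dx : drop (l + r) x != [::] by rewrite -size_eq0 -(size_fuse 2) e size_fuse size_eq0.
split=> //; have := congr1 (last 0) e; rewrite !last_fuse d dx !andbT /=.
by rewrite -(last_drop d) -(last_drop dx) => ->.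
Qed.

(** Where [f] is nonzero, a non-trailing word on either side ends in 2 by [last1_eq0], and then has
    no inversion of 2 by [last2_eq0], so [trail_fused_match] exchanges the two relations. The effect
    is to move the cut from [l] to [l + r]. *)
Lemma trail_key_last2 l w : w \in W -> trail w -> l < N - r -> 2 \in take l.+1 (strip1 w) ->
  last 0 (strip1 w) = 2 ->
  Sg (fun x => trail_key l x == trail_key l w) =
  Sg (fun x => trail x && (fused_key (l + r) x == (gt2 (take l (strip1 w)), fuse 2 (drop l
    (strip1 w))))).
Proof.
move=> wW tw lN w2 l2; rewrite (trail_key_strip1 wW tw (ltnW lN)).
have -> : Sg (fun x => trail_match l (strip1 w) (strip1 x) && ~~ trail x) = Sg (fun x =>
  fused_match l (strip1 w) x && ~~ trail x).
  apply: wsum_supp => x xW fx; case: (boolP (trail x)) => tx; rewrite ?andbF ?andbT //.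
  have x1 : last 0 x != 1 by apply: contra fx => /eqP x1; rewrite last1_eq0.
  have E : last 0 x = 2 -> trail_match l (strip1 w) (strip1 x) = fused_match l (strip1 w) x.
    by move=> x2; apply: trail_fused_match => //; [exact: ltnW|apply: contra fx => i2;
      rewrite last2_eq0].
  apply/idP/idP => h; [rewrite -E //|rewrite E //].
    by rewrite (trail_match_last wW lN x1 h).
  have [] := fused_match_last wW lN h; rewrite l2 /= => - []; case: eqP => // _ e.
  by rewrite e in x1.
have := sum_fused_match l w; rewrite (wsumID _ _ _ trail) => /opp_sum <-.
by apply: wsum_ext => x _; rewrite fused_matchE andbC.
Qed.

(** * Induction on the number K of letters above 2 in the suffix *)

Section Induct.
Variable K : nat.
Hypothesis IHK : forall l w, w \in W -> trail w -> l <= N - r -> size (gt2 (drop l w)) < K ->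
  Sg (fun x => trail_key l x == trail_key l w) = 0%R.

Lemma trail_sumK l w : 0 < K -> (l <= N - r -> size (gt2 (drop l w)) < K) ->
  Sg (fun x => trail x && (fused_key l x == fused_key l w)) = 0%R.
Proof.
move=> K0 sK; apply: trail_sum0 => x xW tx [_ e]; apply: IHK => //; first exact: geq_minr.
case: (leqP l (N - r)) => lN.
  by rewrite -gt2_merge2 e gt2_merge2; apply: sK.
by rewrite (trail_drop xW tx) // drop_oversize ?size_fltW //= /gt2 filter_nseq.
Qed.

(** In the fused fibre, the trailing words cancel by [IHK]. The other words with nonzero [f] end in
    2 and have no inversion of 2, so their suffix is determined by its fused form; they make up the
    fibre of [prefix_key]. *)
Lemma prefix_key_noninv_last2 l w : w \in W -> ~~ has_inv 2 w -> last 0 w = 2 ->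
  1 \in drop l w ->
  size (gt2 (drop l w)) < K -> Sg (fun x => prefix_key l x == prefix_key l w) = 0%R.
Proof.
move=> wW n2 l2 d1 sK.
have dn : drop l w != [::] by case: (drop l w) d1.
have K0 : 0 < K by apply: leq_ltn_trans sK.
have := sum_fused_key l (fused_key l w); rewrite (wsumID _ _ _ trail).
rewrite [X in (X + _)%R](_ : _ = 0%R) ?add0r => [<-|]; last first.
  by rewrite -[RHS](trail_sumK K0 (fun _ => sK)); apply: wsum_ext => x _ /=; rewrite andbC.
apply: wsum_supp => x xW fx /=; apply/eqP/andP => [e|[/eqP e nt]].
  split; first by apply/eqP; exact: prefix_key_fused_key.
  by apply: not_trail => //; rewrite (prefix_key_last e dn) l2.
have [e1 e2] := e.
have dx : drop l x != [::] by rewrite -size_eq0 -(size_fuse 2) e2 size_fuse size_eq0.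
have lx : last 0 x = 1 \/ last 0 x = 2.
  have := congr1 (last 0) e2; rewrite !last_fuse dx dn -(last_drop dx) -(last_drop dn) l2
    !andbT.
  by case: ifP => [/eqP|]; [right|left].
case: lx => lx; first by rewrite last1_eq0 ?eqxx in fx.
have nx : ~~ has_inv 2 x by apply: contra fx => i2; rewrite last2_eq0.
have sx : size x = size w by rewrite !Wsize.
(* With all its letters 1 in the prefix, [x] would have a longer prefix than [w], whose prefix lacks
   the letter 2 and has fewer than [r] letters 1. *)
have [dx1|dx1] := boolP (1 \in drop l x); last first.
  have c1 : count_mem 1 (take l x) = r by rewrite -(count_split _ l xW) (count_memPn dx1) addn0.
  have := size_gt2 (no0_take l xW); have := size_gt2 (no0_take l wW).
  have -> : size (take l x) = size (take l w) by rewrite !size_take sx.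
  rewrite e1 c1 (count_memPn (not_inv2_take d1 n2)).
  have cw := count_split (pred1 1) l wW.
  have dp : 0 < count_mem 1 (drop l w) by rewrite -has_count has_pred1.
  have A a b c d e' k : d + e' = k -> 0 < e' -> a = b + d + 0 -> a = b + k + c -> False.
    by clear; lia.
  by move=> h1 h2; case: (A _ _ _ _ _ _ cw dp h1 h2).
have ed : drop l x = drop l w.
  apply: (@noninv_inj 2) => //; do ?exact: not_inv2_drop.
  by rewrite !not_inv2_count.
by rewrite /prefix_key ed !no2_strip1_gt2 ?e1 ?no0_take //; exact: not_inv2_take.
Qed.

(** If every [i > 2] is inverted in [w], the whole fibre consists of inverting, non-trailing words.
    Otherwise straighten at some [i]. Only [i = 3] can destroy the hypotheses, by turning the last
    letter into 2 or by removing the inversion of 2. In the latter case all [s] letters 2 lie in the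
    suffix, and the bound [K + s] leaves fewer than [K] letters above 2 there, as
    [prefix_key_noninv_last2] demands. *)
Lemma prefix_key_vanish l w : w \in W -> 2 < last 0 w -> 1 \in drop l w -> has_inv 2 w ->
  size (strip1 (drop l w)) < K + s -> Sg (fun x => prefix_key l x == prefix_key l w) = 0%R.
Proof.
have [n] := ubnP (word_val B (drop l w)); elim: n w => // n IHn w.
have [k] := ubnP (word_val B (strip1 (take l w))); elim: k w => // k IHk w kb nb wW lw d1 i2 sz.
have IH w' : lexlt (strip1 (take l w')) (drop l w') (strip1 (take l w)) (drop l w) ->
    w' \in W -> 2 < last 0 w' -> 1 \in drop l w' -> has_inv 2 w' ->
    size (strip1 (drop l w')) <= size (strip1 (drop l w)) -> Sg (fun x =>
      prefix_key l x == prefix_key l w') = 0%R.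
  move=> lt w'W lw' d1' i2' sz'; have szw := leq_ltn_trans sz' sz; case: lt => [lt|[e lt]].
    by apply: IHn => //; apply: leq_trans lt _.
  by apply: IHk; rewrite ?e //; apply: leq_trans lt _.
have dn z : 1 \in drop l z -> drop l z != [::] by case: (drop l z).
have [h|[i im ni]] := has_inv_case 2 w.
  apply: wsum0 => x xW /eqP e; apply: f_pure_inv => // [j jm|]; last first.
    by apply: not_trail => //; rewrite (prefix_key_last e (dn _ d1)); move: lw; clear; lia.
  have [->|j2] := eqVneq j 2; first by rewrite (prefix_key_inv2 e d1).
  have [e1 e2] := e.
  have fx : strip1 x = strip1 w.
    by rewrite -(cat_take_drop l x) -(cat_take_drop l w) /strip1 !filter_cat -!/(strip1 _) e1
      e2.
  have j3 : 2 < j <= m by move: jm j2; clear; lia.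
  by rewrite -has_inv_strip1 ?fx ?has_inv_strip1 ?h //; case/andP: j3.
apply: (prefix_key_class im wW ni) => w' w'W e1 e2 lt.
have i0 : 2 < i by case/andP: im.
have d1' : 1 \in drop l w'.
  by rewrite -(@mem_fuse i) ?e2 ?mem_fuse //; move: i0; clear; lia.
have szf z : size (strip1 (fuse i z)) = size (strip1 z) by rewrite strip1_fuse ?size_fuse.
have sz' : size (strip1 (drop l w')) = size (strip1 (drop l w)) by rewrite -szf e2 szf.
have inv2f (z : seq nat) : has_inv 2 z -> last 0 z = 2 -> 1 \in drop l z ->
    Sg (fun x => prefix_key l x == prefix_key l z) = 0%R.
  move=> i2z l2z d1z; apply: wsum0 => x xW /eqP e; apply: last2_eq0 => //.
    by rewrite (prefix_key_last e (dn _ d1z)).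
  by rewrite (prefix_key_inv2 e).
have ll : (if last 0 w' == i then i.-1 else last 0 w') = (if last 0 w == i then i.-1 else last
  0 w).
  have := congr1 (last 0) e2; rewrite !last_fuse !dn // !andbT.
  by rewrite -(last_drop (dn _ d1)) -(last_drop (dn _ d1')).
have [i3|i3] := leqP i 3; last first.
  have lw' : 2 < last 0 w' by move: ll lw i3; do 2?case: eqP; clear; lia.
  apply: IH => //; rewrite ?sz' //.
  rewrite (has_inv2E d1') -(@has_inv_fuse i) ?e2 ?has_inv_fuse; [|by move: i3; clear; lia..].
  have E z : (2 \in take l z) = (2 \in fuse i (strip1 (take l z))).
    by rewrite mem_fuse ?mem_filter //; move: i3; clear; lia.
  by rewrite E e1 -E -has_inv2E.
have lw' : 1 < last 0 w' by move: ll lw i0 i3; do 2?case: eqP; clear; lia.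
have [i2'|n2'] := boolP (has_inv 2 w').
  have [l2|l2] := eqVneq (last 0 w') 2; first exact: inv2f.
  by apply: IH; rewrite ?sz' //; move: lw' l2; clear; lia.
have c2' := not_inv2_count w'W d1' n2'.
have sfb z : size (strip1 z) = count_mem 0 z + size (gt2 z) + count_mem 2 z.
  by rewrite !size_filter; elim: z => //= a z ->; case: a => [|[|[|a]]] /=; clear; lia.
have sK : size (gt2 (drop l w')) < K.
  by move: sz; rewrite -sz' sfb c2' ltn_add2r; apply: leq_ltn_trans; rewrite leq_addl.
have [l2|l2] := eqVneq (last 0 w') 2; first exact: prefix_key_noninv_last2.
have val' : word_val B (drop l w') <= word_val B (drop l w) by case: lt => [/ltnW|[->]].
(* The last letter is still above 2 but the inversion of 2 is lost. The relation at 2 expresses this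
   fibre by others that have this inversion and a smaller suffix. *)
pose c (v : seq nat * seq nat) := (gt2 v.1 == gt2 (take l w')) && (fuse 2 v.2 == fuse 2 (drop l
  w')).
apply: (@wsum_fib1 _ _ _ (prefix_key l) c) => [|x xW /andP[/eqP h1 /eqP h2] nx|]; last
  by rewrite /c /= gt2_strip1 !eqxx.
  rewrite -[RHS](sum_fused_key l (fused_key l w')); apply: wsum_ext => x _.
  by rewrite /c /fused_key /= gt2_strip1.
rewrite /= gt2_strip1 in h1; rewrite /= in h2.
have cx2 : count_mem 2 (drop l x) <= s by rewrite -(count_split _ l xW) leq_addl.
have take2 z : z \in W -> count_mem 2 (drop l z) = s -> 2 \notin take l z.
  move=> zW cz; apply/count_memPn/eqP.
  by rewrite -(eqn_add2r s) add0n -{1}cz (count_split _ l zW).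
have dne : drop l x != drop l w'.
  apply: contra nx => /eqP e; rewrite /prefix_key e xpair_eqE eqxx andbT.
  by rewrite !no2_strip1_gt2 ?h1 ?no0_take ?take2 ?e.
have vx : word_val B (drop l x) < word_val B (drop l w').
  have cc : count_mem 2 (drop l x) <= count_mem 2 (drop l w') by rewrite c2'.
  have [e|//] := @word_val_class B 2 _ _ (ltn_trans m2 (ltnSn m)) isT h2 (not_inv2_drop d1'
    n2') cc.
  by rewrite e eqxx in dne.
have c12 : count_mem 1 (drop l x) + count_mem 2 (drop l x) =
    count_mem 1 (drop l w') + count_mem 2 (drop l w') by rewrite -!count_merge2 h2.
have c1 : count_mem 1 (drop l w') <= count_mem 1 (drop l x).
  by rewrite -(leq_add2r (count_mem 2 (drop l w'))) -c12 leq_add2l c2'.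
have dx1 : 1 \in drop l x.
  by rewrite -has_pred1 has_count; apply: leq_trans c1; rewrite -has_count has_pred1.
have szd : size (drop l x) = size (drop l w') by rewrite !size_drop !Wsize.
apply: IH => //.
- by left; apply: leq_trans vx val'.
- have := congr1 (last 0) h2; rewrite !last_fuse !dn // !andbT -(last_drop (dn _ dx1)).
  by rewrite -(last_drop (dn _ d1')); move: lw' l2; do 4?case: eqP; clear; lia.
- apply: contraNT dne => nx2; apply/eqP; apply: (@noninv_inj 2) => //; try exact: not_inv2_drop.
  by rewrite !not_inv2_count.
- by rewrite -sz' !size_strip1 szd leq_sub2l.
Qed.

(** Behind the letter at [l] there are only [K - 1] letters above 2, so [IHK] kills the sum for the
    cut [l + 1]. The other fibres for the cut [l] inside it have a 2 at that place, and [IHK]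
    applies to them as well. *)
Lemma trail_key_skip l w : w \in W -> trail w -> l < N - r -> 2 < nth 0 w l ->
  size (gt2 (drop l w)) = K -> Sg (fun x => trail_key l x == trail_key l w) = 0%R.
Proof.
move=> wW tw lN c3 sK.
have dl x : x \in W -> drop l x = nth 0 x l :: drop l.+1 x.
  by move=> xW; rewrite (drop_nth 0) // (Wsize xW); move: lN; clear; lia.
have tl x : x \in W -> take l.+1 x = rcons (take l x) (nth 0 x l).
  by move=> xW; rewrite (take_nth 0) // (Wsize xW); move: lN; clear; lia.
have bl x : x \in W -> gt2 (take l.+1 x) = gt2 (take l x) ++ gt2 (take 1 (drop l x)).
  by move=> xW; rewrite tl // dl //= take0 -cats1 /gt2 filter_cat.
pose c (v : bool * (seq nat * seq nat)) :=
  (v.1, (v.2.1 ++ gt2 (take 1 v.2.2), behead v.2.2)) == trail_key l.+1 w.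
have cE x : x \in W -> c (trail_key l x) = (trail_key l.+1 x == trail_key l.+1 w).
  by move=> xW; rewrite /c /= -bl // [in behead _]dl.
apply: (@wsum_fib1 _ _ _ (trail_key l) c) => [|x xW|]; last by rewrite cE.
  transitivity (Sg (fun x => trail_key l.+1 x == trail_key l.+1 w)); first
    by apply: wsum_ext => x /cE.
  by apply: IHK => //; rewrite -sK dl //= c3.
rewrite cE // => /eqP[tx eb ed] nx.
have xl : nth 0 x l \in take l.+1 (strip1 x).
  rewrite -trail_take ?tx //; rewrite tl // mem_rcons inE eqxx //.
have x01 : 1 < nth 0 x l.
  move/mem_take: xl; rewrite mem_filter (Wmem _ xW).
  by case: (nth 0 x l) => [|[|k]].
have [x2|x2] := ltnP 2 (nth 0 x l).
  case/eqP: nx; move: eb; rewrite !bl // !dl //= !take0 /gt2 /= c3 x2 !cats1.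
  move/eqP; rewrite eqseq_rcons => /andP[/eqP eb' /eqP el].
  by rewrite /trail_key !dl // tx ed el /gt2 eb'.
apply: IHK; rewrite ?tx //; first exact: ltnW.
have x2' : (2 < nth 0 x l) = false by rewrite ltnNge x2.
by rewrite dl //= x2' ed -sK dl //= c3 ltnSn.
Qed.

(** Inversions of [i > 3] are visible after [gt2]. For 3, the prefix shows only whether it contains
    a 3, and the 2 in the suffix then completes the inversion. *)
Lemma good_has_inv k (b d x : seq nat) : (forall i, 3 < i <= m -> has_inv i (b ++ d)) ->
  (3 \in b) || has_inv 3 d -> 2 \in d -> gt2 (take k x) = gt2 b -> drop k x = d ->
  forall i, 2 < i <= m -> has_inv i x.
Proof.
move=> hi g d2 eb ed i /andP[i2 im]; have [i3|i3] := leqP i 3; last first.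
  rewrite -has_inv_gt2 // -(cat_take_drop k x) /gt2 filter_cat -!/(gt2 _) eb ed /gt2
    -filter_cat.
  by rewrite -/(gt2 _) has_inv_gt2 // hi // i3.
have -> : i = 3 by apply/eqP; rewrite eqn_leq i3.
have E3 u : (3 \in u) = (3 \in gt2 u) by rewrite mem_filter.
rewrite -(cat_take_drop k x) ed has_inv_cat E3 eb -E3 d2 /=.
by case: (3 \in b) g.
Qed.

Hypothesis Hbase : {in W, forall w, trail w -> Sg (fun x =>
  trail_key (N - r) x == trail_key (N - r) w) = 0%R}.

(** The cut moves right until [N - r], where [Hbase] takes over; for a fixed cut, straightening
    leads to smaller keys. The remaining case, where every [i > 2] is inverted throughout the fibre,
    goes through both relations that involve the letter 1. *)
Lemma trail_key_level l w : w \in W -> trail w -> l <= N - r -> size (gt2 (drop l w)) = K ->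
  Sg (fun x => trail_key l x == trail_key l w) = 0%R.
Proof.
have [u] := ubnP (N - l); elim: u l w => // u IHu l w.
have [n] := ubnP (word_val B (drop l w)); elim: n w => // n IHn w.
have [k] := ubnP (word_val B (gt2 (take l w))); elim: k w => // k IHk w kb nb ub wW tw lN sK.
have IH w' : lexlt (gt2 (take l w')) (drop l w') (gt2 (take l w)) (drop l w) ->
    w' \in W -> trail w' -> size (gt2 (drop l w')) = K -> Sg (fun x =>
      trail_key l x == trail_key l w') = 0%R.
  move=> lt w'W tw' sK'; case: lt => [lt|[e lt]].
    by apply: IHn => //; apply: leq_trans lt _.
  by apply: IHk; rewrite ?e //; apply: leq_trans lt _.
move: lN; rewrite leq_eqVlt => /orP[/eqP ->|lN]; first exact: Hbase.
have r0 := r_gt0.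
set c := nth 0 w l.
have dl : drop l w = c :: drop l.+1 w.
  by rewrite (drop_nth 0) // (Wsize wW); move: lN; clear; lia.
have tl : take l.+1 w = rcons (take l w) c.
  by rewrite (take_nth 0) // (Wsize wW); move: lN; clear; lia.
have ccoef : c \in take l.+1 (strip1 w) by rewrite -trail_take // tl mem_rcons inE eqxx.
have c1 : 1 < c.
  by move: ccoef; move: (c) => [|[|a]] // /mem_take; rewrite mem_filter (Wmem _ wW).
have [c2|c2] := ltnP 2 c; first exact: trail_key_skip.
have {c1 c2} c2 : c = 2 by move: c1 c2; clear; lia.
rewrite c2 in ccoef dl tl.
set y := strip1 w in ccoef *.
have ty : take l y = take l w by rewrite trail_take // ltnW.
have dy : drop l w = drop l y ++ nseq r 1 by rewrite trail_drop // ltnW.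
have [l2|l2] := eqVneq (last 0 y) 2.
  rewrite trail_key_last2 //; apply: trail_sum0 => x xW tx [ex _].
  have [lr|lr] := leqP (l + r) (N - r); last first.
    exact: Hbase.
  apply: IHu => //.
    have A a b i j : a - i < j.+1 -> i < a - b -> 0 < b -> a - (i + b) < j by clear; lia.
    exact: A ub lN r0.
  have sb z k' : z \in W -> size (gt2 (take k' z)) + size (gt2 (drop k' z)) = size (gt2 T).
    move=> zW; rewrite -size_cat -filter_cat cat_take_drop !size_filter; exact: Wcount.
  by apply/eqP; rewrite -(eqn_add2l (size (gt2 (take l w)))) -{1}ty -ex -{1}sK !sb.
have ylast : last 0 y \in y.
  have d := drop_strip1_nil wW lN; rewrite (last_drop d); apply: (mem_drop (n0 := l)).
  by rewrite -/y; case: (drop l y) d => //= a v _; exact: mem_last.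
have yl : 2 < last 0 y.
  by move: ylast; rewrite mem_filter (Wmem _ wW); case: (last 0 y) l2 => [|[|[|]]].
have m3 : 2 < m.
  by move: ylast; rewrite mem_filter (Wmem _ wW) => /and3P[_ _]; exact: leq_trans.
have sbT z k' : z \in W -> size (gt2 (take k' z)) + size (gt2 (drop k' z)) = size (gt2 T).
  by move=> zW; rewrite -size_cat -filter_cat cat_take_drop !size_filter; exact: Wcount.
have [hi|[i im ni]] := has_inv_case 3 w; last first.
  apply: (trail_key_class im wW tw ni) => w' w'W tw' e1 e2 lt; apply: IH => //.
  have i3 : i != 3 by move: im; clear; lia.
  by rewrite -sK -(size_fuse i) -gt2_fuse // e2 gt2_fuse // size_fuse.
(* Any 3 in the prefix is inverted by the 2 at place [l], so the failure of this condition is what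
   straightening at 3 requires. *)
have [g|] := boolP ((3 \in take l w) || has_inv 3 (drop l w)); last first.
  rewrite negb_or => /andP[n3 ni3].
  apply: trail_key_class3 => // w' w'W tw' e2 nx [lt|[n3' eb ec]]; first by apply: IHK;
    rewrite -?sK // ltnW.
  apply: IH => //; last by apply/eqP;
    rewrite -(eqn_add2l (size (gt2 (take l w)))) -{1}eb -sK !sbT.
  left; have [e|//] := @word_val_class B 3 _ _ (ltn_trans m2 (ltnSn m)) isT e2 ni3 (eq_leq ec).
  by case/eqP: nx; rewrite /trail_key tw tw' eb e.
have d2 : 2 \in drop l y.
  have h : 2 \in drop l w by rewrite dl inE.
  by move: h; rewrite dy mem_cat mem_nseq andbF orbF.
have g' : (3 \in take l w) || has_inv 3 (drop l y).
  by move: g; rewrite dy -[has_inv 3 (_ ++ _)]has_inv_strip1 // /strip1 filter_cat filter_nseq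
    /= cats0 has_inv_strip1.
have hi' i : 3 < i <= m -> has_inv i (take l w ++ drop l y).
  move=> im; rewrite -ty cat_take_drop has_inv_strip1 ?hi //; by move: im; clear; lia.
have fA x : x \in W -> trail_match l y (strip1 x) -> has_inv 2 x -> ~~ trail x -> f x = 0%R.
  move=> xW /andP[/eqP eb /eqP ed] i2 nt; apply: f_pure_inv => // i im.
  have [->//|ni2] := eqVneq i 2; have i2' : 2 < i <= m by move: im ni2; clear; lia.
  rewrite -has_inv_strip1; last by case/andP: i2'.
  by rewrite -ty in eb g' hi'; apply: (good_has_inv hi' g' d2 eb ed).
have lastB x : fused_match l y x -> 2 < last 0 x /\ drop (l + r) x != [::].
  move=> h; have [e dn] := fused_match_last wW lN h; split=> //.
  move: e => /= -[e]; move: e yl; rewrite -/y; do 2?case: eqP; clear; lia.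
rewrite (trail_key_strip1 wW tw (ltnW lN)) -/y.
(* Words with an inversion of 2 drop out by [fA], and the others may be matched at [l + r] instead.
   Their complement in the vanishing sum over [fused_match] is then split into fibres of
   [prefix_key (l + r)]. *)
have -> : Sg (fun x => trail_match l y (strip1 x) && ~~ trail x) = Sg (fun x =>
  fused_match l y x && ~~ has_inv 2 x).
  apply: wsum_supp => x xW fx; apply/andP/andP => [[hA nt]|[hB ni2]].
    have ni2 : ~~ has_inv 2 x by apply: contra fx => i2; rewrite fA.
    by split=> //; rewrite -trail_fused_match // ltnW.
  split; first by rewrite trail_fused_match // ltnW.
  by apply: not_trail => //; have [] := lastB _ hB; clear; case: (last 0 x) => [|[|]].
have := sum_fused_match l w; rewrite -/y (wsumID _ _ _ (has_inv 2)) addrC => /opp_sum ->.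
rewrite opprK; apply: (wsum_fib (h := prefix_key (l + r))) => x xW /andP[hB i2].
have [lx dn] := lastB _ hB; case/andP: (hB) => /eqP eb /eqP ed.
have cBx z : prefix_key (l + r) z = prefix_key (l + r) x -> fused_match l y z.
  by move=> /prefix_key_fused_key e; rewrite fused_matchE e -fused_matchE.
have [x1|x1] := boolP (1 \in drop (l + r) x).
  transitivity (Sg (fun z => prefix_key (l + r) z == prefix_key (l + r) x)).
    apply: wsum_ext => z zW /=; case: eqP => [e|]; rewrite ?andbF // andbT.
    by rewrite (prefix_key_inv2 e x1) i2 (cBx _ e).
  (* The suffix has [K] letters above 2. Its letters 1 and 2 together are as many as the letters 2
     of [drop l y], so at most [s], and at least one of them is a 1, which [strip1] removes. *)
  apply: prefix_key_vanish => //.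
  have sb : size (gt2 (drop (l + r) x)) = K.
    rewrite -gt2_merge2 ed gt2_merge2 -sK dy /gt2 filter_cat size_cat filter_nseq /= addn0 //.
  have y1 : count_mem 1 (drop l y) = 0.
    by apply/count_memPn; apply: contra (strip1_no1 w) => /mem_drop.
  have c12 := congr1 (count_mem 1) ed; rewrite !count_merge2 y1 add0n in c12.
  have cy : count_mem 2 (drop l y) <= s.
    by rewrite -(count_split _ l wW) dy count_cat addnA addnAC leq_addl.
  have d0 : 0 \notin drop (l + r) x by apply: contra (W0 xW) => /mem_drop.
  have := size_gt2 d0; rewrite sb size_strip1 => ->.
  have : 0 < count_mem 1 (drop (l + r) x) by rewrite -has_count has_pred1.
  have A a b k' s' e : b + e = a -> a <= s' -> 0 < b -> k' + b + e - b < k' + s' by clear; lia.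
  exact: A c12 cy.
have ed' : drop (l + r) x = drop l y.
  by apply: fuse2_inj => //; apply: contra (strip1_no1 w) => /mem_drop.
apply: wsum0 => z zW /andP[/andP[hz iz] /eqP [_ e2]].
apply: f_pure_inv => // [i im|]; last first.
  by apply: not_trail => //; have [] := lastB _ hz; clear; case: (last 0 z) => [|[|]].
have [->//|ni2] := eqVneq i 2; have i2' : 2 < i <= m by move: im ni2; clear; lia.
have ez : gt2 (take (l + r) z) = gt2 (take l w) by move: hz => /andP[/eqP -> _]; rewrite ty.
by apply: (good_has_inv hi' g' d2 ez) => //; rewrite e2.
Qed.

End Induct.

Lemma fuse2_ones u : all (fun x => (x == 1) || (x == 2)) u -> fuse 2 u = nseq (size u) 1.
Proof. by elim: u => //= x u IH /andP[/orP[]/eqP-> /IH ->]. Qed.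

(** Past the last letter above 2 every nonempty suffix of [strip1 w] ends in 2, so [trail_key_last2]
    applies again and again, each time moving the cut by [r]. *)
Lemma trail_key_chain l w : w \in W -> trail w -> l <= N - r -> gt2 (drop l w) = [::] ->
  Sg (fun x => trail_key l x == trail_key l w) = Sg (fun x =>
    trail_key (N - r) x == trail_key (N - r) w).
Proof.
move=> wW tw; have [u] := ubnP (N - l); elim: u l => // u IHu l ub.
rewrite leq_eqVlt => /orP[/eqP -> //|lN] bd.
have r0 := r_gt0.
have ty : take l (strip1 w) = take l w by rewrite trail_take // ltnW.
have dy : drop l w = drop l (strip1 w) ++ nseq r 1 by rewrite trail_drop // ltnW.
have a12 : all (fun x => (x == 1) || (x == 2)) (drop l w).
  apply/allP => x xd; have := mem_drop xd; rewrite (Wmem _ wW) => /andP[x0 _].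
  have : x \notin gt2 (drop l w) by rewrite bd.
  by rewrite mem_filter xd andbT; case: x x0 {xd} => [|[|[|]]].
have b' k : l <= k -> gt2 (drop k w) = [::].
  move=> lk; rewrite -(subnK lk) -drop_drop; apply/eqP; rewrite -(negbK (_ == _)) -has_filter.
  apply/negP => /hasP[x /mem_drop xd x2]; have : x \in gt2 (drop l w) by rewrite mem_filter x2.
  by rewrite bd.
have y2 x : x \in drop l (strip1 w) -> x = 2.
  move=> xd; have : x \in drop l w by rewrite dy mem_cat xd.
  move/(allP a12) => /orP[] /eqP // x1; move: xd; rewrite x1 => /mem_drop.
  by rewrite (negbTE (strip1_no1 _)).
have dn := drop_strip1_nil wW lN.
have l2 : last 0 (strip1 w) = 2.
  by rewrite (last_drop dn); apply: y2; case: (drop l (strip1 w)) dn => //= a v _;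
    exact: mem_last.
have h2 : 2 \in take l.+1 (strip1 w).
  rewrite (take_nth 0) ?size_fltW // mem_rcons inE [nth _ _ _]y2 ?eqxx //.
  by rewrite (drop_nth 0) ?size_fltW // inE eqxx.
rewrite trail_key_last2 //.
have -> : (gt2 (take l (strip1 w)), fuse 2 (drop l (strip1 w))) = fused_key (l + r) w.
  rewrite /fused_key ty; congr pair.
    rewrite -[LHS]cats0 -[RHS]cats0 -{1}bd -(b' _ (leq_addr r l)) /gt2 -!filter_cat.
    by rewrite !cat_take_drop.
  rewrite !fuse2_ones.
  - by rewrite !size_drop size_fltW // (Wsize wW) -subnDA addnC.
  - apply/allP => x; rewrite addnC -drop_drop => /mem_drop; exact: allP a12 x.
  - by apply/allP => x /y2 ->.
rewrite trail_sumE //; have [lr|lr] := leqP (l + r) (N - r) => //.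
apply: IHu => //; last by apply: b'; exact: leq_addr.
have A a b i j : a - i < j.+1 -> i < a - b -> 0 < b -> a - (i + b) < j by clear; lia.
exact: A ub lN r0.
Qed.

Lemma trail_key_one l w x : w \in W -> x \in W -> size (gt2 (take l w)) = l ->
  (trail_key l x == trail_key l w) = (x == w).
Proof.
move=> wW xW sl; apply/eqP/eqP => [[_ eb ed]|-> //].
have tb z : z \in W -> size (gt2 (take l z)) = l -> gt2 (take l z) = take l z.
  move=> zW sz; apply/all_filterP; rewrite all_count -size_filter sz size_takel //.
  by rewrite -[leqLHS]sz; apply: leq_trans (size_subseq (filter_subseq _ _)) _;
    rewrite size_take; case: ltnP => // /ltnW.
by rewrite -(cat_take_drop l x) ed -tb ?eb // tb // cat_take_drop.
Qed.

Lemma trail_key_trail w x : w \in W -> x \in W -> trail w ->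
  (trail_key (N - r) x == trail_key (N - r) w) = trail x && (gt2 x == gt2 w).
Proof.
move=> wW xW tw; rewrite /trail_key tw !xpair_eqE eqb_id; case: (boolP (trail x)) => //= tx.
have E z : z \in W -> trail z -> gt2 (take (N - r) z) = gt2 z /\ drop (N - r) z = nseq r 1.
  move=> zW tz; rewrite trail_take // trail_drop // take_oversize ?size_fltW //.
  by rewrite drop_oversize ?size_fltW // gt2_strip1.
by have [-> ->] := E _ xW tx; have [-> ->] := E _ wW tw; rewrite eqxx andbT.
Qed.

(** For the cut right behind [gt2 w] the fibre is the single word [w], and [trail_key_chain] carries
    the cut on to [N - r]. Thus the sums over trailing words with given [gt2] are values of [f],
    known to vanish when the word is pure and inverting. *)
Lemma trail_base w : w \in W -> w = gt2 w ++ nseq s 2 ++ nseq r 1 ->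
  f w = Sg (fun x => trail x && (gt2 x == gt2 w)).
Proof.
move=> wW e; pose l := size (gt2 w).
have sw : N - r = size (gt2 w ++ nseq s 2).
  have e2 : size w = size (gt2 w ++ nseq s 2) + r.
    by rewrite {1}e catA [LHS]size_cat (size_nseq r).
  by rewrite -(Wsize wW) e2 addnK.
have tw : trail w.
  rewrite /trail (Wsize wW) (Wcount _ wW) sw.
  have -> : take (size (gt2 w ++ nseq s 2)) w = gt2 w ++ nseq s 2.
    by rewrite {2}e catA take_size_cat.
  by rewrite mem_cat mem_filter /= mem_nseq andbF.
have lN : l <= N - r by rewrite sw size_cat leq_addr.
have tl : take l w = gt2 w by rewrite {1}e take_size_cat.
have dl : drop l w = nseq s 2 ++ nseq r 1 by rewrite {1}e drop_size_cat.
have bb : gt2 (gt2 w) = gt2 w by rewrite /gt2 filter_id.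
transitivity (Sg (fun x => trail_key l x == trail_key l w)).
  by rewrite -wsum1 //; apply: wsum_ext => x xW; rewrite trail_key_one // tl bb.
rewrite trail_key_chain //; first by apply: wsum_ext => x xW; rewrite trail_key_trail.
by rewrite dl /gt2 filter_cat !filter_nseq.
Qed.

Hypothesis Hbase : {in W, forall w, trail w -> Sg (fun x => trail x && (gt2 x == gt2 w)) = 0%R}.

Lemma trail_key_vanish K l w : w \in W -> trail w -> l <= N - r -> size (gt2 (drop l w)) = K ->
  Sg (fun x => trail_key l x == trail_key l w) = 0%R.
Proof.
elim/ltn_ind: K l w => K IH l w; apply: trail_key_level => [l' w' w'W tw lN lt|w' w'W tw].
  exact: IH lt _ _ w'W tw lN (erefl _).
by rewrite -[RHS](Hbase w'W tw); apply: wsum_ext => x xW; rewrite trail_key_trail.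
Qed.

Lemma all_vanish w : w \in W -> f w = 0%R.
Proof.
have [n] := ubnP (word_val B w); elim: n w => // n IH w vn wW.
have [tw|nt] := boolP (trail w).
  rewrite -wsum1 // -[RHS](trail_key_vanish wW tw (leq0n _) (erefl _)).
  by apply: wsum_ext => x xW; rewrite trail_key_one // take0.
have [h|[i im ni]] := has_inv_case 1 w; first exact: f_pure_inv.
apply: (straighten im wW ni) => w' w'W _ lt; apply: IH => //; exact: leq_trans lt _.
Qed.

End Main.

(** * From largest letter m to m - 2 *)

Definition lower (w : seq nat) : seq nat := [seq x - 2 | x <- gt2 w].

(* n is fuel. For k >= 2, removing the trailing 2...2 1...1 and subtracting 2
   from the other parts lowers by 2 the k of the staircase suffix. *)
Fixpoint pureb n (w : seq nat) : bool :=
  if n is n'.+1 then [|| ~~ trail w, 1 \notin w | [&& 2 \in w,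
    w == gt2 w ++ nseq (count_mem 2 w) 2 ++ nseq (count_mem 1 w) 1 & pureb n' (lower w)]]
  else 1 \notin w.

Lemma lowerK w : [seq x + 2 | x <- lower w] = gt2 w.
Proof.
rewrite /lower -map_comp -[RHS]map_id; apply/eq_in_map => x.
by rewrite mem_filter => /andP[x2 _] /=; rewrite subnK // ltnW.
Qed.

Lemma gt2_up v : 0 \notin v -> gt2 [seq x + 2 | x <- v] = [seq x + 2 | x <- v].
Proof.
move=> v0; apply/all_filterP/allP => y /mapP[x xv ->].
by case: x xv => [v0'|x _]; [rewrite v0' in v0 | rewrite addn2].
Qed.

Lemma lower_up v : 0 \notin v -> lower [seq x + 2 | x <- v] = v.
Proof.
by move=> v0; rewrite /lower gt2_up // -map_comp -[RHS]map_id; apply: eq_map => x /=;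
  rewrite addnK.
Qed.

Lemma lower_fuse i w : 1 < i -> lower (fuse i.+2 w) = fuse i (lower w).
Proof.
move=> i1; rewrite /lower gt2_fuse; last by rewrite !eqSS; case: i i1 => [|[|]].
rewrite /fuse -!map_comp; apply/eq_in_map => x; rewrite mem_filter => /andP[x2 _] /=.
by case: (x =P i.+2); case: (x - 2 =P i); move: x2 i1; clear; lia.
Qed.

Lemma has_inv_up i v : 0 < i -> has_inv i.+2 [seq x + 2 | x <- v] = has_inv i v.
Proof.
move=> i0; have e : i.+2.-1 = i.-1 + 2 by move: i0; clear; lia.
elim: v => //= x v IH; rewrite !has_inv_cons IH.
have -> : (x + 2 == i.+2) = (x == i) by rewrite addn2.
case: (x =P i) => // _; rewrite !in_cons e eqn_add2r; congr (_ || _).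
by rewrite (mem_map (f := fun x => x + 2)) // => a b /addIn.
Qed.

Lemma perm_split (T : seq nat) : 0 \notin T ->
  perm_eq T (gt2 T ++ nseq (count_mem 2 T) 2 ++ nseq (count_mem 1 T) 1).
Proof.
move=> T0; apply/permP => p; rewrite !count_cat !count_nseq.
elim: T T0 => [|x T IH] /=; first by rewrite !muln0.
rewrite inE negb_or => /andP[x0 /IH ->].
case: x x0 => [|[|[|x]]] //= _; rewrite ?muln0 ?muln1; clear; lia.
Qed.

(** Each trailing word [x] is counted for exactly one [v], namely [lower x]. *)
Lemma wsum_lower T f (Q : pred (seq nat)) : 0 \notin T ->
  wsum [seq x - 2 | x <- gt2 T]
    (fun v => wsum T f (fun x => trail x && (gt2 x == [seq y + 2 | y <- v]))) Q =
  wsum T f (fun x => trail x && Q (lower x)).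
Proof.
move=> T0; rewrite /wsum (exchange_big_dep trail) /=; last by move=> v x _ /andP[].
rewrite [RHS]big_mkcondr /= big_seq_cond [RHS]big_seq_cond; apply: eq_bigr => x /andP[xW tx].
have lx : lower x \in permutations [seq x - 2 | x <- gt2 T].
  rewrite mem_permutations perm_map // /gt2 perm_filter //.
  by rewrite -mem_permutations.
have E v : v \in permutations [seq x - 2 | x <- gt2 T] ->
    (Q v && (trail x && (gt2 x == [seq y + 2 | y <- v]))) = (v == lower x) && Q (lower x).
  move=> vW; rewrite tx /=; apply/andP/andP => [[Qv /eqP e]|[/eqP -> Qx]]; last first.
    by rewrite Qx lowerK eqxx.
  have <- : v = lower x; last by rewrite eqxx Qv.
  by rewrite /lower e -map_comp -[LHS]map_id; apply: eq_map => y /=; rewrite addnK.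
rewrite big_seq_cond; under eq_bigl => v.
  have -> : (v \in permutations [seq x - 2 | x <- gt2 T]) && (Q v && (trail x && (gt2 x == [seq
    y + 2 | y <- v]))) = (v == lower x) && Q (lower x).
    case: (boolP (v \in _)) => [/E //|vN] /=; case: eqP => //= ve.
    by rewrite ve lx in vN.
  over.
case: (Q _); last by rewrite big1 // => v /andP[].
under eq_bigl do rewrite andbT.
by rewrite -big_filter filter_pred1_uniq ?permutations_uniq // big_seq1.
Qed.

Lemma pureb_mono n w : pureb n w -> pureb n.+1 w.
Proof.
elim: n w => [|n IH] w; first by move=> /= ->; rewrite orbT.
case/or3P => [h|h|/and3P[h1 h2 /IH h3]];
  rewrite -[pureb _.+2 _]/[|| _, _ | [&& _, _ & pureb n.+1 (lower w)]].
- by rewrite h.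
- by rewrite h orbT.
- by rewrite h1 h2 h3 !orbT.
Qed.

(** The base sums [g], as a function of the lowered word, satisfy the hypotheses for [m - 2], and
    their vanishing is the [Hbase] of [all_vanish]. The relation at [i] for [g] comes from [i + 2]
    for [f]; the one deleting letters 1 comes from 3, since [fuse 3] preserves the word of the
    letters above 3. *)
Theorem words_vanish m T f :
  (forall x, (x \in T) = (0 < x <= m)) ->
  (forall i (P : pred (seq nat)), 1 < i <= m -> wsum T f (fun w => P (fuse i w)) = 0%R) ->
  (0 < m -> forall P : pred (seq nat), wsum T f (fun w => P (strip1 w)) = 0%R) ->
  {in permutations T, forall w, (forall i, 1 < i <= m -> has_inv i w) -> pureb m w ->
    f w = 0%R} ->
  {in permutations T, forall w, f w = 0%R}.
Proof.
elim/ltn_ind: m T f => m IH T f mT HR HR1 f_pure_inv.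
(* The empty word is pure and inverting. For [m = 1] the only word is 1...1, which is not pure, but
   deleting its letters gives a relation with a single term. *)
case: m => [|[|m]] in IH mT HR HR1 f_pure_inv *.
- move=> w wW; apply: f_pure_inv => // [i|]; first by case: i => [|[]].
  by move: wW; rewrite mem_permutations /= => /perm_mem ->; rewrite mT.
- move=> w wW; rewrite -(wsum1 f wW) -[RHS](HR1 isT xpredT); apply: wsum_ext => x xW.
  have E z : z \in permutations T -> z = nseq (size T) 1.
    rewrite mem_permutations => zT; rewrite -(perm_size zT); apply/all_pred1P/allP => a.
    by rewrite (perm_mem zT) mT /=; case: a => [|[|]].
  by rewrite (E x xW) (E w wW) eqxx.
set M := m.+2 in IH mT HR HR1 f_pure_inv *.
have M2 : 1 < M by [].
have W0' w : w \in permutations T -> 0 \notin w by exact: W0 mT w.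
have HPI' : {in permutations T, forall w, (forall i, 1 < i <= M -> has_inv i w) ->
  ~~ trail w -> f w = 0%R}.
  by move=> w wW iw nt; apply: f_pure_inv => //=; rewrite nt.
pose T' := [seq x - 2 | x <- gt2 T].
pose g v := wsum T f (fun x => trail x && (gt2 x == [seq y + 2 | y <- v])).
have mT' x : (x \in T') = (0 < x <= m).
  apply/mapP/idP => [[y] |xm].
    by rewrite mem_filter mT => /andP[y2 /andP[_ yM]] ->; move: y2 yM; rewrite /M; clear; lia.
  exists (x + 2); last by rewrite addnK.
  by rewrite mem_filter mT /M; move: xm; clear; lia.
have T0 : 0 \notin T by rewrite mT.
have gW v : v \in permutations T' -> let w := [seq y + 2 | y <- v] ++ nseq (count_mem 2 T) 2 ++
     nseq (count_mem 1 T) 1 in w \in permutations T /\ gt2 w = [seq y + 2 | y <- v].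
  move=> vW w; have v0 : 0 \notin v by move: vW; rewrite mem_permutations => /perm_mem ->;
    rewrite mT'.
  have bw : gt2 w = [seq y + 2 | y <- v].
    by rewrite /w /gt2 !filter_cat -/(gt2 _) gt2_up // !filter_nseq /= cats0.
  split=> //; rewrite mem_permutations /w perm_sym (permPl (perm_split T0)) perm_cat2r.
  by rewrite -(lowerK T) perm_map // perm_sym -mem_permutations.
have gE v : v \in permutations T' -> g v = f ([seq y + 2 | y <- v] ++ nseq (count_mem 2 T) 2 ++
     nseq (count_mem 1 T) 1).
  move=> vW; have [wW bw] := gW v vW.
  by rewrite (trail_base M2 mT HR (HR1 isT) HPI' wW) ?bw.
have gsum Q : wsum T' g Q = wsum T f (fun x => trail x && Q (lower x)) by apply: wsum_lower.
have g0 : {in permutations T', forall v, g v = 0%R}.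
  apply: (IH m) => //.
  - move=> i P im; rewrite gsum -[RHS](HR i.+2 (fun x => trail x && P (lower x))).
      apply: wsum_ext => x _; case/andP: im => i1 _.
      by rewrite lower_fuse // trail_fuse //; move: i1; clear; lia.
    by rewrite /M; move: im; clear; lia.
  - move=> m0 P; rewrite gsum -[RHS](HR 3 (fun x =>
    trail x && P [seq x - 2 | x <- [seq x <- x | 3 < x]])); last first.
      by rewrite /M; move: m0; clear; lia.
    apply: wsum_ext => x xW; rewrite trail_fuse //; congr (_ && P _).
    rewrite fuse_filter; last by move=> a /=; case: (a =P 3); clear; lia.
    have -> : fuse 3 [seq a <- x | 3 < a] = [seq a <- x | 3 < a].
      rewrite /fuse -[RHS]map_id; apply/eq_in_map => a.
      by rewrite mem_filter; case: (a =P 3) => [->|].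
    rewrite /strip1 /lower filter_map /gt2 -filter_predI; congr map.
    by apply: eq_filter => a /=; clear; lia.
  move=> v vW iv pv; rewrite gE //; have [wW bw] := gW v vW.
  set w := _ ++ _ in wW bw *.
  have v0 : 0 \notin v by move: vW; rewrite mem_permutations => /perm_mem ->; rewrite mT'.
  have s0 := s_gt0 M2 mT; have r0 := r_gt0 M2 mT.
  apply: f_pure_inv => // [i /andP[i1 iM]|].
    have [i2|i2] := leqP i 2.
      have -> : i = 2 by apply/eqP; rewrite eqn_leq i2.
      have n2 : (2 \in [seq y + 2 | y <- v]) = false.
        by apply/negP => /mapP[y yv] /(@addIn 2 0) y0; rewrite -y0 in yv; rewrite yv in v0.
      by rewrite /w has_inv_cat n2 has_inv_cat !mem_nseq s0 r0.
    have [i3|i3] := leqP i 3.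
      have -> : i = 3 by apply/eqP; rewrite eqn_leq i3.
      have h3 : 3 \in [seq y + 2 | y <- v].
        apply/mapP; exists 1 => //; move: vW; rewrite mem_permutations => /perm_mem ->.
        by rewrite mT'; move: iM i2; rewrite /M; clear; lia.
      by rewrite /w has_inv_cat h3 mem_cat mem_nseq s0.
    rewrite -has_inv_gt2 // bw; case: i i1 iM i2 i3 => [|[|i]] // _ iM i2 i3.
    by rewrite has_inv_up ?iv //; move: i3 iM; rewrite /M; clear; lia.
  have -> : pureb M w = [|| ~~ trail w, 1 \notin w | [&& 2 \in w, w == gt2 w ++
    nseq (count_mem 2 w) 2 ++ nseq (count_mem 1 w) 1 & pureb m.+1 (lower w)]] by [].
  have -> : lower w = v by rewrite /lower bw -(gt2_up v0) -/(lower _) lower_up.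
  by apply/or3P/Or33; rewrite !(Wcount _ wW) bw -/w eqxx (Wmem mT _ wW) (pureb_mono pv).
apply: all_vanish M2 mT HR (HR1 isT) HPI' _ => w wW tw.
have lw : lower w \in permutations T'.
  by rewrite mem_permutations perm_map // /gt2 perm_filter // -mem_permutations.
rewrite -[RHS](g0 _ lw) /g; apply: wsum_ext => x _.
by rewrite lowerK.
Qed.

(** * Signed refinements *)

Local Open Scope ring_scope.

Fixpoint comps_rec (fuel n : nat) : seq (seq nat) :=
  if n is 0%N then [:: [::]] else
  if fuel is fuel'.+1 then
    flatten [seq [seq i :: d | d <- comps_rec fuel' (n - i)] | i <- iota 1 n]
  else [::].

Definition comps n := comps_rec n n.

Lemma comps_recS f n : comps_rec f.+1 n.+1 =
  flatten [seq [seq i :: d | d <- comps_rec f (n.+1 - i)] | i <- iota 1 n.+1].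
Proof. by []. Qed.

Lemma mem_comps_rec fuel n d : (n <= fuel)%N ->
  (d \in comps_rec fuel n) = all (ltn 0) d && (sumn d == n).
Proof.
elim: fuel n d => [|fuel IH] [|n] d // lnf.
- by case: d => [|[|x] d] //=; rewrite inE /= ?addSn ?andbF.
- by case: d => [|[|x] d] //=; rewrite inE /= ?addSn ?andbF.
rewrite comps_recS; apply/flattenP/andP => [[s /mapP[i ii ->] /mapP[e]]|].
  rewrite IH; last by move: ii lnf; rewrite mem_iota; clear; lia.
  by move=> /andP[ap /eqP es] -> /=; rewrite ap es; move: ii; rewrite mem_iota; clear; lia.
case: d => [[_ /eqP]|i d [/andP[i0 ap] /eqP e]] //.
have {}e : (i + sumn d = n.+1)%N by []. have {}i0 : (0 < i)%N by [].
exists [seq i :: d | d <- comps_rec fuel (n.+1 - i)].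
  by apply: (map_f (fun i => [seq i :: d | d <- comps_rec fuel (n.+1 - i)])); rewrite mem_iota;
    move: i0 e; clear; lia.
apply/mapP; exists d => //; rewrite IH; last by move: i0 lnf; clear; lia.
by apply/andP; split; [exact: ap|apply/eqP; move: i0 e; clear; lia].
Qed.

Lemma mem_comps n d : (d \in comps n) = all (ltn 0) d && (sumn d == n).
Proof. exact: mem_comps_rec. Qed.

Lemma uniq_comps_rec fuel n : uniq (comps_rec fuel n).
Proof.
elim: fuel n => [|fuel IH] [|n] //; rewrite comps_recS.
apply: (@allpairs_uniq_dep _ _ _ (fun i d => i :: d)); first exact: iota_uniq.
  by move=> i _.
by move=> [i d] [j e] _ _ /= [-> ->].
Qed.

Lemma uniq_comps n : uniq (comps n). Proof. exact: uniq_comps_rec. Qed.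

Lemma comps_rec_fuel f1 f2 n : (n <= f1)%N -> (n <= f2)%N -> comps_rec f1 n = comps_rec f2 n.
Proof.
elim: f1 f2 n => [|f1 IH] [|f2] [|n] // n1 n2; rewrite !comps_recS; congr flatten;
  apply/eq_in_map => i.
by rewrite mem_iota => ii; congr map; apply: IH; move: ii n1 n2; clear; lia.
Qed.

(* If h i is the coefficient of z^i in a series with constant term 1, these are
   the coefficients of the inverse series. *)
Definition signed_comps (h : nat -> (seq nat -> rat) -> seq nat -> rat) n c : seq nat -> rat :=
  fun e => \sum_(d <- comps n) (-1) ^+ size d * foldl (fun c' i => h i c') c d e.

Definition prepend i c : seq nat -> rat := fun e => if i is 0%N then c e else c (i :: e).

Definition linear_op (h : (seq nat -> rat) -> seq nat -> rat) :=
  (forall c1 c2 e, h (fun x => c1 x + c2 x) e = h c1 e + h c2 e) /\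
  (forall a c e, h (fun x => a * c x) e = a * h c e) /\
  (forall c1 c2, c1 =1 c2 -> h c1 =1 h c2).

Section signed_comps.
Variable h : nat -> (seq nat -> rat) -> seq nat -> rat.

Lemma signed_comps0 c e : signed_comps h 0 c e = c e.
Proof. by rewrite /signed_comps /comps big_seq1 /= mul1r. Qed.

Lemma signed_compsS n c e : (0 < n)%N ->
  signed_comps h n c e = - \sum_(i <- iota 1 n) signed_comps h (n - i) (h i c) e.
Proof.
case: n => // n _; rewrite /signed_comps {1}/comps comps_recS big_flatten big_map -sumrN.
rewrite big_seq [RHS]big_seq; apply: eq_bigr => i; rewrite mem_iota => ii.
rewrite big_map -sumrN (@comps_rec_fuel n (n.+1 - i)) //; last by move: ii; clear; lia.
by apply: eq_bigr => d _ /=; rewrite exprS mulN1r mulNr.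
Qed.

End signed_comps.

Lemma foldl_linear_op (h : nat -> (seq nat -> rat) -> seq nat -> rat) d :
  (forall i, linear_op (h i)) -> linear_op (fun c => foldl (fun c' i => h i c') c d).
Proof.
move=> hl; elim: d => [|i d [IH1 [IH2 IH3]]] //=.
have [h1 [h2 h3]] := hl i.
split=> [c1 c2 e|]; last split=> [a c e|c1 c2 e].
- by rewrite -IH1; apply: IH3 => x; rewrite h1.
- by rewrite -IH2; apply: IH3 => x; rewrite h2.
- by apply: IH3; apply: h3.
Qed.

Lemma linear_op_sum (h : (seq nat -> rat) -> seq nat -> rat) (I : Type) (r : seq I)
    (F : I -> seq nat -> rat) e : linear_op h ->
  h (fun x => \sum_(i <- r) F i x) e = \sum_(i <- r) h (F i) e.
Proof.
move=> [h1 [h2 h3]]; elim: r => [|i r IH].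
  rewrite big_nil -[RHS](mul0r (h (fun=> 0) e)) -h2; apply: h3 => x.
  by rewrite big_nil mul0r.
by rewrite big_cons -IH -h1; apply: h3 => x; rewrite big_cons.
Qed.

Lemma signed_comps_linear_op h n : (forall i, linear_op (h i)) -> linear_op (signed_comps h n).
Proof.
move=> hl; have F d := foldl_linear_op d hl.
split=> [c1 c2 e|]; last split=> [a c e|c1 c2 ec e]; rewrite /signed_comps.
- by rewrite -big_split; apply: eq_bigr => d _ /=; rewrite (F d).1 mulrDr.
- by rewrite mulr_sumr; apply: eq_bigr => d _; rewrite (F d).2.1 mulrCA.
- by apply: eq_bigr => d _; rewrite ((F d).2.2 _ _ ec).
Qed.

Lemma prepend_linear_op i : linear_op (prepend i).
Proof. by case: i => [|i]; split=> //; split=> // c1 c2 e x; rewrite /prepend e. Qed.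

(* The series with coefficients h i, multiplied by 1 + z. *)
Definition lift1 (h : nat -> (seq nat -> rat) -> seq nat -> rat) i c : seq nat -> rat :=
  fun e => h i c e + h i.-1 c e.

Lemma lift1_linear_op h i : (forall j, linear_op (h j)) -> linear_op (lift1 h i).
Proof.
move=> hl; have [a1 [a2 a3]] := hl i; have [b1 [b2 b3]] := hl i.-1.
split=> [c1 c2 e|]; last split=> [a c e|c1 c2 ec e]; rewrite /lift1.
- by rewrite a1 b1 addrACA.
- by rewrite a2 b2 mulrDr.
- by rewrite (a3 _ _ ec) (b3 _ _ ec).
Qed.

(** Multiplying a series by [1 + z] divides its inverse by [1 + z]. *)
Lemma signed_comps_lift1 n c e : (0 < n)%N ->
  signed_comps (lift1 prepend) n c e + signed_comps (lift1 prepend) n.-1 c e = signed_comps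
    prepend n c e.
Proof.
elim/ltn_ind: n c e => -[|n] IH c e // _; rewrite -[n.+1.-1]/n.
have LL i : linear_op (lift1 prepend i) by apply: lift1_linear_op; exact: prepend_linear_op.
have YL k := signed_comps_linear_op k LL.
rewrite signed_compsS // [RHS]signed_compsS //.
have hI : iota 1 n.+1 = iota 1 n ++ [:: n.+1] by have := iotaD 1 n 1; rewrite addn1 add1n.
have split_sum : \sum_(i <- iota 1 n.+1) signed_comps (lift1 prepend) (n.+1 - i) (lift1 prepend
  i c) e =
  \sum_(i <- iota 1 n.+1) signed_comps (lift1 prepend) (n.+1 - i) (prepend i c) e +
  \sum_(i <- iota 0 n.+1) signed_comps (lift1 prepend) (n - i) (prepend i c) e.
  rewrite (iotaDl 1 0) [LHS]big_map [X in _ = X + _]big_map -big_split; apply: eq_bigr => i _.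
  by rewrite /lift1 (YL _).1 subSS.
have last1 : \sum_(i <- iota 1 n.+1) signed_comps (lift1 prepend) (n.+1 - i) (prepend i c) e =
  \sum_(i <- iota 1 n) signed_comps (lift1 prepend) (n.+1 - i) (prepend i c) e + signed_comps
    (lift1 prepend) 0 (prepend n.+1 c) e.
  by rewrite hI big_cat big_seq1 subnn.
have last2 : \sum_(i <- iota 1 n.+1) signed_comps prepend (n.+1 - i) (prepend i c) e =
  \sum_(i <- iota 1 n) signed_comps prepend (n.+1 - i) (prepend i c) e + signed_comps prepend 0
    (prepend n.+1 c) e.
  by rewrite hI big_cat big_seq1 subnn.
have first2 : \sum_(i <- iota 0 n.+1) signed_comps (lift1 prepend) (n - i) (prepend i c) e =
  signed_comps (lift1 prepend) n c e + \sum_(i <- iota 1 n) signed_comps (lift1 prepend) (n -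
    i) (prepend i c) e.
  by rewrite big_cons subn0.
rewrite split_sum last1 last2 first2 !signed_comps0.
have -> : \sum_(i <- iota 1 n) signed_comps prepend (n.+1 - i) (prepend i c) e =
  \sum_(i <- iota 1 n) signed_comps (lift1 prepend) (n.+1 - i) (prepend i c) e +
  \sum_(i <- iota 1 n) signed_comps (lift1 prepend) (n - i) (prepend i c) e.
  rewrite -big_split big_seq [RHS]big_seq; apply: eq_bigr => i; rewrite mem_iota => ii /=.
  rewrite -IH; [|by move: ii; clear; lia..]; congr (_ + signed_comps _ _ _ _).
  by move: ii; clear; lia.
by move: (signed_comps _ n c e) (\sum_(i <- _) _) (\sum_(i <- _) _) => a b b'; rewrite !opprD;
  lra.
Qed.

(* The signed sum of c over the refinements of g. *)
Fixpoint Phi c g : rat := if g is x :: g' then Phi (signed_comps prepend x c) g' else c [::].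

Definition ccons i (d : seq nat) := if i is 0%N then d else i :: d.

Lemma prependE i c d : prepend i c d = c (ccons i d). Proof. by case: i. Qed.

(* All ways to lower k parts by one, vanishing parts being erased. *)
Fixpoint lowerings k g : seq (seq nat) :=
  if g is x :: g' then [seq ccons x d | d <- lowerings k g'] ++
    (if k is k'.+1 then [seq ccons x.-1 d | d <- lowerings k' g'] else [::])
  else if k is 0%N then [:: [::]] else [::].

(* The action of e_k on coefficients, see [ccoef_mul_elementary]. *)
Definition mulE k c : seq nat -> rat := fun g => \sum_(d <- lowerings k g) c d.

Fixpoint all_lowerings g : seq (seq nat) :=
  if g is x :: g' then [seq ccons x d | d <- all_lowerings g'] ++ [seq ccons x.-1 d | d <-
    all_lowerings g']
  else [:: [::]].

Definition mulEall c : seq nat -> rat := fun g => \sum_(d <- all_lowerings g) c d.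

Lemma Phi_linear_op g : linear_op (fun c _ => Phi c g).
Proof.
elim: g => [|x g [IH1 [IH2 IH3]]] /=; first by split=> //; split=> // c1 c2 ->.
have [h1 [h2 h3]] := signed_comps_linear_op x prepend_linear_op.
split=> [c1 c2 e|]; last split=> [a c e|c1 c2 e].
- by rewrite -(IH1 _ _ [::]); apply: (IH3 _ _ _ [::]) => y; rewrite h1.
- by rewrite -(IH2 _ _ [::]); apply: (IH3 _ _ _ [::]) => y; rewrite h2.
- by apply: IH3; apply: h3.
Qed.

Lemma PhiD c1 c2 g : Phi (fun x => c1 x + c2 x) g = Phi c1 g + Phi c2 g.
Proof. exact: ((Phi_linear_op g).1 _ _ [::]). Qed.

Lemma Phi_sum (I : Type) (r : seq I) (F : I -> seq nat -> rat) g :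
  Phi (fun x => \sum_(i <- r) F i x) g = \sum_(i <- r) Phi (F i) g.
Proof. exact: (linear_op_sum r F [::] (Phi_linear_op g)). Qed.

Lemma PhiZ a c g : Phi (fun x => a * c x) g = a * Phi c g.
Proof. exact: ((Phi_linear_op g).2.1 _ _ [::]). Qed.

Lemma mulEall_linear_op : linear_op mulEall.
Proof.
split=> [c1 c2 e|]; last split=> [a c e|c1 c2 ec e]; rewrite /mulEall.
- by rewrite big_split.
- by rewrite mulr_sumr.
- by apply: eq_bigr => d _.
Qed.

Lemma mulEall_cons c x g : mulEall c (x :: g) = mulEall (lift1 prepend x c) g.
Proof. by rewrite /mulEall /= big_cat /= !big_map -big_split; apply: eq_bigr => d _;
  rewrite /lift1 !prependE. Qed.

Lemma prepend_mulEall i c : prepend i (mulEall c) = if i is 0%N then mulEall c else mulEall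
  (lift1 prepend i c).
Proof. by apply: boolp.funext => g; case: i => // i; rewrite -mulEall_cons. Qed.

Lemma foldl_lift1 c d : comp d ->
  foldl (fun c' i => prepend i c') (mulEall c) d = mulEall (foldl (fun c' i =>
    lift1 prepend i c') c d).
Proof. by elim: d c => //= -[|x] d IH c //= ap; rewrite (prepend_mulEall x.+1) IH. Qed.

Lemma signed_comps_mulEall n c : signed_comps prepend n (mulEall c) = mulEall (signed_comps
  (lift1 prepend) n c).
Proof.
apply: boolp.funext => e; rewrite /signed_comps (linear_op_sum _ _ _ mulEall_linear_op) big_seq
  [RHS]big_seq.
apply: eq_bigr => d; rewrite mem_comps => /andP[cd _].
by rewrite foldl_lift1 // mulEall_linear_op.2.1.
Qed.

Lemma lift1_Phi x c : lift1 prepend x (Phi c) = Phi (fun e =>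
  signed_comps prepend x c e + signed_comps prepend x.-1 c e).
Proof.
have H y : prepend y (Phi c) = Phi (signed_comps prepend y c).
  apply: boolp.funext => g; case: y => [|y] //=.
  by apply: ((Phi_linear_op g).2.2 _ _ _ [::]) => e; rewrite signed_comps0.
by apply: boolp.funext => g; rewrite /lift1 !H PhiD.
Qed.

(* [mulEall] is the multiplication by 1 + e_1 + e_2 + ... *)
Lemma mulEall_Phi_mulEall c g : comp g -> mulEall (Phi (mulEall c)) g = Phi c g.
Proof.
elim: g c => [|x g IH] c /=; first by move=> _; rewrite /mulEall /= big_seq1 /= big_seq1.
(* The outer [mulEall] multiplies the inverse series for the part [x] by [1 + z], and the inner one
   divides it by [1 + z]. *)
move=> /andP[x0 cg]; rewrite mulEall_cons lift1_Phi !signed_comps_mulEall -IH //.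
congr mulEall; congr Phi; apply: boolp.funext => e.
rewrite -mulEall_linear_op.1; apply: mulEall_linear_op.2.2 => e'.
exact: signed_comps_lift1.
Qed.

(** As [comps n] is stable under reversal, the inverse series can be expanded at either end. *)
Lemma signed_comps_last h n c e : (forall i, linear_op (h i)) -> (0 < n)%N ->
  signed_comps h n c e = - \sum_(i <- iota 1 n) h i (signed_comps h (n - i) c) e.
Proof.
move=> hl; have R m : signed_comps h m c = fun e =>
  \sum_(d <- comps m) (-1) ^+ size d * foldl (fun c' i => h i c') c (rev d) e.
  apply: boolp.funext => x; rewrite /signed_comps;
    have : perm_eq (comps m) [seq rev d | d <- comps m].
    apply: uniq_perm; rewrite ?(map_inj_uniq (can_inj revK)) ?uniq_comps // => d.
    by rewrite -{2}(revK d) (mem_map (can_inj revK)) !mem_comps all_rev sumn_rev.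
  by move=> /(perm_big _) ->; rewrite big_map; apply: eq_bigr => d _; rewrite size_rev.
case: n => // n _; rewrite R {1}/comps comps_recS big_flatten big_map -sumrN.
rewrite big_seq [RHS]big_seq; apply: eq_bigr => i; rewrite mem_iota => ii.
rewrite big_map R (linear_op_sum _ _ _ (hl i)) -sumrN (@comps_rec_fuel n (n.+1 - i)) //;
  last by move: ii; clear; lia.
by apply: eq_bigr => d _; rewrite (hl i).2.1 rev_cons foldl_rcons /= exprS mulN1r mulNr.
Qed.

(** The inverse of the inverse: the outer series expanded by [signed_compsS] and the inner one by
    [signed_comps_last] have the same terms. *)
Lemma signed_comps_signed_comps h n c e : (forall i, linear_op (h i)) -> (0 < n)%N ->
  signed_comps (signed_comps h) n c e = h n c e.
Proof.
move=> hl; elim/ltn_ind: n c e => -[|n] IH c e // _.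
rewrite signed_compsS //.
have hI : iota 1 n.+1 = iota 1 n ++ [:: n.+1] by have := iotaD 1 n 1; rewrite addn1 add1n.
rewrite hI big_cat /= big_seq1 subnn signed_comps0.
have -> : \sum_(i <- iota 1 n) signed_comps (signed_comps h) (n.+1 - i) (signed_comps h i c) e =
  \sum_(i <- iota 1 n) h i (signed_comps h (n.+1 - i) c) e.
  have : perm_eq (iota 1 n) [seq (n.+1 - i)%N | i <- iota 1 n].
    apply: uniq_perm; [exact: iota_uniq| |move=> x].
      by rewrite map_inj_in_uniq ?iota_uniq // => x y; rewrite !mem_iota; clear; lia.
    rewrite mem_iota.
    apply/idP/mapP => [xx|[y]]; last by rewrite mem_iota => yy ->; move: yy; clear; lia.
    by exists (n.+1 - x)%N; rewrite ?mem_iota; move: xx; clear; lia.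
  move=> /(perm_big _) ->; rewrite big_map [LHS]big_seq [RHS]big_seq; apply: eq_bigr => i.
  rewrite mem_iota => ii; have e1 : (n.+1 - (n.+1 - i) = i)%N by move: ii; clear; lia.
  by rewrite e1 IH //; move: ii; clear; lia.
rewrite [signed_comps h n.+1 c e](signed_comps_last _ _ hl) // hI big_cat /= big_seq1 subnn.
rewrite (_ : signed_comps h 0 c = c); last by apply: boolp.funext => x; rewrite signed_comps0.
by rewrite !opprD !opprK addKr.
Qed.

Lemma Phi_cat c d g : Phi c (d ++ g) = Phi (foldl (fun c' i =>
  signed_comps prepend i c') c d) g.
Proof. by elim: d c => //=. Qed.

Lemma foldl_prepend c d e : comp d -> foldl (fun c' i => prepend i c') c d e = c (d ++ e).
Proof. by elim: d c => //= -[|x] d IH c //= cd; rewrite IH. Qed.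

Lemma PhiK c g : comp g -> Phi (Phi c) g = c g.
Proof.
elim: g c => //= x g IH c /andP[x0 cg].
transitivity (Phi (Phi (fun e => c (x :: e))) g); last by rewrite IH.
congr (Phi _ g); apply: boolp.funext => e.
transitivity (Phi (signed_comps (signed_comps prepend) x c) e).
  rewrite {2}/signed_comps Phi_sum /signed_comps big_seq [RHS]big_seq.
  apply: eq_bigr => d; rewrite mem_comps => /andP[cd _].
  by rewrite PhiZ foldl_prepend // Phi_cat.
congr (Phi _ e); apply: boolp.funext => y; rewrite signed_comps_signed_comps //;
  last exact: prepend_linear_op.
by case: x x0 {IH}.
Qed.

Lemma Phi_ext c1 c2 g : comp g ->
  (forall d, comp d -> sumn d = sumn g -> c1 d = c2 d) -> Phi c1 g = Phi c2 g.
Proof.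
elim: g c1 c2 => [|x g IH] c1 c2 /=; first by move=> _; apply.
move=> /andP[x0 cg] h; apply: IH => // d cd sd; rewrite /signed_comps big_seq [RHS]big_seq.
apply: eq_bigr => e; rewrite mem_comps => /andP[ce /eqP se].
by rewrite !foldl_prepend // h // ?all_cat ?ce // sumn_cat se sd.
Qed.

Lemma Phi0 c g : comp g -> (forall d, comp d -> sumn d = sumn g -> c d = 0) -> Phi c g = 0.
Proof.
move=> cg h; have := PhiZ 0 c g; rewrite mul0r => <-; apply: Phi_ext => // d cd sd.
by rewrite h ?mulr0.
Qed.

Lemma lowerings_prop k g d : comp g -> d \in lowerings k g -> comp d /\ (sumn d + k = sumn g)%N.
Proof.
elim: g k d => [|x g IH] k d /=; first by case: k => // _; rewrite inE => /eqP->.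
move=> /andP[x0 cg]; rewrite mem_cat => /orP[/mapP[e /(IH _ _ cg) [ce se] ->]|].
  by case: x x0 => //= x _; rewrite ce; split=> //; rewrite -addnA se.
case: k => // k /mapP[e /(IH _ _ cg) [ce se] ->].
case: x x0 => //= -[|x] _ /=; rewrite ce; split=> //; move: se; clear; lia.
Qed.

Lemma lowerings_size k g : (size g < k)%N -> lowerings k g = [::].
Proof.
elim: g k => [|x g IH] [|k] //= ; rewrite ltnS => kg.
by rewrite !IH // ltnW.
Qed.

Lemma mulEall_mulE c g n : (size g <= n)%N -> mulEall c g = \sum_(0 <= i < n.+1) mulE i c g.
Proof.
elim: g n c => [|x g IH] n c /=.
  move=> _; rewrite /mulEall big_seq1 big_nat_recl // {1}/mulE big_seq1 big1 ?addr0 // => i _.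
  by rewrite /mulE big_nil.
case: n => // n gn; rewrite mulEall_cons /lift1 mulEall_linear_op.1 (IH n.+1 _ (ltnW gn)) (IH n
  _ gn).
have E0 : mulE 0 c (x :: g) = mulE 0 (prepend x c) g.
  by rewrite /mulE /= cats0 big_map; apply: eq_bigr => d _; rewrite prependE.
have ES i : mulE i.+1 c (x :: g) = mulE i.+1 (prepend x c) g + mulE i (prepend x.-1 c) g.
  by rewrite /mulE /= big_cat /= !big_map; congr (_ + _); apply: eq_bigr => d _;
    rewrite prependE.
rewrite (big_nat_recl n.+1) // E0 [X in X + _](big_nat_recl n.+1) // -addrA -big_split.
by congr (_ + _); apply: eq_bigr => i _; rewrite ES.
Qed.

Lemma comp_size g : comp g -> (size g <= sumn g)%N.
Proof. by elim: g => //= x g IH /andP[x0 /IH]; move: x0; clear; rewrite /=; lia. Qed.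

(** With [E] for [mulEall], this is the component of [E Phi E = Phi] in degree [e + k], for [c]
    concentrated in degree [e]. The right side has none there, as [k > 0]. *)
Lemma Phi_mulE c e k g : (0 < k)%N -> (forall d, comp d -> sumn d != e -> c d = 0) ->
  comp g -> sumn g = (e + k)%N -> \sum_(0 <= i < k.+1) mulE i (Phi (mulE (k - i) c)) g = 0.
Proof.
move=> k0 hc cg sg; have := mulEall_Phi_mulEall c cg.
rewrite [RHS]Phi0 => [|//|d cd sd]; last first.
  by apply: hc => //; rewrite sd sg -[X in _ != X]addn0 eqn_add2l -lt0n.
rewrite (@mulEall_mulE _ _ (k + e)) => [|]; last by rewrite addnC -sg comp_size.
rewrite (big_cat_nat (n := k.+1)) //=; last by rewrite ltnS leq_addr.
have E n h : comp h -> sumn h = (e + n)%N -> mulEall c h = mulE n c h.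
  move=> ch sh; rewrite (@mulEall_mulE _ _ (sumn h)) ?comp_size //.
  rewrite (bigD1_seq n) ?mem_index_iota ?iota_uniq ?sh ?ltnS ?leq_addl //=.
  rewrite big1 ?addr0 // => i ni; rewrite /mulE big_seq big1 // =>
    d /(lowerings_prop ch) [cd sd].
  by apply: hc => //; move: ni sd; rewrite sh; clear; lia.
rewrite [X in _ + X = _ -> _]big_nat [X in _ + X = _ -> _]big1 => [|i /andP[ki _]].
  rewrite addr0 => h0; rewrite -[RHS]h0 big_nat [RHS]big_nat; apply: eq_bigr => i /andP[_ ik].
  rewrite /mulE big_seq [RHS]big_seq.
  apply: eq_bigr => d /(lowerings_prop cg) [cd sd]; apply: Phi_ext => // h ch sh.
  by rewrite (@E (k - i)%N) //; move: sd sh ik; rewrite sg; clear; lia.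
rewrite /mulE big_seq big1 // => d /(lowerings_prop cg) [cd sd]; apply: Phi0 => // h ch sh.
rewrite (@mulEall_mulE _ _ (sumn h)) ?comp_size // big1 // => j _.
rewrite /mulE big_seq big1 // => x /(lowerings_prop ch) [cx sx]; apply: hc => //.
by move: ki sd sx; rewrite sh sg; clear; lia.
Qed.

(** * Functionals on compositions *)

Local Open Scope nat_scope.

Definition wt (g : seq nat) : nat := sumn [seq 2 ^ x - 1 | x <- g].

(* Bounds the weight of g when d is in lowerings k g; the bound is attained only
   if the lowered parts are exactly the parts >= i. *)
Definition wt_bound i k (d : seq nat) : nat :=
  wt d + k * 2 ^ i.-1 + sumn [seq 2 ^ x - 2 ^ i.-1 | x <- d].

Definition lower_from i (g : seq nat) : seq nat :=
  foldr (fun x d => ccons (if i <= x then x.-1 else x) d) [::] g.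

Lemma ccons_inj y : injective (ccons y).
Proof. by case: y => [|y] d e // []. Qed.

Lemma wt_bound_ccons i k y d : 0 < i ->
  wt_bound i k (ccons y d) = (2 ^ y - 1) + (2 ^ y - 2 ^ i.-1) + wt_bound i k d.
Proof.
move=> i0; case: y => [|y]; last by rewrite /wt_bound /wt /=; clear; lia.
by have := expn_gt0 2 i.-1; rewrite /= expn0; clear; lia.
Qed.

Lemma wt_boundS i k d : wt_bound i k.+1 d = 2 ^ i.-1 + wt_bound i k d.
Proof. by rewrite /wt_bound mulSn; clear; lia. Qed.

Lemma wt_cons x g : wt (x :: g) = (2 ^ x - 1) + wt g. Proof. by []. Qed.

Lemma count_ccons (s : seq (seq nat)) y d :
  count_mem (ccons y d) [seq ccons y e | e <- s] = count_mem d s.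
Proof. by rewrite count_map; apply: eq_count => e /=; rewrite (inj_eq (@ccons_inj y)). Qed.

Lemma pow_pred x : 0 < x -> 2 ^ x = 2 ^ x.-1 + 2 ^ x.-1.
Proof. by case: x => // x _; rewrite expnS mul2n addnn. Qed.

Lemma lowerings_bound i k g d : 0 < i -> comp g -> d \in lowerings k g ->
  wt g <= wt_bound i k d.
Proof.
move=> i0; elim: g k d => [|x g IH] k d /=; first by case: k => // _; rewrite inE => /eqP->.
move=> /andP[x0 cg]; rewrite mem_cat => /orP[/mapP[e /(IH _ _ cg) le ->]|].
  by rewrite wt_cons wt_bound_ccons //; move: le; clear; lia.
case: k => // k /mapP[e /(IH _ _ cg) le ->].
rewrite wt_cons wt_bound_ccons // wt_boundS pow_pred //; move: le (expn_gt0 2 x.-1); clear.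
by case: (leqP (2 ^ x.-1) (2 ^ i.-1)); lia.
Qed.

(** If [d] occurs at all, the hypothesis is an equality by [lowerings_bound], and this forces, part
    by part, the parts [>= i] to be lowered and the others to stay. So there is at most one way. *)
Lemma count_lowerings i k g d : 0 < i -> comp g -> wt_bound i k d <= wt g ->
  count_mem d (lowerings k g) = (lower_from i g == d) && (count (leq i) g == k) :> nat.
Proof.
move=> i0; elim: g k d => [|x g IH] k d.
  by case: k => [|k] _ _ /=; rewrite ?andbT ?andbF // addn0.
rewrite [lowerings _ _]/= [count (leq i) _]/= [lower_from _ _]/= => /andP[x0 cg] le.
have p1 := pow_pred x0.
have L := @lowerings_bound i _ g _ i0 cg.
rewrite count_cat; case: (leqP i x) => ix.
  have -> : count_mem d [seq ccons x d | d <- lowerings k g] = 0.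
    apply/count_memPn/mapP => -[e /L le2 ed]; move: le; rewrite ed wt_cons wt_bound_ccons //.
    have : 2 ^ i.-1 < 2 ^ x by rewrite ltn_exp2l //; move: ix i0; clear; lia.
    by move: le2; clear; lia.
  case: k le => [|k] le; first by rewrite andbF.
  have h : 2 ^ i.-1 <= 2 ^ x.-1 by rewrite leq_exp2l //; move: ix i0; clear; lia.
  case: (boolP (d \in [seq ccons x.-1 d | d <- lowerings k g])) => [/mapP[e _ ed]|nd].
    rewrite ed count_ccons (inj_eq (@ccons_inj _)) add1n eqSS; apply: IH => //.
    by move: le p1 h; rewrite ed wt_cons wt_bound_ccons // wt_boundS; move: (expn_gt0 2 x.-1);
      clear; lia.
  rewrite (count_memPn nd) add1n eqSS; case: eqP => //= ed.
  move: nd; rewrite -ed (mem_map (@ccons_inj _)) => nd.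
  have := IH k (lower_from i g) cg; rewrite eqxx /= (count_memPn nd) => <- //.
  by move: le p1 h; rewrite -ed wt_cons wt_bound_ccons // wt_boundS; move: (expn_gt0 2 x.-1);
    clear; lia.
have h : 2 ^ x <= 2 ^ i.-1 by rewrite leq_exp2l //; move: ix i0; clear; lia.
have -> : count_mem d (if k is k'.+1 then [seq ccons x.-1 d | d <- lowerings k' g] else [::]) =
  0.
  case: k le => // k le; apply/count_memPn/mapP => -[e /L le2 ed].
  move: le; rewrite ed wt_cons wt_bound_ccons // wt_boundS; move: p1 h le2 (expn_gt0 2 x.-1);
    clear; lia.
rewrite addn0 add0n.
case: (boolP (d \in [seq ccons x d | d <- lowerings k g])) => [/mapP[e _ ed]|nd].
  rewrite ed count_ccons (inj_eq (@ccons_inj _)); apply: IH => //.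
  by move: le p1 h; rewrite ed wt_cons wt_bound_ccons //; move: (expn_gt0 2 x.-1); clear; lia.
rewrite (count_memPn nd); case: eqP => //= ed.
move: nd; rewrite -ed (mem_map (@ccons_inj _)) => nd.
have := IH k (lower_from i g) cg; rewrite eqxx /= (count_memPn nd) => <- //.
by move: le p1 h; rewrite -ed wt_cons wt_bound_ccons //; move: (expn_gt0 2 x.-1); clear; lia.
Qed.

Lemma wt_bound_lower_from i w : 0 < i -> comp w ->
  wt_bound i (count (leq i) w) (lower_from i w) = wt w.
Proof.
move=> i0; elim: w => //= x w IH /andP[x0 /IH h].
rewrite wt_bound_ccons // wt_cons -h; case: (leqP i x) => ix.
  rewrite add1n wt_boundS (pow_pred x0).
  have : 2 ^ i.-1 <= 2 ^ x.-1 by rewrite leq_exp2l //; move: ix i0; clear; lia.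
  by move: (expn_gt0 2 x.-1); clear; lia.
have : 2 ^ x <= 2 ^ i.-1 by rewrite leq_exp2l //; move: ix i0; clear; lia.
by rewrite add0n; clear; lia.
Qed.

(** Both kinds of relations in one: lowering all parts [>= i] erases the letters 1 if [i = 1] and
    otherwise merges [i] with [i - 1]. *)
Definition letter_class i w := if i == 1 then strip1 w else fuse i w.

Lemma lower_from1 w : lower_from 1 w = [seq x.-1 | x <- strip1 w & 0 < x].
Proof. by elim: w => //= -[|[|x]] w ->. Qed.

Lemma lower_from_fuse i w : 1 < i -> comp w ->
  lower_from i w = [seq if i < x then x.-1 else x | x <- fuse i w].
Proof.
move=> i1; elim: w => //= x w IH /andP[x0 /IH ->].
case: (x =P i) => [->|xi].
  by rewrite leqnn ltnNge leq_pred /=; case: i i1 {IH} => [|[]].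
case: (ltngtP i x) => [ix|ix|e]; last by rewrite e in xi.
  by case: x ix {x0 xi} => [|[|x]] // ix; move: i1 ix; clear; lia.
by case: x x0 {xi ix}.
Qed.

(** For [i > 1], a fused word does not contain [i], so nothing collides when its letters above [i]
    are lowered. *)
Lemma letter_class_lower_from i w w' : 0 < i -> comp w -> comp w' ->
  (lower_from i w == lower_from i w') = (letter_class i w == letter_class i w').
Proof.
move=> i0 cw cw'; rewrite /letter_class; case: (i =P 1) => [->|/eqP i1].
  have A v : comp v -> [seq x <- strip1 v | 0 < x] = strip1 v.
    by move=> cv; apply/all_filterP; rewrite all_filter; apply/allP => x /(allP cv) /= ->;
      rewrite implybT.
  rewrite !lower_from1 !A //; apply/eqP/eqP => [|->//].
  have : comp (strip1 w) by apply/allP => x; rewrite mem_filter => /andP[_ /(allP cw)].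
  have : comp (strip1 w') by apply/allP => x; rewrite mem_filter => /andP[_ /(allP cw')].
  elim: (strip1 w) (strip1 w') =>
    [|x u IH] [|x' u'] //= /andP[a b] /andP[a' b'] [e /(IH _ b b') ->].
  by move: a a' e; case: x; case: x' => //= x x' _ _ ->.
have {}i1 : 1 < i by move: i0 i1; clear; case: i => [|[]].
rewrite !lower_from_fuse //; apply/eqP/eqP => [|->//].
have N v : i \notin fuse i v.
  by apply/mapP => -[x _]; case: (x =P i) => [_|xi e]; [move: i1; clear; lia|rewrite e in xi].
move: (N w) (N w'); elim: (fuse i w) (fuse i w') => [|x u IH] [|x' u'] //=.
rewrite !inE !negb_or => /andP[a b] /andP[a' b'] [e /(IH _ b b') ->].
by congr (_ :: _); move: a a' e; case: (ltnP i x); case: (ltnP i x'); clear; lia.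
Qed.

Lemma count_fuse_self i w : 0 < i ->
  count_mem i w + count (leq i) (fuse i w) = count (leq i) w.
Proof.
move=> i0; elim: w => //= x w <-; case: (x =P i) => [->|xi]; last by clear; lia.
by move: i0; clear; lia.
Qed.

Lemma count_fuse_pred i w : 0 < i ->
  count_mem i.-1 (fuse i w) = count_mem i.-1 w + count_mem i w.
Proof.
move=> i0; elim: w => //= x w ->; case: (x =P i) => [->|xi]; last by clear; lia.
by rewrite eqxx; move: i0; clear; lia.
Qed.

Lemma count_fuse_other i y w : y != i -> y != i.-1 -> count_mem y (fuse i w) = count_mem y w.
Proof.
move=> yi yj; elim: w => //= x w ->; case: (x =P i) => [->|xi] //.
by rewrite eq_sym (negbTE yj) eq_sym (negbTE yi).
Qed.

(** For [i > 1] the class fixes all multiplicities except how the letters [i - 1] and [i] share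
    their total, which [count (leq i)] tells. For [i = 1] only the number of letters 1 is open, and
    the length tells it. *)
Lemma letter_class_perm i w w' : 0 < i -> letter_class i w = letter_class i w' ->
  count (leq i) w = count (leq i) w' -> comp w -> comp w' -> perm_eq w w'.
Proof.
move=> i0; rewrite /letter_class; case: (i =P 1) => [->|/eqP i1] e c cw cw'; apply/allP =>
  y _ /=; apply/eqP.
  have F v : comp v -> count_mem 1 v = count (leq 1) v - size (strip1 v).
    move=> cv; have -> : count (leq 1) v = size v by move: cv; rewrite all_count => /eqP.
    by rewrite size_filter -(count_predC (pred1 1) v) addnK.
  case: (y =P 1) => [->|/eqP y1]; first by rewrite !F // c e.
  have G v : count_mem y v = count_mem y (strip1 v).
    by rewrite count_filter; apply: eq_count => x /=; case: eqP => // ->; rewrite y1.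
  by rewrite (G w) (G w') e.
have := count_fuse_self w i0; have := count_fuse_self w' i0.
have := count_fuse_pred w i0; have := count_fuse_pred w' i0; rewrite c e.
case: (y =P i) => [->|/eqP yi]; first by move=> _ _ <- /addIn.
case: (y =P i.-1) => [->|/eqP yj].
  by move=> -> e2 <- /addIn eB; move: e2; rewrite eB => /addIn ->.
by rewrite -(count_fuse_other _ yi yj) e (count_fuse_other _ yi yj).
Qed.

Lemma has_leq_max i w : 0 < i -> i <= \max_(p <- w) p -> has (leq i) w.
Proof.
move=> i0; elim: w => [|x w IH]; first by rewrite big_nil; case: i i0.
by rewrite big_cons leq_max /= => /orP[->//|/IH ->]; rewrite orbT.
Qed.

Section Functional.
Variables (d : nat) (L : seq nat -> rat) (R : seq nat -> seq nat -> rat).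

Definition pairing (c : seq nat -> rat) : rat := (\sum_(g <- comps d) L g * c g)%R.

Definition pure_inv_word b := (forall i, 1 < i <= \max_(p <- b) p ->
  has_inv i b) /\ pureb (\max_(p <- b) p) b.

Hypothesis L_mulE : forall k c, 0 < k -> pairing (mulE k c) = 0%R.
Hypothesis L_R : forall b, b \in comps d -> pure_inv_word b -> pairing (R b) = 0%R.
Hypothesis R_diag : forall b, b \in comps d -> Phi (R b) b <> 0%R.
Hypothesis R_lowerings : forall b g, b \in comps d -> g \in comps d -> Phi (R b) g <> 0%R ->
  wt g < wt b \/ g = b.

Definition dualw g := pairing (Phi (fun e => (e == g)%:R)%R).

Local Open Scope ring_scope.

Lemma pairing_sum (I : Type) (r : seq I) (F : I -> seq nat -> rat) :
  pairing (fun x => \sum_(i <- r) F i x) = \sum_(i <- r) pairing (F i).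
Proof. by rewrite /pairing exchange_big; apply: eq_bigr => g _; rewrite mulr_sumr. Qed.

Lemma pairing_ext c1 c2 : {in comps d, c1 =1 c2} -> pairing c1 = pairing c2.
Proof. by move=> e; rewrite /pairing big_seq [RHS]big_seq; apply: eq_bigr => g /e ->. Qed.

Lemma comps_delta (c : seq nat -> rat) g : g \in comps d ->
  c g = \sum_(e <- comps d) c e * (g == e)%:R.
Proof.
move=> gd; rewrite (bigD1_seq g) ?uniq_comps //= eqxx mulr1 big1 ?addr0 // => e.
by rewrite eq_sym => /negbTE ->; rewrite mulr0.
Qed.

Lemma pairing_Phi c : pairing (Phi c) = \sum_(g <- comps d) c g * dualw g.
Proof.
transitivity (\sum_(g <- comps d) pairing (Phi (fun e => c g * (e == g)%:R))).
  rewrite -pairing_sum; apply: pairing_ext => g; rewrite mem_comps => /andP[cg /eqP sg].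
  rewrite -Phi_sum; apply: Phi_ext => // x cx sx.
  by apply: comps_delta; rewrite mem_comps cx sx sg /=.
apply: eq_bigr => g _; rewrite /dualw /pairing mulr_sumr; apply: eq_bigr => e _.
by rewrite PhiZ mulrCA.
Qed.

Lemma lowerings0 g : comp g -> lowerings 0 g = [:: g].
Proof. by elim: g => //= x g IH /andP[x0 /IH ->]; case: x x0. Qed.

Lemma mulE_0 F g : comp g -> mulE 0 F g = F g.
Proof. by move=> cg; rewrite /mulE lowerings0 // big_seq1. Qed.

(** By [Phi_mulE], [Phi (mulE k c)] is minus a sum of terms [mulE i] with [i > 0], each of them
    killed by [L]. *)
Lemma pairing_Phi_mulE k c : (0 < k)%N -> pairing (Phi (mulE k c)) = 0.
Proof.
move=> k0; case: (leqP k d) => kd; last first.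
  rewrite /pairing big_seq big1 // => g; rewrite mem_comps => /andP[cg /eqP sg].
  rewrite Phi0 ?mulr0 // => x cx sx; rewrite /mulE lowerings_size ?big_nil //.
  by apply: leq_ltn_trans kd; rewrite -sg -sx comp_size.
(* In degree [d] only the values of [c] in degree [d - k] matter, while [Phi_mulE] asks [c] to
   vanish elsewhere. *)
pose c0 x := if (sumn x == d - k)%N then c x else 0.
transitivity (pairing (fun g => \sum_(1 <= i < k.+1) - mulE i (Phi (mulE (k - i) c0)) g)).
  apply: pairing_ext => g; rewrite mem_comps => /andP[cg /eqP sg].
  have := @Phi_mulE c0 (d - k)%N k g k0; rewrite big_nat_recl // => h.
  rewrite sumrN; apply/eqP; rewrite -addr_eq0; apply/eqP; rewrite -[RHS]h //; last 2 first.
  - by move=> x cx /negbTE sx; rewrite /c0 sx.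
  - by rewrite subnK.
  congr (_ + _); last by rewrite big_add1.
  rewrite mulE_0 // subn0; apply: Phi_ext => // x cx sx.
  rewrite /mulE big_seq [RHS]big_seq; apply: eq_bigr => y /(lowerings_prop cx) [cy sy].
  by rewrite /c0; case: eqP => // -[]; move: sy; rewrite sx sg; clear; lia.
rewrite (pairing_sum (index_iota 1 k.+1) (fun i g => - mulE i (Phi (mulE (k - i) c0)) g)).
rewrite big_nat big1 // => i /andP[i0 _].
transitivity (- pairing (mulE i (Phi (mulE (k - i) c0)))); last by rewrite L_mulE ?oppr0.
by rewrite /pairing -sumrN; apply: eq_bigr => g _; rewrite mulrN.
Qed.

(** Take the indicator of [lower_from i w], with [k] the number of parts [>= i]. Compositions
    lighter than [w] contribute nothing by assumption; of the others, only those in the class of [w]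
    can be lowered to it, each in one way. *)
Lemma dualw_class i w : (0 < i)%N -> has (leq i) w -> w \in comps d ->
  (forall g, g \in comps d -> (wt g < wt w)%N -> dualw g = 0) ->
  wsum w dualw (fun x => letter_class i x == letter_class i w) = 0.
Proof.
move=> i0; rewrite has_count; set k := count _ w => k0 wd lowerings0.
have [cw /eqP sw] : comp w /\ sumn w == d by apply/andP; rewrite -mem_comps.
rewrite -(@pairing_Phi_mulE k (fun e => (e == lower_from i w)%:R) k0) pairing_Phi /wsum.
have W g : (g \in permutations w) -> g \in comps d.
  rewrite mem_permutations mem_comps => gw.
  by rewrite (perm_all _ gw) cw (perm_sumn gw) sw /=.
have E g : mulE k (fun e => (e == lower_from i w)%:R) g = (count_mem (lower_from i w)
  (lowerings k g))%:R.
  rewrite /mulE; elim: (lowerings k g) => [|x s IH]; first by rewrite big_nil.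
  by rewrite big_cons IH /= natrD.
rewrite [RHS](bigID (fun g => (g \in permutations w) && (letter_class i g == letter_class i
  w))) /=.
rewrite [X in _ = _ + X]big_seq_cond [X in _ = _ + X]big1 ?addr0 => [|g /andP[gd ng]];
  last first.
  have [cg /eqP sg] : comp g /\ sumn g == d by apply/andP; rewrite -mem_comps.
  rewrite E; case: (ltnP (wt g) (wt w)) => lt; first by rewrite lowerings0 // mulr0.
  rewrite (@count_lowerings i) ?wt_bound_lower_from //; case: eqP => [el|]; last
    by rewrite mul0r.
  case: eqP => [ek|]; last by rewrite mul0r.
  have ec : letter_class i g = letter_class i w by apply/eqP;
    rewrite -letter_class_lower_from // el.
  by case/negP: ng; rewrite ec eqxx andbT mem_permutations (letter_class_perm i0 ec).
transitivity (\sum_(g <- permutations w | letter_class i g == letter_class i w)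
   mulE k (fun e => (e == lower_from i w)%:R) g * dualw g).
  rewrite big_seq_cond [RHS]big_seq_cond; apply: eq_bigr => g /andP[gw ec].
  have gd := W _ gw; have [cg _] : comp g /\ sumn g == d by apply/andP; rewrite -mem_comps.
  have pw : perm_eq g w by rewrite -mem_permutations.
  rewrite E (@count_lowerings i) ?wt_bound_lower_from //; last
    by rewrite /wt (perm_sumn (perm_map _ pw)).
  by rewrite letter_class_lower_from // ec /k (permP pw) eqxx mul1r.
rewrite -[LHS]big_filter -[RHS]big_filter.
apply: perm_big; apply: uniq_perm.
- by rewrite filter_uniq // permutations_uniq.
- by rewrite filter_uniq // uniq_comps.
move=> g; rewrite !mem_filter; case: (letter_class i g == letter_class i w) => //=;
  rewrite ?andbF ?andbT //.
by case: (boolP (g \in permutations w)) => //= /W ->.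
Qed.

Lemma dualw_vanish w : w \in comps d ->
  (forall g, g \in comps d -> (wt g < wt w)%N -> dualw g = 0) -> dualw w = 0.
Proof.
move=> wd IH; have [cw /eqP sw] : comp w /\ sumn w == d by apply/andP; rewrite -mem_comps.
have W g : (g \in permutations w) -> g \in comps d.
  rewrite mem_permutations mem_comps => gw.
  by rewrite (perm_all _ gw) cw (perm_sumn gw) sw /=.
have Wwt g : (g \in permutations w) -> wt g = wt w.
  by rewrite mem_permutations => pw; rewrite /wt (perm_sumn (perm_map _ pw)).
pose m := (\max_(p <- w) p)%N.
have HR i : (0 < i <= m)%N -> forall w', w' \in permutations w ->
    wsum w dualw (fun x => letter_class i x == letter_class i w') = 0.
  move=> /andP[i0 im] w' ww'.
  have pw : perm_eq w' w by rewrite -mem_permutations.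
  rewrite -(@dualw_class i w') ?W // => [||g gd]; last by rewrite (Wwt w') //; apply: IH.
    by rewrite /wsum; apply: perm_big; apply: uniq_perm; rewrite ?permutations_uniq // => x;
      rewrite !mem_permutations (permPr pw).
  rewrite (eq_has_r (perm_mem pw)); exact: has_leq_max.
(* If some [x > 1] occurs without [x - 1], the class of [w] under [fuse x] is a single
   rearrangement. Otherwise the letters are exactly [1..m], as [words_vanish] requires. *)
case: (boolP (all (fun x => (x == 1)%N || (x.-1 \in w)) w)) => [full|]; last first.
  rewrite -has_predC => /hasP[x xw]; rewrite /= negb_or => /andP[x1 xn].
  have x0 : (0 < x)%N by exact: (allP cw).
  have := HR x _ w; rewrite x0 /= (leq_bigmax_seq x) // mem_permutations perm_refl =>
    /(_ isT isT).
  rewrite /wsum -big_filter => <-.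
  rewrite (_ : [seq _ <- _ | _] = [:: w]) ?big_seq1 //.
  rewrite -(filter_pred1_uniq (permutations_uniq w)) ?mem_permutations //.
  apply: eq_in_filter => g; rewrite mem_permutations => gw; rewrite /letter_class (negbTE x1).
  apply/eqP/eqP => [|->//].
  have : x.-1 \notin g by rewrite (perm_mem gw).
  elim: (g) (w) xn => [|y u IHu] [|z v] //=; rewrite !inE !negb_or =>
    /andP[zx vx] /andP[yx ux] [e /(IHu _ vx ux) ->].
  by congr (_ :: _); move: e yx zx; case: (y =P x) => [->|yx]; case: (z =P x) => [->|zx] //;
    clear; move=> ->; rewrite eqxx.
have memw x : (x \in w) = (0 < x <= m)%N.
  apply/idP/idP => [xw|]; first by rewrite (allP cw x xw : (0 < x)%N) leq_bigmax_seq.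
  move=> /andP[x0 xm].
  have mw : m \in w.
    have := has_leq_max (leq_trans x0 xm) (leqnn m) => /hasP[y yw my].
    by rewrite (_ : m = y) //; apply/eqP; rewrite eqn_leq my leq_bigmax_seq.
  rewrite -(subKn xm); move: x0; rewrite -{1}(subKn xm).
  elim: (m - x)%N => [|k IHk] h; first by rewrite subn0.
  have h2 := IHk (leq_trans h (leq_sub2l _ (leqnSn k))).
  have /orP[/eqP e|] := allP full _ h2; last by rewrite subnS.
  by move: h; rewrite subnS e.
apply: (@words_vanish m w dualw memw) => [i P im|m0 P|g gw inv_g pure_g|].
- apply: (wsum_fib (h := fuse i)) => w' ww' Pw'.
  have i0 : (0 < i <= m)%N by move: im => /andP[/ltnW -> ->].
  have := HR _ i0 _ ww'; rewrite /letter_class; case: (i =P 1%N) => [e|_ h]; first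
    by rewrite e in im.
  by rewrite -[RHS]h; apply: wsum_ext => x _ /=; case: (fuse i x =P _) => [->|];
    rewrite ?Pw' ?andbF.
- apply: (wsum_fib (h := strip1)) => w' ww' Pw'.
  have := HR 1%N; rewrite m0 => /(_ isT _ ww'); rewrite /letter_class eqxx => h.
  by rewrite -[RHS]h; apply: wsum_ext => x _ /=; case: (strip1 x =P _) => [->|];
    rewrite ?Pw' ?andbF.
- have mg : (\max_(p <- g) p)%N = m.
    by apply: perm_big; rewrite -mem_permutations.
  have gd := W _ gw.
  (* This is the pairing with [R g], since [Phi] is an involution. Expanded in values of [dualw],
     only the diagonal term is left, the others having smaller weight. *)
  have : pairing (Phi (Phi (R g))) = 0.
    rewrite -(L_R gd); last by rewrite /pure_inv_word mg.
    apply: pairing_ext => x; rewrite mem_comps => /andP[cx _]; exact: PhiK.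
  rewrite pairing_Phi (bigD1_seq g) ?uniq_comps //= big_seq_cond big1 ?addr0 =>
    [|x /andP[xd xg]].
    by move/eqP; rewrite mulf_eq0 => /orP[/eqP/(R_diag gd)//|/eqP].
  case: (eqVneq (Phi (R g) x) 0) => [->|/eqP nz]; first by rewrite mul0r.
  have [lt|e] := R_lowerings gd xd nz; last by rewrite e eqxx in xg.
  by rewrite IH ?mulr0 // -(Wwt g).
- by rewrite mem_permutations.
Qed.

Theorem pairing_vanish c : pairing c = 0.
Proof.
have L0 n g : g \in comps d -> (wt g < n)%N -> dualw g = 0.
  elim: n g => // n IH g gd gn; apply: dualw_vanish => // x xd xg.
  by apply: IH => //; apply: leq_trans xg gn.
rewrite (@pairing_ext _ (Phi (Phi c))) => [|x]; last by rewrite mem_comps => /andP[cx _];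
  rewrite PhiK.
by rewrite pairing_Phi big_seq big1 // => g gd; rewrite (L0 (wt g).+1) ?mulr0.
Qed.

End Functional.

(** * Standard fillings and reading order *)

Section Blocks.
Variable T : eqType.
Implicit Types (r : rel T) (w L : seq T).

Fixpoint block_sorted r (d : seq nat) L : bool :=
  if d is x :: d' then sorted r (take x L) && block_sorted r d' (drop x L) else true.

Variable r : rel T.
Hypothesis r_total : forall x y, x != y -> r x y = ~~ r y x.
Local Notation rd := (fun x y => r y x).
Local Open Scope ring_scope.

(** For [w = z :: _], the terms with [i > 0] all contain the factor [r y z]; by induction they
    cancel the term [i = 0] unless [y] and [z] are in decreasing order. *)
Lemma sign_sum y w : uniq (y :: w) ->
  \sum_(0 <= i < (size w).+1) (-1) ^+ i * ((path r y (take i w))%:R * (sorted rd (drop i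
    w))%:R) =
  (path rd y w)%:R :> rat.
Proof.
elim: w y => [|z w IH] y uw; first by rewrite big_nat1 expr0 !mul1r.
have uzw : uniq (z :: w) by case/andP: uw.
have yz : y != z by move: uw; rewrite /= inE negb_or => /andP[/andP[]].
rewrite big_nat_recl // expr0 mul1r.
transitivity ((path rd z w)%:R - (r y z)%:R * (path rd z w)%:R : rat).
  congr (_ + _); first by rewrite /= mul1r.
  rewrite -(IH z uzw) mulr_sumr -sumrN; apply: eq_bigr => i _.
  rewrite exprS mulN1r mulNr /=; case: (r y z); first by rewrite mul1r.
  by rewrite !mul0r mulr0.
by rewrite /= (r_total yz); case: (r z y); rewrite /= ?mul1r ?mul0r ?subr0 ?subrr.
Qed.

Lemma sign_sum1 w : uniq w -> w != [::] ->
  \sum_(i <- iota 1 (size w)) (-1) ^+ i * ((sorted r (take i w))%:R * (sorted rd (drop i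
    w))%:R) =
  - (sorted rd w)%:R :> rat.
Proof.
case: w => // y w uw _; rewrite -(sign_sum uw) -sumrN (iotaDl 1 0) big_map; apply: eq_bigr =>
  i _.
by rewrite add1n exprS mulN1r mulNr.
Qed.

Definition block_indic r' L : seq nat -> rat := fun d => (block_sorted r' d L)%:R.

Lemma prepend_block_indic i w : (0 < i)%N ->
  prepend i (block_indic r w) = fun d => (sorted r (take i w))%:R * block_indic r (drop i w) d.
Proof. by case: i => // i _; apply: boolp.funext => d;
  rewrite /prepend /block_indic /= -natrM mulnb. Qed.

(** Expanding at the first increasing piece and using induction on the rest turns the signed sum
    into that of [sign_sum1]. *)
Lemma signed_comps_block_indic g w e : uniq w -> (g <= size w)%N ->
  signed_comps prepend g (block_indic r w) e = (-1) ^+ g * ((sorted rd (take g w))%:R *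
    block_indic r (drop g w) e).
Proof.
elim/ltn_ind: g w e => g IH w e uw gw; case: (posnP g) => [->|g0].
  by rewrite signed_comps0 take0 drop0 !mul1r.
rewrite signed_compsS //; set v := take g w.
have sv : size v = g by rewrite size_takel.
have v0 : v != [::] by rewrite -size_eq0 sv -lt0n.
have uv : uniq v by rewrite take_uniq.
have := sign_sum1 uv v0; rewrite sv => h.
rewrite -[(sorted _ v)%:R]opprK -h mulNr mulrN; congr (- _).
rewrite mulr_suml mulr_sumr big_seq [RHS]big_seq; apply: eq_bigr => i; rewrite mem_iota => ii.
have ig : (i <= g)%N by move: ii; clear; lia.
rewrite prepend_block_indic; last by case/andP: ii.
rewrite (signed_comps_linear_op _ prepend_linear_op).2.1 IH ?drop_uniq //; last 2 first.
- by move: ii; clear; lia.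
- by rewrite size_drop leq_sub2r.
rewrite drop_drop subnK // take_drop subnK // -/v take_takel //.
have -> : (-1) ^+ (g - i) = (-1) ^+ g * (-1) ^+ i :> rat.
  by rewrite -signr_odd oddB // signr_addb !signr_odd.
by ring.
Qed.

Lemma Phi_block_indic g w : uniq w -> (sumn g <= size w)%N ->
  Phi (block_indic r w) g = (-1) ^+ sumn g * block_indic rd w g.
Proof.
elim: g w => [|x g IH] w uw gw; first by rewrite /= mul1r.
rewrite [LHS]/=; transitivity (Phi (fun e =>
  ((-1) ^+ x * (sorted rd (take x w))%:R) * block_indic r (drop x w) e) g).
  congr (Phi _ g); apply: boolp.funext => e; rewrite signed_comps_block_indic ?mulrA //.
  by move: gw; rewrite /=; clear; lia.
rewrite PhiZ IH ?drop_uniq //; last by rewrite size_drop; move: gw; rewrite /=; clear; lia.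
rewrite /= exprD -!mulrA; congr (_ * _); rewrite mulrCA; congr (_ * _).
by rewrite -natrM mulnb.
Qed.

End Blocks.

Definition cell := (nat * nat)%type.

(* Column 0 is read downwards and the others upwards, so that breaking ties in
   this order turns the tableau conditions into conditions on standard fillings. *)
Definition reading_lt (c c' : cell) : bool :=
  (c.2 < c'.2) || ((c.2 == c'.2) && (if c.2 == 0 then c.1 < c'.1 else c'.1 < c.1)).

Lemma reading_lt_total x y : x != y -> reading_lt x y = ~~ reading_lt y x.
Proof.
case: x y => [a b] [a' b']; rewrite /reading_lt /= xpair_eqE negb_and.
case: (ltngtP b b') => //= ->; rewrite ?eqxx ?orbF.
by case: (b' == 0); case: (ltngtP a a') => //= ->; rewrite eqxx.
Qed.

Lemma reading_lt_irr : irreflexive reading_lt.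
Proof. by move=> [a b]; rewrite /reading_lt /= ltnn eqxx ltnn if_same. Qed.

Lemma reading_lt_trans : transitive reading_lt.
Proof.
move=> [a b] [c d] [e f]; rewrite /reading_lt /= =>
  /orP[db|/andP[/eqP-> h1]] /orP[bf|/andP[/eqP <- h2]].
- by rewrite (ltn_trans db bf).
- by rewrite db.
- by rewrite bf.
by move: h1 h2; rewrite ltnn eqxx /=; case: eqP => _; clear; lia.
Qed.

(* The tableau conditions on the cells of A, lt c c' meaning that the entry of c
   is smaller than that of c', or equal and read first. *)
Definition good_rel (A : pred cell) (lt : rel cell) :=
  [/\ forall i i', i < i' -> A (i, 0) -> A (i', 0) -> lt (i, 0) (i', 0),
      forall i j, A (i, j.+1) -> A (i, j) -> lt (i, j.+1) (i, j)
    & forall i i' j, i < i' -> A (i', j.+1) -> (A (i, j.+1) -> lt (i, j.+1) (i', j.+1)) ->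
      A (i, j) -> lt (i, j) (i', j.+1)].

Definition before (L : seq cell) : rel cell := fun c c' => index c L < index c' L.

Definition good (L : seq cell) := good_rel (mem L) (before L).

Definition col_weight (L : seq cell) := sumn [seq 2 ^ c.2 | c <- L].

Lemma col_weight_perm L L' : perm_eq L L' -> col_weight L = col_weight L'.
Proof. by move=> pL; exact: perm_sumn (perm_map _ pL). Qed.

Lemma good_catr B L : uniq (B ++ L) -> good (B ++ L) ->
  (forall c c', c \in B -> c' \in L -> c.1 < c'.1) -> good L.
Proof.
rewrite cat_uniq => /and3P[_ BL _] [g1 g2 g3] rows.
have NB c : c \in L -> c \notin B by move=> cL; apply: contra BL => fused_match; apply/hasP;
  exists c.
have bE c c' : c \in L -> c' \in L -> before (B ++ L) c c' = before L c c'.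
  by move=> /NB fused_match /NB cB';
    rewrite /before !index_cat (negbTE fused_match) (negbTE cB') ltn_add2l.
have m c : c \in L -> c \in B ++ L by rewrite mem_cat orbC => ->.
split=> [i i' ii a a'|i j a a'|i i' j ii a b a'].
- by rewrite -bE //; apply: g1 => //; apply: m.
- by rewrite -bE //; apply: g2 => //; apply: m.
- rewrite -bE //; apply: g3 => //; try exact: m.
  rewrite [mem _ _]/= mem_cat => /orP[fused_match|cL]; last by rewrite bE //; apply: b.
  by have := rows _ _ fused_match a'; rewrite ltnn.
Qed.

Definition closed_row (L : seq cell) := forall i j, (i, j.+1) \in L -> (i, j) \in L.

(** Two cells of one column cannot share a decreasing block. In column 0 the first goodness
    condition forbids it. If [(a, j + 1)] comes before [(a', j + 1)] with [a < a'], the other two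
    put [(a, j)] between them, hence into the block, where a cell of column [j] cannot precede one
    of column [j + 1]. *)
Lemma dec_cols L (B : seq cell) s t : L = s ++ B ++ t -> uniq L -> good L -> closed_row L ->
  sorted (fun x y => reading_lt y x) B -> sorted gtn [seq c.2 | c <- B].
Proof.
move=> LE uL [g1 g2 g3] cl sB.
have tr : transitive (fun x y => reading_lt y x) by move=> a b c h1 h2;
  apply: reading_lt_trans h2 h1.
have pw : pairwise (fun x y => reading_lt y x) B by rewrite -sorted_pairwise.
have uB : uniq B by move: uL; rewrite LE !cat_uniq => /and3P[_ _ /and3P[]].
have iB c : c \in B -> index c L = size s + index c B.
  move=> fused_match; rewrite LE index_cat; case: ifP => [cs|_]; last
    by rewrite index_cat fused_match.
  by move: uL; rewrite LE cat_uniq => /and3P[_ /hasPn /(_ c)];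
    rewrite mem_cat fused_match cs => /(_ isT).
have mL c : c \in B -> c \in L by rewrite LE !mem_cat => ->; rewrite orbT.
have bR c c' : c \in B -> c' \in B -> before L c c' -> reading_lt c' c.
  move=> fused_match cB'; rewrite /before !iB // ltn_add2l => lt.
  move/pairwiseP: pw => /(_ c _ _ _ _ lt); rewrite !inE !index_mem => /(_ fused_match cB').
  by rewrite !nth_index.
have btw x c c' : c \in B -> c' \in B -> before L c x -> before L x c' -> x \in B.
  rewrite /before => fused_match cB'; rewrite (iB c) // (iB c') // => h1 h2.
  have xL : x \in L.
    rewrite -index_mem; apply: ltn_trans h2 _.
    by rewrite LE !size_cat ltn_add2l ltn_addr // index_mem.
  case: (boolP (x \in B)) => // xB; move: xL h1 h2.
  rewrite LE !mem_cat !index_cat (negbTE xB); case: ifP => [xs|_] /=.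
    by move=> _; rewrite ltnNge ltnW // ltn_addr // index_mem.
  move=> _ _; rewrite ltn_add2l => lt.
  by have := ltn_trans lt (_ : index c' B < size B); rewrite index_mem ltnNge leq_addr =>
    /(_ cB').
rewrite sorted_pairwise ?pairwise_map => [|x y z]; last by move=> h1 h2; apply: ltn_trans h2 h1.
apply/(pairwiseP (0, 0)) => p q; rewrite !inE => pB qB pq.
set c := nth _ B p; set c' := nth _ B q.
have fused_match : c \in B by apply: mem_nth.
have cB' : c' \in B by apply: mem_nth.
have cc' : before L c c' by rewrite /before !iB // ltn_add2l !index_uniq.
have := bR _ _ fused_match cB' cc'; rewrite /reading_lt /=.
case: (ltngtP c'.2 c.2) => //= e.
move: (c) (c') e fused_match cB' cc' => [a j] [a' j'] /= -> fused_match cB' cc'.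
case: j fused_match cB' cc' => [|j] fused_match cB' cc' /= aa'.
  by have := g1 _ _ aa' (mL _ cB') (mL _ fused_match); rewrite /before ltnNge (ltnW cc').
have m : (a, j) \in L by apply/cl/mL.
have h1 := g2 _ _ (mL _ fused_match) m.
have h2 := g3 _ _ _ aa' (mL _ cB') (fun _ => cc') m.
have := bR _ _ (btw _ _ _ fused_match cB' h1 h2) cB' h2.
by rewrite /reading_lt /= ltnNge leqnSn /= eqn_leq ltnn.
Qed.

Lemma rev_iotaS n : rev (iota 0 n.+1) = n :: rev (iota 0 n).
Proof. by have := iotaD 0 n 1; rewrite addn1 => ->; rewrite rev_cat. Qed.

Lemma cols_wt (s : seq nat) : sorted gtn s ->
  2 ^ size s - 1 <= sumn [seq 2 ^ x | x <- s] /\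
  (sumn [seq 2 ^ x | x <- s] = 2 ^ size s - 1 -> s = rev (iota 0 (size s))).
Proof.
elim: s => //= x s IH px; have [le eq] := IH (path_sorted px).
have sx : size s <= x.
  elim: s x px {IH le eq} => //= y s IH x /andP[xy /IH le]; exact: leq_ltn_trans le xy.
have e1 : 2 ^ size s <= 2 ^ x by rewrite leq_exp2l.
have e2 := expn_gt0 2 (size s).
split; first by rewrite expnS; move: le e1 e2; clear; lia.
rewrite expnS => h.
have e3 : 2 ^ x = 2 ^ size s by move: le e1 e2 h; clear; lia.
have ex : x = size s by apply/eqP; rewrite -(eqn_exp2l (m := 2)) // e3.
rewrite -[RHS]/(rev (iota 0 (size s).+1)) rev_iotaS -eq -?ex //.
by move: h e3 e2; clear; lia.
Qed.

Lemma block_sorted_wt L g s L' : L = s ++ L' -> uniq L -> good L -> closed_row L ->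
  block_sorted (fun x y => reading_lt y x) g L' -> sumn g = size L' -> wt g <= col_weight L'.
Proof.
move=> + uL gL cl; elim: g s L' => //= x g IH s L' LE /andP[sB bl] sg.
rewrite wt_cons -[X in _ <= col_weight X](cat_take_drop x) /col_weight map_cat sumn_cat leq_add
  //.
  have := dec_cols (s := s) (B := take x L') (t := drop x L'); rewrite cat_take_drop =>
    /(_ _ LE uL gL cl sB).
  move/cols_wt => []; rewrite size_map size_takel; last by rewrite -sg leq_addr.
  by rewrite -map_comp.
apply: (IH (s ++ take x L')) => //; first by rewrite -catA cat_take_drop.
by rewrite size_drop -sg addKn.
Qed.

Fixpoint cells_from p (al : seq nat) : seq cell :=
  if al is a :: al' then [seq (p, j) | j <- iota 0 a] ++ cells_from p.+1 al' else [::].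

Lemma mem_cells_from p al i j : ((i, j) \in cells_from p al) = (p <= i) && (j < nth 0 al (i -
  p)).
Proof.
elim: al p => [|a al IH] p /=; first by rewrite nth_nil andbF.
rewrite mem_cat IH; case: (ltngtP p i) => [pi|pi|->] /=; last first.
- rewrite subnn /= orbF; apply/mapP/idP => [[k]|ja]; first by rewrite mem_iota =>
  /andP[_ ka] [->].
  by exists j => //; rewrite mem_iota.
- by rewrite orbF; apply/mapP => -[k _ [e _]]; rewrite e ltnn in pi.
have -> : i - p = (i - p.+1).+1 by move: pi; clear; lia.
rewrite /= orb_idl // => /mapP[k _ [e _]]; by rewrite e ltnn in pi.
Qed.

Lemma uniq_cells_from p al : uniq (cells_from p al).
Proof.
elim: al p => //= a al IH p; rewrite cat_uniq IH map_inj_uniq ?iota_uniq ?andbT /=; last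
  by move=> x y [].
apply/hasPn => -[i j]; rewrite mem_cells_from => /andP[pi _].
by apply/mapP => -[k _ [e _]]; rewrite e ltnn in pi.
Qed.

Lemma col_weight_cells_from p al : col_weight (cells_from p al) = wt al.
Proof.
elim: al p => //= a al IH p; rewrite wt_cons /col_weight map_cat sumn_cat -(IH p.+1);
  congr (_ + _).
rewrite -map_comp; elim: a => // a IHa.
rewrite -(addn1 a) iotaD map_cat sumn_cat IHa /= addn1 expnS add0n.
by have := expn_gt0 2 a; clear; lia.
Qed.

Lemma size_cells_from p al : size (cells_from p al) = sumn al.
Proof. by elim: al p => //= a al IH p; rewrite size_cat size_map size_iota IH. Qed.

Lemma closed_cells_from p al L : perm_eq L (cells_from p al) -> closed_row L.
Proof.
by move=> pL i j; rewrite !(perm_mem pL) !mem_cells_from => /andP[-> /ltnW].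
Qed.

Lemma block_sorted_wt_le al L g p : perm_eq L (cells_from p al) -> good L ->
  block_sorted (fun x y => reading_lt y x) g L -> sumn g = size L -> wt g <= wt al.
Proof.
move=> pL gL bL sg; rewrite -(col_weight_cells_from p al) -(col_weight_perm pL).
apply: (@block_sorted_wt L g [::] L) => //; first by rewrite (perm_uniq pL) uniq_cells_from.
exact: closed_cells_from pL.
Qed.

(** Equality forces the first block to run through the columns [x - 1, ..., 0]. From its end: the
    cell of column 0 is [(p, 0)], the first one of that column in [L], and the third goodness
    condition makes [(p, j + 1)] the cell just before [(p, j)]. So the block is the top row, and the
    other rows follow by induction. *)
Lemma block_sorted_wt_eq al L g p : comp al -> comp g -> perm_eq L (cells_from p al) ->
  good L ->
  block_sorted (fun x y => reading_lt y x) g L -> sumn g = size L -> wt g = wt al -> g = al.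
Proof.
elim: al L g p => [|a al IH] L g p.
  by move=> _ cg /perm_size -> _ _; case: g cg => [|[|x] g].
move=> /= /andP[a0 ca] cg pL gL bL sg eg.
have uL : uniq L by rewrite (perm_uniq pL) (uniq_cells_from p (a :: al)).
have cl : closed_row L := closed_cells_from (al := a :: al) pL.
have mL i j : ((i, j) \in L) = (p <= i) && (j < nth 0 (a :: al) (i - p)).
  by rewrite (perm_mem pL) (mem_cells_from p (a :: al)).
case: g cg bL sg eg => [|x g] /=.
  by move=> _ _ sg; move: (mL p 0); rewrite leqnn subnn /= a0; move: sg; case: (L).
move=> /andP[x0 cg] /andP[sB bL] sg eg.
have xL : x <= size L by rewrite -sg leq_addr.
set B := take x L; set L' := drop x L.
have LE : L = B ++ L' by rewrite cat_take_drop.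
have sB' : size B = x by rewrite size_takel.
have [wB eB] := cols_wt (dec_cols (s := [::]) (t := L') LE uL gL cl sB).
have wL : wt g <= col_weight L'.
  by apply: (@block_sorted_wt L g B L') => //; rewrite size_drop -sg addKn.
have cE : col_weight B + col_weight L' = wt (x :: g).
  by rewrite eg -(col_weight_cells_from p (a :: al)) -(col_weight_perm pL) /col_weight
    -sumn_cat -map_cat -LE.
move: wB eB cE; rewrite size_map -map_comp sB' wt_cons -/(col_weight B) => wB eB cE.
have {}eB : [seq c.2 | c <- B] = rev (iota 0 x) by apply: eB; move: wB wL cE; clear; lia.
have colB k : k < x -> (nth (0, 0) B k).2 = x - k.+1.
  move=> kx; rewrite -(nth_map (0,0) 0 (fun c : cell => c.2)) ?sB' // eB nth_rev ?size_iota //.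
  by rewrite nth_iota ?add0n //; move: kx; clear; lia.
have iB c : index c L < x -> c \in B.
  move=> ic; rewrite -(nth_index (0,0) (_ : c \in L)); last by rewrite -index_mem;
    apply: leq_trans ic xL.
  by rewrite -(nth_take (0,0) ic) mem_nth // sB'.
have nB k : k < x -> index (nth (0, 0) B k) L = k.
  by move=> kx; rewrite nth_take // index_uniq //; apply: leq_trans kx xL.
have iBc c : index c L < x -> c.2 = x - (index c L).+1.
  move=> ic; rewrite -colB // nth_take // nth_index // -index_mem; apply: leq_trans ic xL.
have mB k : k < x -> nth (0, 0) B k \in L.
  by move=> kx; rewrite LE mem_cat mem_nth // sB'.
have [g1 g2 g3] := gL.
have rowB j : j < x -> nth (0, 0) B (x - j.+1) = (p, j).
  elim: j => [|j IHj] jx.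
    have kx : x - 1 < x by move: x0; clear; lia.
    have := colB _ kx; have := mB _ kx; have := nB _ kx; case: (nth _ _ _) => [i j] /= ni + e.
    have {}e : j = 0 by move: e x0; clear; lia.
    rewrite {}e in ni *; rewrite mL => /andP[]; rewrite leq_eqVlt => /orP[/eqP -> //|pi] _.
    have p0 : (p, 0) \in L by rewrite mL leqnn subnn.
    have i0 : (i, 0) \in L by rewrite -index_mem ni; apply: leq_trans kx xL.
    have lt := g1 _ _ pi p0 i0; rewrite /before ni in lt.
    have := iBc (p, 0) (ltn_trans lt kx); move: lt x0 => /=; clear; lia.
  have kx : x - j.+2 < x by move: x0; clear; lia.
  have jx' : j < x by exact: ltnW.
  have := colB _ kx; have := mB _ kx; have := nB _ kx; case E: (nth _ _ _) => [i j'] /= ni + e.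
  have {}e : j' = j.+1 by move: e jx; clear; lia.
  rewrite {}e in ni E *; rewrite mL => /andP[]; rewrite leq_eqVlt => /orP[/eqP -> //|pi] _.
  have ij : (i, j.+1) \in L by rewrite -index_mem ni; apply: leq_trans kx xL.
  have pj : (p, j) \in L by rewrite -(IHj jx') mB //; move: x0; clear; lia.
  have npj : index (p, j) L = x - j.+1 by rewrite -(IHj jx') nB //; move: x0; clear; lia.
  suff : before L (p, j) (i, j.+1) by rewrite /before npj ni; move: jx; clear; lia.
  apply: g3 => // pj1; have := g2 _ _ pj1 pj; rewrite /before npj ni => lt.
  suff : index (p, j.+1) L != x - j.+2 by move: lt jx; clear; lia.
  apply/eqP => e; have : nth (0,0) L (index (p, j.+1) L) = (i, j.+1)
    by rewrite e -(nth_take (0,0) kx) E.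
  by rewrite nth_index // => -[ep]; rewrite ep ltnn in pi.
(* If the row went on, [(p, x)] would have to come before [(p, x - 1)], which has index 0. *)
have ex : x = a.
  have kx : x.-1 < x by move: x0; clear; lia.
  have ax : x <= a.
    have := mB _ kx.
    have := rowB x.-1 kx; rewrite prednK // subnn => eq0.
    have := mB 0 x0; rewrite eq0 mL leqnn subnn /=; move: x0; clear; lia.
  apply/eqP; rewrite eqn_leq ax leqNgt; apply/negP => xa.
  have eq0 := rowB x.-1 kx; rewrite prednK // subnn in eq0.
  have i0 : index (p, x.-1) L = 0 by rewrite -eq0 nB.
  have := g2 p x.-1; rewrite prednK // ![mem _ _]/= !mL leqnn subnn /= xa => /(_ isT).
  by rewrite (leq_trans kx ax) /before i0 ltn0 => /(_ isT).
have BE : B = rev [seq (p, j) | j <- iota 0 a].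
  apply: (@eq_from_nth _ (0, 0)) => [|k]; rewrite ?size_rev ?size_map ?size_iota sB' // => kx.
  rewrite nth_rev ?size_map ?size_iota -?ex // (nth_map 0) ?size_iota; last by move: kx; clear;
    lia.
  rewrite nth_iota ?add0n; last by move: kx; clear; lia.
  rewrite -rowB; last by move: kx; clear; lia.
  by congr nth; move: kx; clear; lia.
rewrite ex; congr (_ :: _).
have pL' : perm_eq L' (cells_from p.+1 al).
  rewrite -(perm_cat2l B) -LE (perm_trans pL) // BE perm_cat2r perm_sym perm_rev.
  exact: perm_refl.
apply: (IH L' g p.+1) => //.
- apply: (@good_catr B) => //; rewrite -?LE // => c [i j]; rewrite BE mem_rev => /mapP[k _ ->].
  by rewrite (perm_mem pL') mem_cells_from => /andP[].
- by rewrite size_drop -sg addKn.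
by move: eg; rewrite !wt_cons ex => /addnI.
Qed.

(** A good listing whose decreasing blocks have the sizes [al]; it makes the diagonal coefficient in
    [Rcoef_diag] nonzero. *)
Fixpoint rows p (al : seq nat) : seq cell :=
  if al is a :: al' then rev [seq (p, j) | j <- iota 0 a] ++ rows p.+1 al' else [::].

Lemma rows_perm p al : perm_eq (rows p al) (cells_from p al).
Proof. by elim: al p => //= a al IH p; rewrite perm_cat // perm_rev. Qed.

Lemma block_sorted_rows p al : block_sorted (fun x y => reading_lt y x) al (rows p al).
Proof.
elim: al p => //= a al IH p.
have sz : size (rev [seq (p, j) | j <- iota 0 a]) = a by rewrite size_rev size_map size_iota.
rewrite take_cat drop_cat sz ltnn subnn take0 drop0 cats0 IH andbT rev_sorted sorted_map.
by apply: sub_sorted (iota_ltn_sorted 0 a) => x y xy; apply/orP; left.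
Qed.

Lemma before_rows p al i j i' j' : (i, j) \in rows p al -> (i', j') \in rows p al ->
  (i < i') || ((i == i') && (j' < j)) -> before (rows p al) (i, j) (i', j').
Proof.
elim: al p => //= a al IH p; rewrite /before !index_cat !mem_cat.
have mr k l : ((k, l) \in rev [seq (p, j) | j <- iota 0 a]) = (k == p) && (l < a).
  rewrite mem_rev; apply/mapP/andP => [[m]|[/eqP-> la]]; last by exists l; rewrite ?mem_iota.
  by rewrite mem_iota => /andP[_ ma] [-> ->].
have out k l : (k, l) \in rows p.+1 al -> p < k.
  by rewrite (perm_mem (rows_perm _ _)) mem_cells_from => /andP[].
case: ifP => h1 m1; case: ifP => h2 m2 h.
- move: h h1 h2; rewrite !mr => h /andP[/eqP ei ja] /andP[/eqP ei' ja'].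
  move: h; rewrite ei ei' ltnn eqxx /= => jj.
  rewrite -(nth_index (0,0) (_ : (p,j) \in rev [seq (p, j) | j <- iota 0 a])); last
    by rewrite mr eqxx.
  have ix l : l < a -> index (p, l) (rev [seq (p, j) | j <- iota 0 a]) = a - l.+1.
    move=> la; have -> : (p, l) = nth (0,0) (rev [seq (p, j) | j <- iota 0 a]) (a - l.+1).
      rewrite nth_rev size_map size_iota ?(nth_map 0) ?size_iota ?nth_iota; try (by move: la;
        clear; lia).
      by congr pair; move: la; clear; lia.
    rewrite index_uniq ?size_rev ?size_map ?size_iota //; first by move: la; clear; lia.
    by rewrite rev_uniq map_inj_uniq ?iota_uniq // => x y [].
  by rewrite nth_index ?mr ?eqxx // !ix //; move: jj ja; clear; lia.
- by apply: leq_trans (leq_addr _ _); rewrite index_mem.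
- move: m1; rewrite /= => /out pi; move: h h2; rewrite mr => h /andP[/eqP e _].
  by move: h; rewrite e; move: pi; clear; lia.
- by rewrite ltn_add2l; apply: IH.
Qed.

Lemma good_rows p al : good (rows p al).
Proof.
split=> [i i' ii a a'|i j a a'|i i' j ii a _ a']; apply: before_rows => //.
- by rewrite ii.
- by rewrite eqxx ltnSn orbT.
- by rewrite ii.
Qed.

Local Open Scope ring_scope.

(** These are the coefficients of [RS al], see [RS_xpow]. The sums are compared because
    [block_sorted] ignores cells beyond the last block. *)
Definition Rcoef al (d : seq nat) : rat :=
  if sumn d == sumn al then
    \sum_(L <- permutations (cells_from 0 al) | boolp.asbool (good L)) (block_sorted reading_lt
      d L)%:R
  else 0.

Lemma Phi_Rcoef al g : comp g -> sumn g = sumn al -> Phi (Rcoef al) g = (-1) ^+ sumn al *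
  \sum_(L <- permutations (cells_from 0 al) | boolp.asbool (good L)) (block_sorted (fun x y =>
    reading_lt y x) g L)%:R.
Proof.
move=> cg sg; pose good_listings := [seq L <- permutations (cells_from 0 al) | boolp.asbool
  (good L)].
rewrite (@Phi_ext _ (fun d => \sum_(L <- good_listings) block_indic reading_lt L d)) // =>
  [|d cd sd]; last first.
  by rewrite /Rcoef sd sg eqxx big_filter.
rewrite Phi_sum mulr_sumr -[RHS]big_filter -/good_listings big_seq [RHS]big_seq;
  apply: eq_bigr => L.
rewrite mem_filter mem_permutations => /andP[_ pL].
rewrite (Phi_block_indic reading_lt_total) ?sg ?(perm_size pL) ?size_cells_from //.
by rewrite (perm_uniq pL) uniq_cells_from.
Qed.

Lemma Rcoef_diag al : comp al -> Phi (Rcoef al) al <> 0.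
Proof.
move=> ca; rewrite Phi_Rcoef //; apply/eqP; rewrite mulf_neq0 ?signr_eq0 //.
rewrite -natr_sum pnatr_eq0 -lt0n -big_filter.
rewrite (bigD1_seq (rows 0 al)) ?filter_uniq ?permutations_uniq //=; first
  by rewrite block_sorted_rows.
rewrite mem_filter mem_permutations rows_perm andbT; apply/boolp.asboolP; exact: good_rows.
Qed.

Lemma Rcoef_lowerings al g : comp al -> comp g -> sumn g = sumn al -> Phi (Rcoef al) g <> 0 ->
  (wt g < wt al)%N \/ g = al.
Proof.
move=> ca cg sg; rewrite Phi_Rcoef // => nz.
have : has (fun L => boolp.asbool (good L) && block_sorted (fun x y =>
  reading_lt y x) g L) (permutations (cells_from 0 al)).
  apply/negP => /negP/hasPn h; apply: nz; rewrite big_seq_cond big1 ?mulr0 // => L /andP[Lp gL].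
  by have := h L Lp; rewrite gL /= => /negbTE ->.
move=> /hasP[L]; rewrite mem_permutations => pL /andP[/boolp.asboolP gL bL].
have sL : sumn g = size L by rewrite (perm_size pL) size_cells_from.
have := block_sorted_wt_le pL gL bL sL; rewrite leq_eqVlt => /orP[/eqP e|]; last by left.
by right; apply: block_sorted_wt_eq pL gL bL sL e.
Qed.

(** * Standardization of row-strict composition tableaux *)

Local Open Scope nat_scope.

Definition fill_lt (f : cell -> nat) : rel cell :=
  fun c c' => (f c < f c') || ((f c == f c') && reading_lt c c').

Lemma fill_lt_trans f : transitive (fill_lt f).
Proof.
move=> y x z; rewrite /fill_lt => /orP[h1|/andP[/eqP-> h1]] /orP[h2|/andP[/eqP <- h2]].
- by rewrite (ltn_trans h1 h2).
- by rewrite h1.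
- by rewrite h2.
by rewrite eqxx (reading_lt_trans h1 h2) orbT.
Qed.

Lemma fill_lt_irr f : irreflexive (fill_lt f).
Proof. by move=> x; rewrite /fill_lt ltnn reading_lt_irr andbF. Qed.

Lemma fill_lt_total f x y : x != y -> fill_lt f x y = ~~ fill_lt f y x.
Proof.
by move=> /reading_lt_total; rewrite /fill_lt; case: (ltngtP (f x) (f y)) => //= _ ->.
Qed.

Lemma fill_lt_before f L : sorted (fill_lt f) L ->
  {in L &, forall c c', before L c c' = fill_lt f c c'}.
Proof.
move=> sL c c' cL cL'; have uL : uniq L := sorted_uniq (@fill_lt_trans f) (fill_lt_irr f) sL.
have imp x y : x \in L -> y \in L -> before L x y -> fill_lt f x y.
  move=> xL yL xy; rewrite -(nth_index (0,0) xL) -(nth_index (0,0) yL).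
  by apply: (sorted_ltn_nth (@fill_lt_trans f)); rewrite ?inE ?index_mem.
apply/idP/idP; first exact: imp.
move=> h; case: (c =P c') => [e|/eqP ne]; first by rewrite e fill_lt_irr in h.
have : index c L != index c' L.
  by apply: contraNneq ne => e; rewrite -(nth_index (0,0) cL) e nth_index.
rewrite neq_ltn => /orP[//|] /(imp _ _ cL' cL).
by rewrite fill_lt_total 1?eq_sym // h.
Qed.

Lemma good_rel_ext (A : pred cell) (lt lt' : rel cell) : (forall c c', A c -> A c' ->
  lt c c' = lt' c c') ->
  good_rel A lt -> good_rel A lt'.
Proof.
move=> e [g1 g2 g3]; split=> [i i' ii a a'|i j a a'|i i' j ii a h a'].
- by rewrite -e //; apply: g1.
- by rewrite -e //; apply: g2.
- by rewrite -e //; apply: g3 => // b; rewrite e //; apply: h.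
Qed.

Lemma good_rel_mem (A A' : pred cell) lt : A =1 A' -> good_rel A lt -> good_rel A' lt.
Proof.
move=> e [g1 g2 g3]; split=> [i i' ii|i j|i i' j ii]; rewrite -!e.
- exact: g1.
- exact: g2.
- exact: g3.
Qed.

Definition entry_lt : rel (nat * cell) :=
  fun p q => (p.1 < q.1) || ((p.1 == q.1) && reading_lt p.2 q.2).

Lemma entry_lt_trans : transitive entry_lt.
Proof.
move=> y x z; rewrite /entry_lt => /orP[h1|/andP[/eqP-> h1]] /orP[h2|/andP[/eqP <- h2]].
- by rewrite (ltn_trans h1 h2).
- by rewrite h1.
- by rewrite h2.
by rewrite eqxx (reading_lt_trans h1 h2) orbT.
Qed.

Definition index_word (i d : seq nat) : seq nat := flatten [seq nseq p.2 p.1 | p <- zip i d].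

Lemma index_word_size i d : size i = size d -> size (index_word i d) = sumn d.
Proof. by elim: i d => [|v i IH] [|x d] //= [/IH e];
  rewrite /index_word /= size_cat size_nseq -e. Qed.

Lemma index_word_mem i d x : x \in index_word i d -> x \in i.
Proof.
elim: i d => [|v i IH] [|y d] //=; rewrite /index_word /= mem_cat mem_nseq inE.
by case/orP=> [/andP[_ ->]//|/IH ->]; rewrite orbT.
Qed.

Lemma index_word_sorted i d : sorted ltn i -> sorted leq (index_word i d).
Proof.
elim: i d => [|v i IH] [|y d] //= pv; rewrite /index_word /= sorted_pairwise;
  last exact: leq_trans.
rewrite pairwise_cat -!sorted_pairwise; try exact: leq_trans.
rewrite (IH d (path_sorted pv)) andbT; apply/andP; split.
  apply/allrelP => a b; rewrite mem_nseq => /andP[_ /eqP ->] /index_word_mem bi.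
  by move: pv; rewrite path_sortedE => [/andP[/allP/(_ _ bi)/ltnW]//|]; exact: ltn_trans.
by elim: y => //= -[|y] //= ->; rewrite leqnn.
Qed.

(** Values increase strictly from block to block, so only the ties inside a block are tested. *)
Lemma sorted_entry_lt_block_sorted i d L : sorted ltn i -> size i = size d -> sumn d = size L ->
  sorted entry_lt (zip (index_word i d) L) = block_sorted reading_lt d L.
Proof.
elim: i d L => [|v i IH] [|x d] // L; first by case: L.
move=> /= pv [sd] sL; have {}IH := IH d (drop x L) (path_sorted pv) sd.
have sz : size (take x L) = x by rewrite size_takel // -sL leq_addr.
rewrite /index_word /= -/(index_word i d) -{1}(cat_take_drop x L) zip_cat ?size_nseq ?sz //.
rewrite sorted_pairwise; last exact: entry_lt_trans.
rewrite pairwise_cat -!sorted_pairwise; try exact: entry_lt_trans.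
rewrite IH; last by rewrite size_drop -sL addKn.
have -> : allrel entry_lt (zip (nseq x v) (take x L)) (zip (index_word i d) (drop x L)).
  apply/allrelP => a b above bb.
  have : a.1 \in nseq x v.
    by rewrite -[X in _ \in X](@unzip1_zip _ _ _ (take x L)) ?size_nseq ?sz // map_f.
  have : b.1 \in index_word i d.
    rewrite -[X in _ \in X](@unzip1_zip _ _ _ (drop x L)) ?map_f // size_drop -sL addKn.
    by rewrite index_word_size.
  rewrite mem_nseq => /index_word_mem bi /andP[_ /eqP av].
  by apply/orP; left; rewrite av; apply: (allP (order_path_min ltn_trans pv)).
rewrite /=; congr (_ && _).
have -> : zip (nseq x v) (take x L) = [seq (v, c) | c <- take x L].
  by rewrite -{1}sz; elim: (take x L) => //= c w ->.
by rewrite sorted_map; apply: eq_sorted => c c'; rewrite /entry_lt /= ltnn eqxx.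
Qed.

Definition fill_shape (h : cell -> nat) al : seq (seq nat) :=
  [seq [seq h (k, j) | j <- iota 0 (nth 0 al k)] | k <- iota 0 (size al)].

Lemma fill_shape_shape h al : shape (fill_shape h al) = al.
Proof.
apply: (@eq_from_nth _ 0); rewrite /shape !size_map size_iota // => k kl.
rewrite (nth_map [::]) ?size_map ?size_iota // (nth_map 0) ?size_iota //.
by rewrite size_map size_iota nth_iota.
Qed.

Lemma fill_shape_flatten h al : flatten (fill_shape h al) = [seq h c | c <- cells_from 0 al].
Proof.
have A p : flatten [seq [seq h (k, j) | j <- iota 0 (nth 0 al (k - p))] | k <- iota p (size
  al)] =
  [seq h c | c <- cells_from p al].
  elim: al p => //= a al IH p; rewrite subnn map_cat -map_comp -IH; congr (_ ++ flatten _).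
  apply/eq_in_map => k; rewrite mem_iota => /andP[pk _].
  by have -> : k - p = (k - p.+1).+1 by move: pk; clear; lia.
by rewrite -A; congr flatten; apply: eq_map => k; rewrite subn0.
Qed.

Lemma fill_shape_padded h al k j : padded (fill_shape h al) k j = if j < nth 0 al k then h (k,
  j) else 0.
Proof.
rewrite /padded; case: (ltnP k (size al)) => kl; last first.
  by rewrite (nth_default [::]) ?size_map ?size_iota // nth_nil (nth_default 0).
rewrite (nth_map 0) ?size_iota // nth_iota // add0n; case: ltnP => jl.
  by rewrite (nth_map 0) ?size_iota // nth_iota.
by rewrite nth_default // size_map size_iota.
Qed.

Lemma padded_fill_shape U al : shape U = al -> fill_shape (fun c => padded U c.1 c.2) al = U.
Proof.
move=> <-; apply: (@eq_from_nth _ [::]); rewrite ?size_map ?size_iota ?size_map // => k kl.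
have kl' : k < size (shape U) by rewrite size_map.
rewrite (nth_map 0) ?size_iota // nth_iota // add0n.
apply: (@eq_from_nth _ 0); rewrite ?size_map ?size_iota (nth_map [::]) // => j jl.
by rewrite (nth_map 0) ?size_iota // nth_iota.
Qed.

Lemma fill_shape_ext h h' al : {in cells_from 0 al, h =1 h'} ->
  fill_shape h al = fill_shape h' al.
Proof.
move=> e; apply/eq_in_map => k; rewrite mem_iota => kl; apply/eq_in_map => j;
  rewrite mem_iota => jl.
by apply: e; rewrite mem_cells_from subn0.
Qed.

Lemma padded_gt0 U al k j : shape U = al -> all (all (ltn 0)) U ->
  (0 < padded U k j) = (j < nth 0 al k).
Proof.
move=> <- index_ord; rewrite /padded; case: (ltnP k (size U)) => kl; last first.
  by rewrite (nth_default [::]) // nth_nil nth_default // size_map.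
rewrite (nth_map [::]) //; case: (ltnP j) => jl; last by rewrite nth_default.
by apply: (allP (allP index_ord _ (mem_nth _ kl))); apply: mem_nth.
Qed.

(** Ties are broken as the tableau conditions need it. Reading column 0 downwards allows equal
    entries there; reading columns from left to right makes rows strict and the conclusion of the
    third condition weak; reading later columns upwards makes its premise strict. A missing cell
    [(i, j + 1)] stands for the padding 0. *)
Lemma RCT_good al U : comp al -> shape U = al -> all (all (ltn 0)) U ->
  is_RCT al U <-> good_rel (mem (cells_from 0 al)) (fill_lt (fun c => padded U c.1 c.2)).
Proof.
move=> ca sU index_ord; have p0 k j := padded_gt0 k j sU index_ord.
have sz : size U = size al by rewrite -sU size_map.
have mc k j : mem (cells_from 0 al) (k, j) = (0 < padded U k j).
  by rewrite [LHS]mem_cells_from subn0 p0.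
have m0 k : (0 < nth 0 al k) = (k < size al).
  case: (ltnP k (size al)) => h; last by rewrite nth_default.
  by apply: (allP ca); apply: mem_nth.
split=> [[_ hd rw c3]|[g1 g2 g3]].
  have srow k : sorted gtn (nth [::] U k).
    case: (ltnP k (size U)) => kl; last by rewrite nth_default.
    exact: (allP rw _ (mem_nth _ kl)).
  split=> [i i' ii|i j|i i' j ii]; rewrite !mc /fill_lt /reading_lt /= => a.
  - move=> a'; have i'l : i' < size U by rewrite sz -m0 -p0.
    have := sorted_leq_nth leq_trans leqnn 0 hd; rewrite size_map => /(_ i i').
    rewrite !inE i'l (ltn_trans ii i'l) => /(_ isT isT (ltnW ii)).
    rewrite !(nth_map [::]) ?(ltn_trans ii i'l) // -!nth0 -!/(padded U _ 0).
    by rewrite leq_eqVlt ii andbT orbC.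
  - move=> a'; have := srow i; move/(sortedP 0)/(_ j) => /= h.
    by apply/orP; left; apply: h; rewrite ltnNge; apply/negP => /(nth_default 0) e;
      rewrite /padded e in a.
  - move=> h a'; rewrite ltnSn /= andbT orbC -leq_eqVlt.
    apply: (c3 i i' j.+1) => //; first by rewrite ii /= -m0;
      apply: leq_ltn_trans (_ : j.+1 < _); rewrite -?p0.
    + have := p0 i' j.+1; rewrite a => /esym jl; apply: leq_trans jl _.
      case: (ltnP i' (size al)) => il; last by rewrite nth_default.
      exact: (leq_bigmax_seq (nth 0 al i') (mem_nth _ il)).
    + by move=> e; rewrite e in a.
    case: (posnP (padded U i j.+1)) => [->//|/h]; rewrite ltnn eqxx /= [i' < i]ltnNge (ltnW ii).
    by rewrite andbF orbF.
split=> //.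
- apply/(sortedP 0) => k; rewrite size_map => kl;
  rewrite !(nth_map [::]) // ?(ltnW kl) // -!nth0 -!/(padded U _ 0).
  have := g1 k k.+1 (ltnSn k); rewrite !mc !p0 !m0 -sz kl (ltnW kl) /fill_lt /reading_lt /=
    ltnSn andbT => /(_ isT isT).
  by rewrite orbC -leq_eqVlt.
- apply/allP => r /(nthP [::])[k kl <-]; apply/(sortedP 0) => j jl.
  have := g2 k j; rewrite !mc !p0 -sU (nth_map [::]) // jl (ltnW jl) /fill_lt /reading_lt /= =>
    /(_ isT isT).
  have -> : (j.+1 < j) = false by clear; lia.
  have -> : (j.+1 == j) = false by clear; lia.
  by rewrite andbF orbF.
- move=> i1 i2 [//|j] /andP[ii il] /andP[_ jm] /eqP nz lt.
  have := g3 i1 i2 j ii; rewrite !mc lt0n nz => /(_ isT).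
  case: (posnP (padded U i1 j)) => [->//|] a /(_ _ isT) h.
  have : fill_lt (fun c => padded U c.1 c.2) (i1, j) (i2, j.+1) by apply: h;
    rewrite /fill_lt /= lt.
  by rewrite /fill_lt /= => /orP[/ltnW//|/andP[/eqP->]].
Qed.

Lemma gen_series_count (T : choiceType) (A : set T) (w : T -> monomial) m (s : seq T) :
  uniq s -> (forall u, (A u /\ w u = m) <-> u \in s) -> gen_series A w m = ((size s)%:R)%R.
Proof.
move=> us e; rewrite /gen_series.
rewrite (_ : [set u | A u /\ w u = m]%classic = [set` s]%classic); last first.
  by apply/funext => u; apply/propext; exact: e.
by rewrite -fsbig_seq // big_const_seq count_predT iter_addr_0.
Qed.

Definition entry (vs : seq nat) (L : seq cell) (c : cell) : nat := nth 0 vs (index c L).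

Lemma map_entry vs L : uniq L -> size vs = size L -> [seq entry vs L c | c <- L] = vs.
Proof.
move=> uL e; apply: (@eq_from_nth _ 0) => [|k]; rewrite size_map ?e // => kl.
by rewrite (nth_map (0,0)) // /entry index_uniq.
Qed.

Lemma sorted_entry vs L : uniq L -> size vs = size L ->
  sorted entry_lt (zip vs L) = sorted (fill_lt (entry vs L)) L.
Proof.
move=> uL e; have -> : zip vs L = [seq (entry vs L c, c) | c <- L].
  transitivity (zip [seq entry vs L c | c <- L] [seq id c | c <- L]); first
    by rewrite map_entry // map_id.
  by elim: (L) (entry vs L) => //= c w IH f; rewrite IH.
by rewrite sorted_map; apply: eq_sorted.
Qed.

(** The successor undoes the shift of indices in [content] and keeps the entries positive. *)
Definition fill_listing vs al L := fill_shape (fun c => (entry vs L c).+1) al.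

Lemma sort_fill_lt f (cs : seq cell) : uniq cs ->
  exists L, [/\ perm_eq L cs, sorted (fill_lt f) L & sorted leq [seq f c | c <- L]].
Proof.
move=> ucs; pose r c c' := (c == c') || fill_lt f c c'.
have tot : total r.
  move=> c c'; rewrite /r; case: (eqVneq c c') => //= ne.
  by rewrite (fill_lt_total f ne); case: (fill_lt f c' c); rewrite ?orbT.
have rtr : transitive r.
  move=> y x z /orP[/eqP->//|h1] /orP[/eqP <-|h2]; rewrite /r ?h1 ?orbT //.
  by rewrite (fill_lt_trans h1 h2) orbT.
have pL : perm_eq (sort r cs) cs by rewrite perm_sort.
have uL : uniq (sort r cs) by rewrite (perm_uniq pL).
have sL : sorted (fill_lt f) (sort r cs).
  rewrite sorted_pairwise; last exact: fill_lt_trans.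
  have := sort_sorted tot cs; rewrite sorted_pairwise // => p1.
  have : pairwise [rel x y | r x y && (x != y)] (sort r cs).
    by rewrite pairwise_relI p1 -uniq_pairwise uL.
  by apply: sub_pairwise => x y /= /andP[/orP[/eqP->|//]]; rewrite eqxx.
exists (sort r cs); split=> //; rewrite sorted_map; apply: sub_sorted sL => x y.
by move=> /orP[/ltnW//|/andP[/eqP xy _]]; rewrite /= xy.
Qed.

Lemma fill_lt_ext (f f' : cell -> nat) c c' : f c = f' c -> f c' = f' c' ->
  fill_lt f c c' = fill_lt f' c c'.
Proof. by rewrite /fill_lt => -> ->. Qed.

Lemma fill_ltS f c c' : fill_lt (fun c => (f c).+1) c c' = fill_lt f c c'.
Proof. by []. Qed.

Lemma sorted_fill_lt_eq f L L' (cs : seq cell) : perm_eq L cs -> perm_eq L' cs ->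
  sorted (fill_lt f) L -> sorted (fill_lt f) L' -> L = L'.
Proof.
move=> pL pL' sL sL'; apply: (irr_sorted_eq (@fill_lt_trans f) (@fill_lt_irr f)) => // c.
by rewrite (perm_mem pL) (perm_mem pL').
Qed.

Section Count.
Variables al i d : seq nat.
Hypothesis ca : comp al.
Hypothesis si : sorted ltn i.
Hypothesis sid : size i = size d.
Local Notation vs := (index_word i d).
Local Notation cs := (cells_from 0 al).

Lemma RS_content_size U : is_RCT al U -> content U = xpow i d -> sumn d = sumn al.
Proof.
move=> [[sU _] _ _ _] e; rewrite -(index_word_size sid) -sU -size_flatten.
by have /eq_seq_msetP/perm_size := e; rewrite size_map => ->.
Qed.

Hypothesis sd : sumn d = sumn al.

Definition good_listings := [seq L <- permutations cs | asbool (good L) && block_sorted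
  reading_lt d L].

Lemma mem_good_listings L : L \in good_listings <-> [/\ perm_eq L cs, good L & sorted (fill_lt
  (entry vs L)) L].
Proof.
rewrite mem_filter mem_permutations; split=> [/andP[/andP[/asboolP gL bL] pL]|[pL gL sL]].
  split=> //; rewrite -sorted_entry ?(perm_uniq pL) ?uniq_cells_from //.
    by rewrite sorted_entry_lt_block_sorted // (perm_size pL) size_cells_from.
  by rewrite index_word_size // (perm_size pL) size_cells_from.
rewrite pL andbT (asboolT gL) /= -(sorted_entry_lt_block_sorted si sid) ?(perm_size pL)
  ?size_cells_from //.
rewrite sorted_entry ?(perm_uniq pL) ?uniq_cells_from //.
by rewrite index_word_size // (perm_size pL) size_cells_from.
Qed.

Lemma fill_listing_entry L c : c \in cs ->
  padded (fill_listing vs al L) c.1 c.2 = (entry vs L c).+1.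
Proof.
by case: c => k j; rewrite mem_cells_from subn0 => /= jl; rewrite fill_shape_padded jl.
Qed.

Lemma fill_listing_inj : {in good_listings &, injective (fill_listing vs al)}.
Proof.
move=> L L' /mem_good_listings[pL _ sL] /mem_good_listings[pL' _ sL'] e.
have E c : c \in cs -> entry vs L c = entry vs L' c.
  by move=> cc; apply: succn_inj; rewrite -!fill_listing_entry // e.
apply: (@sorted_fill_lt_eq (entry vs L) L L' cs) => //.
apply: (sub_in_sorted (P := mem cs) _ _ sL').
  by move=> c c' /= cc cc'; rewrite (fill_lt_ext (E c cc) (E c' cc')).
by apply/allP => c; rewrite (perm_mem pL').
Qed.

(** Standardization and its inverse: sorting the cells of a tableau by [fill_lt] gives the listing,
    and writing the sorted word [vs] along a listing gives back the tableau. *)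
Lemma RCT_good_listings U : (is_RCT al U /\ content U = xpow i d) <-> U \in [seq fill_listing
  vs al L | L <- good_listings].
Proof.
split=> [[RU cU]|/mapP[L /mem_good_listings[pL gL sL] ->]].
  have [[sU index_ord] _ _ _] := RU.
  pose f c := (padded U c.1 c.2).-1.
  have fS c : c \in cs -> padded U c.1 c.2 = (f c).+1.
    by case: c => k j; rewrite mem_cells_from subn0 => jl;
      rewrite /f prednK // (padded_gt0 _ _ sU index_ord).
  have [L [pL sL sf]] := sort_fill_lt f (uniq_cells_from 0 al).
  have fL : [seq f c | c <- L] = vs.
    apply: (sorted_eq leq_trans anti_leq) => //; first exact: index_word_sorted.
    rewrite (perm_trans (perm_map _ pL)) //.
    have /eq_seq_msetP pU := cU.
    suff <- : [seq e.-1 | e <- flatten U] = [seq f c | c <- cs] by exact: pU.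
    by rewrite -{1}(padded_fill_shape sU) fill_shape_flatten -map_comp.
  have E c : c \in cs -> entry vs L c = f c.
    rewrite -(perm_mem pL) => cL; rewrite /entry -fL (nth_map (0,0)) ?index_mem //.
    by rewrite nth_index.
  have sE : sorted (fill_lt (entry vs L)) L.
    apply: (sub_in_sorted (P := mem cs) _ _ sL); last by apply/allP => c; rewrite (perm_mem pL).
    by move=> c c' /= cc cc'; rewrite (fill_lt_ext (E c cc) (E c' cc')).
  apply/mapP; exists L; last first.
    rewrite -{1}(padded_fill_shape sU); apply: fill_shape_ext => c cc; by rewrite fS // E.
  apply/mem_good_listings; split=> //.
  have g := (RCT_good ca sU index_ord).1 RU.
  apply: good_rel_mem (_ : mem cs =1 mem L) _ => [c|]; first by rewrite /= (perm_mem pL).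
  apply: good_rel_ext g => c c' cc cc'; rewrite (fill_lt_before sE) ?(perm_mem pL) //.
  by rewrite -[RHS]fill_ltS; apply: fill_lt_ext; rewrite fS // E.
have sU : shape (fill_listing vs al L) = al by exact: fill_shape_shape.
have index_ord : all (all (ltn 0)) (fill_listing vs al L).
  by apply/allP => r /mapP[k _ ->]; apply/allP => x /mapP[j _ ->].
have uL : uniq L by rewrite (perm_uniq pL) uniq_cells_from.
split.
  apply/(RCT_good ca sU index_ord).
  apply: good_rel_mem (_ : mem L =1 mem cs) _ => [c|]; first by rewrite /= (perm_mem pL).
  apply: good_rel_ext gL => c c' cL cL'; rewrite (fill_lt_before sL) // -fill_ltS.
  by apply: fill_lt_ext; rewrite fill_listing_entry // -(perm_mem pL).
apply/eq_seq_msetP; rewrite fill_shape_flatten -map_comp -/(index_word i d).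
rewrite -[X in perm_eq _ X](map_entry uL); last
  by rewrite index_word_size // (perm_size pL) size_cells_from.
by rewrite perm_sym; exact: (perm_map (entry vs L) pL).
Qed.

Lemma RS_count : RS al (xpow i d) = Rcoef al d.
Proof.
rewrite /RS (@gen_series_count _ _ _ _ [seq fill_listing vs al L | L <- good_listings]);
  last exact: RCT_good_listings.
  rewrite size_map size_filter /Rcoef sd eqxx -sum1_count natr_sum.
  rewrite big_mkcondr; apply: eq_bigr => L _; by case: (block_sorted _ _ _).
by rewrite map_inj_in_uniq ?filter_uniq ?permutations_uniq //; exact: fill_listing_inj.
Qed.

End Count.

Theorem RS_xpow al i d : comp al -> sorted ltn i -> size i = size d ->
  RS al (xpow i d) = Rcoef al d.
Proof.
move=> ca si sid; case: (sumn d =P sumn al) => sd; first exact: RS_count.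
rewrite /RS (@gen_series_count _ _ _ _ [::]) // => [|U].
  by rewrite /Rcoef; case: eqP.
by split=> // -[RU cU]; case: sd; apply: RS_content_size sid _ RU cU.
Qed.

(** * Pairs of a partition and a pure inverting composition *)

(* Positions are ordered by decreasing value, the rightmost first among equals. *)
Definition above (w : seq nat) p q :=
  (nth 0 w q < nth 0 w p) || ((nth 0 w q == nth 0 w p) && (q < p)).

Lemma above_irr w p : above w p p = false. Proof. by rewrite /above !ltnn andbF. Qed.

Lemma above_trans w p q r : above w p q -> above w q r -> above w p r.
Proof. by rewrite /above; clear; lia. Qed.

Lemma above_total w p q : p != q -> above w p q = ~~ above w q p.
Proof. by rewrite /above; clear; lia. Qed.

Definition rank w p := count (fun q => above w q p) (iota 0 (size w)).

Lemma rank_lt w p : p < size w -> rank w p < size w.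
Proof.
move=> pw; rewrite /rank -[X in _ < X](size_iota 0) -(count_predC (fun q =>
  above w q p) (iota 0 (size w))).
rewrite -[X in X < _]addn0 ltn_add2l -has_count; apply/hasP; exists p; first
  by rewrite mem_iota.
by rewrite /= above_irr.
Qed.

Lemma rank_above w p q : p < size w -> above w p q -> rank w p < rank w q.
Proof.
move=> pw pq; rewrite /rank.
have e : count (fun r => above w r q) (iota 0 (size w)) =
  count (fun r => above w r p) (iota 0 (size w)) +
  count (fun r => above w r q && ~~ above w r p) (iota 0 (size w)).
  elim: (iota _ _) => //= r s ->; case h: (above w r p); last by clear; lia.
  by rewrite (above_trans h pq); clear; lia.
rewrite e -[X in X < _]addn0 ltn_add2l -has_count; apply/hasP; exists p; first
  by rewrite mem_iota.
by rewrite /= pq above_irr.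
Qed.

Lemma rank_inj w : {in iota 0 (size w) &, injective (rank w)}.
Proof.
move=> p q; rewrite !mem_iota => /= pw qw e; apply/eqP/negPn/negP => ne.
case h: (above w p q); first by have := rank_above pw h; rewrite e ltnn.
by move: h; rewrite above_total // => /negbFE /(rank_above qw); rewrite e ltnn.
Qed.

Lemma rank_perm w : perm_eq [seq rank w p | p <- iota 0 (size w)] (iota 0 (size w)).
Proof.
have u : uniq [seq rank w p | p <- iota 0 (size w)].
  by rewrite map_inj_in_uniq ?iota_uniq //; exact: rank_inj.
apply: uniq_perm; rewrite ?iota_uniq //.
have [||//] := uniq_min_size u (s2 := iota 0 (size w)); last by rewrite size_map.
by move=> r /mapP[p]; rewrite !mem_iota /= => pw ->; apply: rank_lt.
Qed.

Definition col_count (mu : seq nat) r := count (fun h => r < h) mu.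

(* Each h in mu adds one to the h highest positions. *)
Definition addcols (i mu : seq nat) : seq nat :=
  [seq nth 0 i p + col_count mu (rank i p) | p <- iota 0 (size i)].

Lemma size_addcols i mu : size (addcols i mu) = size i.
Proof. by rewrite size_map size_iota. Qed.

Lemma nth_addcols i mu p : p < size i ->
  nth 0 (addcols i mu) p = nth 0 i p + col_count mu (rank i p).
Proof. by move=> pi; rewrite (nth_map 0) ?size_iota // nth_iota. Qed.

Lemma sumn_map_add (T : Type) (f g : T -> nat) s :
  sumn [seq f x + g x | x <- s] = sumn [seq f x | x <- s] + sumn [seq g x | x <- s].
Proof. by elim: s => //= x s ->; clear; lia. Qed.

Lemma sum_col_count n mu : all (fun h => h <= n) mu ->
  sumn [seq col_count mu r | r <- iota 0 n] = sumn mu.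
Proof.
elim: mu => [|h mu IH] /=; first by elim: (iota 0 n).
move=> /andP[hn /IH <-]; rewrite /col_count /= sumn_map_add; congr (_ + _).
rewrite -(subnKC hn) iotaD map_cat sumn_cat add0n.
have -> : sumn [seq (r < h : nat) | r <- iota 0 h] = h.
  rewrite -[RHS](size_iota 0) -sum1_size sumnE big_map big_seq [RHS]big_seq.
  by apply: eq_bigr => r; rewrite mem_iota => /= ->.
rewrite sumnE big_map big_seq big1 ?addn0 // => r; rewrite mem_iota => /andP[hr _].
by rewrite ltnNge hr.
Qed.

Lemma sumn_addcols i mu : all (fun h => h <= size i) mu ->
  sumn (addcols i mu) = sumn i + sumn mu.
Proof.
move=> hm; rewrite /addcols sumn_map_add; congr (_ + _).
  by congr sumn; apply: (@eq_from_nth _ 0); rewrite ?size_map ?size_iota // => p pi;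
   rewrite (nth_map 0) ?size_iota // nth_iota.
by rewrite -(sum_col_count hm) (map_comp (col_count mu) (rank i)); apply: perm_sumn;
  apply: perm_map; exact: rank_perm.
Qed.

Lemma col_count_mono mu r r' : r <= r' -> col_count mu r' <= col_count mu r.
Proof. by move=> le; apply: sub_count => h /=; apply: leq_ltn_trans. Qed.

Lemma above_addcols i mu p q : p < size i -> q < size i ->
  above (addcols i mu) p q = above i p q.
Proof.
have A p' q' : p' < size i -> q' < size i -> above i p' q' -> above (addcols i mu) p' q'.
  move=> pi qi h; have := col_count_mono mu (ltnW (rank_above pi h)).
  by rewrite /above !nth_addcols //; move: h; rewrite /above; clear; lia.
move=> pi qi; case: (eqVneq p q) => [->|pq]; first by rewrite !above_irr.
case h: (above i p q); first exact: A.
apply/negbTE; move: h; rewrite above_total // => /negbFE /(A _ _ qi pi).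
by rewrite [above _ p q]above_total // => ->.
Qed.

Definition inverting_word (w : seq nat) := forall i, 1 < i <= \max_(p <- w) p -> has_inv i w.

(** The alternative [i.-1 = i] is the degenerate case [i = 0], in which a letter is its own
    partner. *)
Lemma has_invP i w : i \in w -> has_inv i w ->
  exists s t, [/\ s < t < size w, nth 0 w s = i & nth 0 w t = i.-1] \/ i.-1 = i.
Proof.
move=> iw /(nthP 0)[t]; rewrite size_drop => tl; rewrite nth_drop => e.
exists (index i w), (index i w + t); case: t tl e => [|t] tl e.
  by right; rewrite -e addn0 nth_index.
by left; split; rewrite ?nth_index //; move: tl; clear; lia.
Qed.

Lemma inverting_pair w p : inverting_word w -> p < size w -> 1 < nth 0 w p ->
  exists s t, [/\ s < t < size w, nth 0 w s = nth 0 w p & nth 0 w t = (nth 0 w p).-1].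
Proof.
move=> iw pw gt.
have [||s [t [//|e]]] := @has_invP (nth 0 w p) w; first exact: mem_nth.
- by apply: iw; rewrite gt (leq_bigmax_seq (nth 0 w p)) // mem_nth.
- by exists s, t.
by exists 0, 0; move: e gt; clear; lia.
Qed.

(* An inverting composition is the smallest one inducing its order on positions. *)
Lemma inverting_le w w' : size w = size w' -> comp w' -> inverting_word w ->
  (forall p q, p < size w -> q < size w -> above w p q = above w' p q) ->
  forall p, p < size w -> nth 0 w p <= nth 0 w' p.
Proof.
move=> sz cw' iw abE p; move e: (nth 0 w p) => v.
elim/ltn_ind: v p e => v IHv p; elim/ltn_ind: p => p IHp e pw.
have p1 : 0 < nth 0 w' p by apply: (allP cw'); rewrite mem_nth // -sz.
case: (ltnP 1 v) => [v1|]; last by move: p1; clear; lia.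
have [|s [t [/andP[st tw] es et]]] := @inverting_pair w p iw pw; first by rewrite e.
have sw := ltn_trans st tw.
rewrite e in es et.
have abpt : above w' p t by rewrite -abE // /above e et; move: v1; clear; lia.
(* If [s < p], then [p] is above [s], which has the same value [v]. Otherwise [t] lies to the right
   of [p] and has value [v - 1]; there, being above [t] forces a strictly larger value in [w']. *)
case: (ltnP s p) => sp.
  have := IHp s sp es sw.
  have : above w' p s by rewrite -abE // /above e es eqxx sp orbT.
  by rewrite /above; clear; lia.
have vt : v.-1 < v by move: v1; clear; lia.
have := IHv v.-1 vt t et tw; move: abpt st sp v1; rewrite /above; clear; lia.
Qed.

Lemma inverting_above_inj w w' : size w = size w' -> comp w -> comp w' ->
  inverting_word w -> inverting_word w' ->
  (forall p q, p < size w -> q < size w -> above w p q = above w' p q) -> w = w'.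
Proof.
move=> sz cw cw' iw iw' abE; apply: (@eq_from_nth _ 0) => // p pw; apply/eqP.
rewrite eqn_leq inverting_le //= inverting_le -?sz // => q r qw rw; by rewrite abE.
Qed.

(** The multiplicities of the parts are the differences of successive values of [col_count]. *)
Lemma col_count_inj n mu mu' : sorted geq mu -> sorted geq mu' ->
  all (fun h => 0 < h <= n) mu -> all (fun h => 0 < h <= n) mu' ->
  (forall r, r < n -> col_count mu r = col_count mu' r) -> mu = mu'.
Proof.
move=> s s' b b' e; apply: (sorted_eq (leT := geq)) => //.
- by move=> x y z h1 h2; apply: leq_trans h2 h1.
- by move=> x y h; apply/eqP; rewrite eqn_leq andbC.
have E r : col_count mu r = col_count mu' r.
  case: (ltnP r n) => [/e//|nr].
  have Z nu : all (fun h => 0 < h <= n) nu -> col_count nu r = 0.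
    move=> al; apply/eqP; rewrite -leqn0 leqNgt -has_count; apply/hasPn =>
      h /(allP al) /andP[_ hn].
    by rewrite -leqNgt (leq_trans hn nr).
  by rewrite !Z.
have C nu h : 0 < h -> col_count nu h.-1 = count_mem h nu + col_count nu h.
  by move=> h0; rewrite /col_count; elim: nu => //= x nu ->; move: h0; clear; lia.
apply/allP => h _ /=; apply/eqP; case: (posnP h) => [->|h0].
  have Z nu : all (fun h => 0 < h <= n) nu -> count_mem 0 nu = 0.
    by move=> al; apply/count_memPn/negP => /(allP al).
  by rewrite !Z.
have := C mu h h0; rewrite E (C mu' h h0) E => /addIn ->; reflexivity.
Qed.

(** Adding columns preserves the order of the positions, and this order determines the inverting
    composition. The increments, taken by rank, then give the columns. *)
Lemma addcols_inj i i' mu mu' : comp i -> comp i' -> inverting_word i -> inverting_word i' ->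
  sorted geq mu -> sorted geq mu' ->
  all (fun h => 0 < h <= size i) mu -> all (fun h => 0 < h <= size i') mu' ->
  addcols i mu = addcols i' mu' -> i = i' /\ mu = mu'.
Proof.
move=> ci ci' vi vi' s s' b b' e.
have sz : size i = size i' by rewrite -(size_addcols i mu) e size_addcols.
have ei : i = i'.
  apply: inverting_above_inj => // p q pi qi.
  by rewrite -(above_addcols mu pi qi) e above_addcols // -sz.
split=> //; rewrite -{}ei in e b'; apply: (col_count_inj s s' b b') => r ri.
have : r \in [seq rank i p | p <- iota 0 (size i)] by rewrite (perm_mem (rank_perm i)) mem_iota.
move=> /mapP[p]; rewrite mem_iota /= => pi ->.
by have := congr1 (fun w => nth 0 w p) e; rewrite /= !nth_addcols // => /addnI.
Qed.

(** * Columns longer than b and the encoding of pairs *)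

Definition shift_ones (b : seq nat) e := [seq x.+1 | x <- b] ++ nseq e 1.

Lemma count1_shift_ones b e : 0 \notin b -> count_mem 1 (shift_ones b e) = e.
Proof.
move=> b0; rewrite count_cat count_nseq mul1n count_map.
by rewrite (_ : count _ b = 0) //; apply/count_memPn.
Qed.

Lemma trail_shift_ones b e : 0 \notin b -> trail (shift_ones b e).
Proof.
move=> b0; rewrite /trail count1_shift_ones // size_cat size_nseq size_map addnK take_size_cat
  ?size_map //.
by apply: contra b0 => /mapP[[|x] xb].
Qed.

Lemma strip1_shift_ones b e : 0 \notin b -> strip1 (shift_ones b e) = [seq x.+1 | x <- b].
Proof.
move=> b0; rewrite /strip1 filter_cat filter_nseq cats0; apply/all_filterP/allP =>
  x /mapP[y yb ->].
by case: y yb => // yb; rewrite yb in b0.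
Qed.

Lemma gt2_shift_ones b e : 0 \notin b -> gt2 (shift_ones b e) = [seq x.+1 | x <- strip1 b].
Proof.
move=> b0; rewrite /gt2 filter_cat filter_nseq cats0 filter_map; congr map.
by apply: eq_in_filter => -[|[|x]] xb //; rewrite xb in b0.
Qed.

(** The staircase of [shift_ones b e] is one step longer than that of [b], so the parities differ.
    The induction removes two steps from both. *)
Lemma pure_excl n n' b e : 0 < e -> 0 \notin b -> pureb n b -> ~ pureb n' (shift_ones b e).
Proof.
elim: n' n b e => [|n' IH] n b e e0 b0.
  by rewrite /= mem_cat mem_nseq e0 eqxx orbT.
rewrite [pureb n'.+1 _]/= trail_shift_ones // mem_cat mem_nseq e0 eqxx orbT /= => pn.
move=> /and3P[h2 /eqP eq pn'].
have tb : trail b.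
  apply/trailP; have := congr1 (fun w => [seq x.-1 | x <- take (size b) w]) eq.
  rewrite {1}/shift_ones take_size_cat ?size_map // -map_comp (eq_map (g := id)) // map_id.
  rewrite gt2_shift_ones // count1_shift_ones // catA.
  have c2 : count_mem 2 (shift_ones b e) = count_mem 1 b.
    by rewrite count_cat count_nseq addn0 count_map; apply: eq_count => x /=; rewrite eqSS.
  rewrite c2 take_size_cat.
    by rewrite map_cat -map_comp map_nseq (eq_map (g := id)) // map_id.
  by rewrite size_cat size_map size_nseq size_strip1 subnK // count_size.
have b1 : 1 \in b.
  move: h2; rewrite mem_cat mem_nseq andbF orbF => /mapP[x xb [e1]]; by rewrite e1.
case: n pn => [|n] /=; first by rewrite b1.
rewrite tb b1 /= => /and3P[b2 /eqP eb pn].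
apply: (IH n (lower b) (count_mem 2 b)) => //.
- by rewrite -has_count has_pred1.
- by apply/mapP => -[x]; rewrite mem_filter => /andP[x2 _]; move: x2; clear; lia.
have -> : shift_ones (lower b) (count_mem 2 b) = lower (shift_ones b e) => //.
rewrite /lower gt2_shift_ones //; have -> : strip1 b = gt2 b ++ nseq (count_mem 2 b) 2.
  have := congr1 strip1 eb; rewrite /strip1 !filter_cat !filter_nseq /= cats0 => ->;
    rewrite mul1n; congr (_ ++ _).
  by rewrite -filter_predI; apply: eq_filter => -[|[|[|x]]].
rewrite !map_cat !map_nseq /shift_ones -!map_comp; congr (_ ++ _).
by apply/eq_in_map => x; rewrite mem_filter => /andP[x2 _] /=; move: x2; clear; lia.
Qed.

Lemma has_inv_in i w : has_inv i w -> i \in w.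
Proof.
by move=> h; rewrite -index_mem ltnNge; apply/negP => le; move: h;
  rewrite /has_inv drop_oversize.
Qed.

Lemma drop_shift_ones k b e : k \in b ->
  drop (index k.+1 (shift_ones b e)) (shift_ones b e) = shift_ones (drop (index k b) b) e.
Proof.
move=> kb; have kb' : k.+1 \in [seq x.+1 | x <- b] by rewrite mem_map // => x y [].
rewrite /shift_ones index_cat kb' index_map; last by move=> x y [].
by rewrite drop_cat size_map index_mem kb map_drop.
Qed.

Lemma inverting_word_mem1 b : inverting_word b -> comp b -> b != [::] -> 1 \in b.
Proof.
move=> ib cb b0; case: (ltnP 1 (\max_(p <- b) p)) => m1.
  by apply: (@has_inv_mem 2); apply: ib; rewrite m1.
case: b cb b0 m1 {ib} => //= x b /andP[x0 _] _; rewrite big_cons geq_max inE => /andP[x1 _].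
by have -> : x = 1 by move: x0 x1; clear; lia.
Qed.

Lemma inverting_shift_ones b e : 0 < e -> comp b -> inverting_word b ->
  inverting_word (shift_ones b e).
Proof.
move=> e0 cb ib i /andP[i1]; case: i i1 => // i i1.
move=> im; have : has (leq i.+1) (shift_ones b e) by apply: has_leq_max im.
move=> /hasP[y]; rewrite mem_cat mem_nseq => /orP[/mapP[x xb ->]|/andP[_ /eqP->]]; last first.
  by move: i1; clear; lia.
rewrite ltnS => ix.
have b0 : b != [::] by case: (b) xb.
have ib' : i \in b.
  case: (ltnP 1 i) => [i2|]; last first.
    move=> i2; have -> : i = 1 by move: i1 i2; clear; lia.
    exact: inverting_word_mem1.
  by apply/has_inv_in/ib; rewrite i2 (leq_trans ix) // (leq_bigmax_seq x).
rewrite /has_inv drop_shift_ones // mem_cat mem_nseq; case: (ltnP 1 i) => i2; last first.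
  have -> : i = 1 by move: i1 i2; clear; lia.
  by rewrite eqxx e0 orbT.
apply/orP; left; apply/mapP; exists i.-1; last by move: i2; clear; lia.
by apply: ib; rewrite i2 (leq_trans ix) // (leq_bigmax_seq x).
Qed.

(** Adding a column of height [h > size b] to [b] padded with zeros gives
    [shift_ones b (h - size b)], which has size [h], so that the remaining columns fit. *)
Definition encode (p : seq nat * seq nat) : seq nat :=
  if head 0 p.1 <= size p.2 then addcols p.2 p.1
  else addcols (shift_ones p.2 (head 0 p.1 - size p.2)) (behead p.1).

Definition compsle d := flatten [seq comps j | j <- iota 0 d.+1].

Definition pi_pairs d := [seq p <- [seq (l, b) | l <- compsle d, b <- compsle d] |
  [&& sorted geq p.1, boolp.asbool (pure_inv_word p.2) & sumn p.1 + sumn p.2 == d]].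

Lemma mem_compsle d w : (w \in compsle d) = comp w && (sumn w <= d).
Proof.
apply/flattenP/andP => [[s /mapP[j]]|[cw sw]].
  by rewrite mem_iota => jd ->; rewrite mem_comps => /andP[-> /eqP ->].
exists (comps (sumn w)); last by rewrite mem_comps cw eqxx.
by apply: (map_f comps); rewrite mem_iota.
Qed.

Lemma uniq_compsle d : uniq (compsle d).
Proof.
rewrite /compsle; elim: (iota 0 d.+1) (iota_uniq 0 d.+1) => //= j s IH /andP[js us].
rewrite cat_uniq uniq_comps IH // andbT; apply/hasPn => w /flattenP[t /mapP[k ks ->]].
rewrite !mem_comps => /andP[_ /eqP e]; apply/negP => /andP[_ /eqP e'].
by move: js; rewrite -e' e ks.
Qed.

Lemma mem_pi_pairs d l b : reflect [/\ comp l /\ comp b, sorted geq l, pure_inv_word b & sumn l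
  + sumn b = d]
  ((l, b) \in pi_pairs d).
Proof.
rewrite mem_filter; apply: (iffP andP) => [[/and3P[s /boolp.asboolP p /eqP e]]|[[cl cb] s p e]].
  move=> /allpairsP[[l' b'] /= [ml mb [el eb]]]; move: ml mb; rewrite -el -eb !mem_compsle.
  by move=> /andP[cl _] /andP[cb _].
split; first by rewrite /= s boolp.asboolT //= e eqxx.
by apply/allpairsP; exists (l, b); rewrite /= !mem_compsle cl cb -e leq_addr leq_addl.
Qed.

Lemma uniq_pi_pairs d : uniq (pi_pairs d).
Proof. by apply: filter_uniq; apply: allpairs_uniq; rewrite ?uniq_compsle // =>
  -[a b] [a' b']. Qed.

Lemma comp_shift_ones b e : comp (shift_ones b e).
Proof. by rewrite all_cat all_nseq orbT andbT; apply/allP => x /mapP[y _ ->]. Qed.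

Lemma comp_addcols i mu : comp i -> comp (addcols i mu).
Proof.
move=> ci; apply/allP => x /mapP[p]; rewrite mem_iota => /= pi ->.
by apply: leq_trans (leq_addr _ _); apply: (allP ci); apply: mem_nth.
Qed.

Lemma head_max l h : sorted geq l -> h \in l -> h <= head 0 l.
Proof.
case: l => [|x l] //=; rewrite path_sortedE; last by move=> a b c h1 h2; apply: leq_trans h2 h1.
by move=> /andP[/allP xl _]; rewrite inE => /orP[/eqP->//|/xl].
Qed.

Lemma sumn_shift_ones b e : sumn (shift_ones b e) = sumn b + size b + e.
Proof.
rewrite /shift_ones sumn_cat sumn_nseq mul1n; congr (_ + _).
by elim: b => //= x b ->; clear; lia.
Qed.

Lemma size_shift_ones b e : size (shift_ones b e) = size b + e.
Proof. by rewrite size_cat size_map size_nseq. Qed.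

(* The inverting composition i is pure exactly in the first case. *)
Lemma encodeE d l b : (l, b) \in pi_pairs d -> exists i mu,
  [/\ encode (l, b) = addcols i mu, [/\ comp i, inverting_word i, sorted geq mu &
      all (fun h => 0 < h <= size i) mu], sumn i + sumn mu = d &
      (i = b /\ mu = l) \/
      [/\ exists2 e, 0 < e & i = shift_ones b e, l = size i :: mu & b = [seq x.-1 | x <- strip1
        i]]].
Proof.
move=> /mem_pi_pairs [[cl cb] sl [ib pb] e].
have lp h : h \in l -> 0 < h by move/(allP cl).
rewrite /encode /=; case: leqP => hl.
  exists b, l; split; [by []| |by rewrite addnC|by left].
  split=> //; apply/allP => h hin; rewrite lp //=; apply: leq_trans hl; exact: head_max.
case: l cl sl e lp hl => [|n mu] cl sl e lp hl; first by [].
have /andP[n0 cm] : comp (n :: mu) := cl.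
have {}hl : size b < n by [].
have en : 0 < n - size b by rewrite subn_gt0.
have sz : size (shift_ones b (n - size b)) = n by rewrite size_shift_ones subnKC // ltnW.
exists (shift_ones b (n - size b)), mu; split=> //.
- split; [exact: comp_shift_ones|exact: inverting_shift_ones|exact: path_sorted sl|].
  apply/allP => h hin; rewrite lp ?inE ?hin ?orbT //= sz.
  by apply: (@head_max (n :: mu)); rewrite ?inE ?hin ?orbT.
- by rewrite sumn_shift_ones -[sumn b + _ + _]addnA subnKC ?(ltnW hl) // -addnA addnC.
right; split; first by exists (n - size b).
- by rewrite sz.
rewrite strip1_shift_ones ?(negbT) // -?map_comp ?(eq_map (g := id)) ?map_id //.
by apply/negP => /(allP cb).
Qed.

Lemma encode_comps d p : p \in pi_pairs d -> encode p \in comps d.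
Proof.
case: p => l b /encodeE [i [mu [-> [ci ii sm hm] e _]]].
rewrite mem_comps comp_addcols //= sumn_addcols ?e //.
by apply/allP => h /(allP hm) /andP[].
Qed.

Lemma encode_inj d : {in pi_pairs d &, injective encode}.
Proof.
move=> [l b] [l' b'] P P'.
have [i [mu [-> [ci ii sm hm] _ H]]] := encodeE P.
have [i' [mu' [-> [ci' ii' sm' hm'] _ H']]] := encodeE P'.
move=> /addcols_inj [] // ei em; subst i' mu'.
have /mem_pi_pairs [[_ cb] _ [_ pb] _] := P; have /mem_pi_pairs [[_ cb'] _ [_ pb'] _] := P'.
have z w : comp w -> 0 \notin w by move=> cw; apply/negP => /(allP cw).
case: H => [[ib ml]|[[e e0 ie] el eb]]; case: H' => [[ib' ml']|[[e' e0' ie'] el' eb']].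
- by rewrite -ib -ib' -ml -ml'.
- by case: (pure_excl e0' (z _ cb') pb' (n' := \max_(p <- b) p)); rewrite -ie' ib.
- by case: (pure_excl e0 (z _ cb) pb (n' := \max_(p <- b') p)); rewrite -ie ib'.
- by rewrite el el' eb eb'.
Qed.

Lemma pi_pairs_comps d : size (pi_pairs d) <= size (comps d).
Proof.
rewrite -(size_map encode); apply: uniq_leq_size.
  by rewrite map_inj_in_uniq ?uniq_pi_pairs //; exact: encode_inj.
by move=> x /mapP[p /encode_comps pd ->].
Qed.

(** * Pure and inverting compositions *)

Lemma invertingP w : inverting w <-> inverting_word w.
Proof.
split=> iw i im.
  have [s [t [/andP[st tw] es et]]] := iw i im.
  rewrite /has_inv -et; have is_ : index i w <= s.
    by rewrite -es leqNgt; apply/negP => lt; have := before_find 0 lt; rewrite /= eqxx.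
  have it : index i w <= t by exact: leq_trans is_ (ltnW st).
  by rewrite -(subnKC it) -nth_drop mem_nth // size_drop ltn_sub2r // (leq_ltn_trans it).
have iW := has_inv_in (iw i im).
have [||s [t [st es et]]] := @inverting_pair w (index i w) iw; rewrite ?index_mem ?nth_index //.
  by case/andP: im.
by exists s, t; split=> //; rewrite ?es ?et nth_index.
Qed.

Definition stair (mult : nat -> nat) k := flatten [seq nseq (mult j) j | j <- rev (iota 1 k)].

Lemma rev_iotaSS k : rev (iota 1 k.+2) = [seq j + 2 | j <- rev (iota 1 k)] ++ [:: 2; 1].
Proof.
have -> : iota 1 k.+2 = [:: 1; 2] ++ iota 3 k by [].
rewrite rev_cat (iotaDl 2 1) -map_rev; congr (_ ++ _).
by apply: eq_map => j; rewrite addnC.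
Qed.

Lemma stair_SS mult k : stair mult k.+2 =
  [seq x + 2 | x <- stair (fun j => mult (j + 2)) k] ++ nseq (mult 2) 2 ++ nseq (mult 1) 1.
Proof.
rewrite /stair rev_iotaSS map_cat flatten_cat /= cats0; congr (_ ++ _).
rewrite map_flatten -!map_comp; congr flatten; apply: eq_map => j /=.
by rewrite map_nseq.
Qed.

Lemma stair_S1 mult k : stair mult k.+1 = flatten [seq nseq (mult j) j | j <- rev (iota 2 k)]
  ++ nseq (mult 1) 1.
Proof. by rewrite /stair -[iota 1 k.+1]cat1s rev_cat map_cat flatten_cat /= cats0. Qed.

Lemma staircase0 w : staircase_suffix w 0.
Proof. by exists w, (fun=> 1); split=> [|j /andP[]|p _]; [rewrite cats0|case: j|case: p]. Qed.

Lemma cat_ones u e : 1 \notin u -> 0 < e -> trail (u ++ nseq e 1) /\ 1 \in u ++ nseq e 1.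
Proof.
move=> u1 e0; split; last by rewrite mem_cat mem_nseq e0 orbT.
rewrite /trail count_cat count_nseq mul1n size_cat size_nseq.
by rewrite (count_memPn u1) add0n addnK take_size_cat.
Qed.

Lemma staircaseS w k : staircase_suffix w k.+1 -> trail w /\ 1 \in w.
Proof.
move=> [al [mult [-> m1 al1]]]; rewrite -/(stair mult k.+1) stair_S1 catA; apply: cat_ones;
  last exact: m1.
rewrite mem_cat negb_or; apply/andP; split; first by apply/negP => /al1.
apply/negP => /flattenP[s /mapP[j]]; rewrite mem_rev mem_iota => /andP[j2 _] ->.
by rewrite mem_nseq => /andP[_ /eqP e]; rewrite -e in j2.
Qed.

Lemma staircase1 w : comp w -> trail w -> 1 \in w -> staircase_suffix w 1.
Proof.
move=> cw /trailP e w1; exists (strip1 w), (fun=> count_mem 1 w); split.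
- by rewrite /= cats0.
- by rewrite -has_count has_pred1.
by move=> p; rewrite mem_filter => /andP[p1 _]; case: p p1 => [|[|p]].
Qed.

Definition split2 w := w == gt2 w ++ nseq (count_mem 2 w) 2 ++ nseq (count_mem 1 w) 1.

Lemma comp_lower w : comp (lower w).
Proof. by apply/allP => x /mapP[y]; rewrite mem_filter => /andP[y2 _] -> /=;
  rewrite subn_gt0. Qed.

Lemma split2_shape (u : seq nat) a b : (forall x, x \in u -> 2 < x) ->
  let w := u ++ nseq a 2 ++ nseq b 1 in
  [/\ gt2 w = u, count_mem 1 w = b & count_mem 2 w = a].
Proof.
move=> u2 w; have z x : x <= 2 -> count_mem x u = 0.
  by move=> x2; apply/count_memPn/negP => /u2; rewrite ltnNge x2.
rewrite /w /gt2 !filter_cat !filter_nseq !count_cat !count_nseq !z //= !cats0 !mul1n !mul0n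
  addn0.
by split=> //; apply/all_filterP/allP; exact: u2.
Qed.

(** The two lowest steps are the final 2...2 1...1, and subtracting 2 turns the higher steps into a
    staircase again. *)
Lemma staircaseSS w k : comp w -> staircase_suffix w k.+2 <->
  [/\ 1 \in w, 2 \in w, split2 w & staircase_suffix (lower w) k].
Proof.
move=> cw; split=> [[al [mult [e m1 al1]]]|[w1 w2 /eqP e [al [mult [el m1 al1]]]]].
  rewrite -/(stair mult k.+2) stair_SS catA in e.
  set u := al ++ _ in e.
  have u2 x : x \in u -> 2 < x.
    move=> xu; have x0 : 0 < x by apply: (allP cw); rewrite e mem_cat xu.
    move: xu; rewrite mem_cat => /orP[/al1|/mapP[y yk ->]]; first by move: x0; clear; lia.
    move: yk => /flattenP[s /mapP[j]]; rewrite mem_rev mem_iota => /andP[j1 _] ->.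
    by rewrite mem_nseq => /andP[_ /eqP ->]; move: j1; clear; lia.
  have [bu c1 c2] := split2_shape (mult 2) (mult 1) u2; rewrite -e in bu c1 c2.
  split.
  - by rewrite -has_pred1 has_count c1 m1.
  - by rewrite -has_pred1 has_count c2 m1.
  - by rewrite /split2 bu c1 c2 {1}e.
  exists [seq x - 2 | x <- al], (fun j => mult (j + 2)); split.
  - rewrite /lower bu map_cat -map_comp; congr (_ ++ _).
    by rewrite -/(stair _ _) -[RHS]map_id; apply: eq_map => x /=; rewrite addnK.
  - by move=> j /andP[j1 jk]; apply: m1; move: j1 jk; clear; lia.
  - move=> p /mapP[x xal ->]; have := u2 x; rewrite mem_cat xal => /(_ isT).
    by have := al1 x xal; clear; lia.
exists [seq x + 2 | x <- al], (fun j =>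
  if j == 1 then count_mem 1 w else if j == 2 then count_mem 2 w else mult (j - 2)).
split.
- transitivity ([seq x + 2 | x <- lower w] ++ nseq (count_mem 2 w) 2 ++ nseq (count_mem 1 w) 1).
    by rewrite lowerK.
  rewrite -/(stair _ k.+2) stair_SS /= catA el map_cat -/(stair mult k) -!catA.
  congr (_ ++ (map _ _ ++ _)).
  rewrite /stair; congr flatten; apply/eq_in_map => j; rewrite mem_rev mem_iota => /andP[j1 _].
  by rewrite addnK; case: eqP => [h|_]; [|case: eqP => [h|//]]; move: h j1; clear; lia.
- move=> j /andP[j1 jk]; case: eqP => [_|n1]; first by rewrite -has_count has_pred1.
  case: eqP => [_|n2]; first by rewrite -has_count has_pred1.
  by apply: m1; move: j1 jk n1 n2; clear; lia.
move=> p /mapP[x xal ->]; have x0 : 0 < x by apply: (allP (comp_lower w));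
  rewrite el mem_cat xal.
by have := al1 x xal; move: x0; clear; lia.
Qed.

(** A bound on the letters is enough fuel, as each unfolding of [pureb] lowers the letters by 2. *)
Lemma pureP m w : comp w -> all (fun x => x <= m) w -> pure w <-> pureb m w.
Proof.
elim: m w => [|m IH] w cw bw.
  case: w cw bw => [|[|x] w] // _ _; split=> // _; exists 0; split=> // [|k];
    first exact: staircase0.
  by case: k => // k /staircaseS[].
rewrite /=; case: (boolP (trail w)) => tw /=; last first.
  split=> // _; exists 0; split=> // [|k]; first exact: staircase0.
  by case: k => // k /staircaseS[h]; rewrite h in tw.
case: (boolP (1 \in w)) => w1 /=; last first.
  split=> // _; exists 0; split=> // [|k]; first exact: staircase0.
  by case: k => // k /staircaseS[_ h]; rewrite h in w1.
have s1 := staircase1 cw tw w1.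
rewrite andbA; case: (boolP ((2 \in w) && _)) => [/andP[w2 e]|nC] /=; last first.
  split=> // -[[|[|k]] [sk mk ek]]; first by have := mk 1 s1.
    by [].
  by move/(staircaseSS _ cw): sk => [_ w2 e _]; case/negP: nC; rewrite w2; exact: e.
have bl : all (fun x => x <= m) (lower w).
  apply/allP => x /mapP[y]; rewrite mem_filter => /andP[_ /(allP bw) ym] ->; move: ym; clear;
    lia.
rewrite -(IH _ (comp_lower w) bl); split=> -[k [sk mk ek]].
  case: k sk mk ek => [|[|k]] sk mk ek; [by have := mk 1 s1|by []|].
  have [_ _ _ sl] := (staircaseSS k cw).1 sk.
  exists k; split=> //; last by rewrite /= negbK in ek.
  move=> k' sk'; have : staircase_suffix w k'.+2 by apply/(staircaseSS _ cw).
  by move/mk; rewrite !ltnS.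
exists k.+2; split=> //=; last by rewrite negbK.
  by apply/(staircaseSS _ cw).
move=> [|[|k']] // sk'; rewrite !ltnS; apply: mk.
by have [] := (staircaseSS k' cw).1 sk'.
Qed.

Lemma pure_inv_wordP w : (composition w /\ pure w /\ inverting w) <-> (comp w /\ pure_inv_word
  w).
Proof.
have b : all (fun x => x <= \max_(p <- w) p) w by apply/allP => x xw; exact: leq_bigmax_seq.
split=> [[cw [pw iw]]|[cw [iw pw]]].
  by split=> //; split; [apply/invertingP|apply/(pureP cw b)].
by split=> //; split; [apply/(pureP cw b)|apply/invertingP].
Qed.

(** * Linear algebra in a fixed degree *)

Local Open Scope ring_scope.

Section Duality.
Variables (I J : eqType) (S : seq I) (G : seq J) (F : I -> J -> rat).
Hypotheses (uS : uniq S) (uG : uniq G).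
Hypothesis full : forall L : J -> rat,
  {in S, forall p, \sum_(g <- G) L g * F p g = 0} -> {in G, forall g, L g = 0}.

Let A : 'M[rat]_(size S, size G) := \matrix_(i, j) F (tnth (in_tuple S) i) (tnth (in_tuple G)
  j).

Lemma gt2_tnthG (f : J -> rat) : \sum_(g <- G) f g = \sum_(j < size G) f (tnth (in_tuple G) j).
Proof. by rewrite big_tnth. Qed.

Definition index_ord (T : eqType) (s : seq T) (x : T) (xs : x \in s) : 'I_(size s) :=
  Ordinal (etrans (index_mem x s) xs).

Lemma tnth_index_ord (T : eqType) (s : seq T) (x : T) (xs : x \in s) : tnth (in_tuple s)
  (index_ord xs) = x.
Proof. by rewrite (tnth_nth x) /= nth_index. Qed.

Lemma row_fullA : row_full A.
Proof.
rewrite /row_full -mxrank_tr -/(row_free A^T) -kermx_eq0; apply/eqP/row_matrixP => i.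
rewrite row0; set v := row i _.
have vA : v *m A^T = 0 by apply/sub_kermxP; exact: row_sub.
pose L g := if insub (index g G) is Some j then v 0 j else 0.
have LE j : L (tnth (in_tuple G) j) = v 0 j.
  rewrite /L (tnth_nth (tnth (in_tuple G) j)) /= index_uniq // insubT //= => h.
  by congr (v 0 _); apply: ord_inj.
have := full (L := L); rewrite /prop_in1 => LV.
apply/rowP => j; rewrite [RHS]mxE -LE; apply: LV; last exact: mem_tnth.
move=> p pS; rewrite gt2_tnthG; have := congr1 (fun w : 'rV_(size S) => w 0 (index_ord pS)) vA.
rewrite !mxE => h; rewrite -[RHS]h; apply: eq_bigr => k _.
by rewrite LE !mxE tnth_index_ord.
Qed.

Lemma dual_span (c : J -> rat) : exists x : I -> rat,
  {in G, forall g, c g = \sum_(p <- S) x p * F p g}.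
Proof.
have : (\row_j c (tnth (in_tuple G) j) <= A)%MS by exact: submx_full row_fullA.
move=> /submxP[y e].
exists (fun p => if insub (index p S) is Some i then y 0 i else 0) => g gG.
have := congr1 (fun w : 'rV_(size G) => w 0 (index_ord gG)) e; rewrite !mxE tnth_index_ord =>
  ->.
rewrite [RHS]big_tnth; apply: eq_bigr => i _; rewrite !mxE tnth_index_ord; congr (_ * _).
rewrite (tnth_nth (tnth (in_tuple S) i)) /= index_uniq // insubT //= => h.
by congr (y 0 _); apply: ord_inj.
Qed.

(** By [full] the rows of [A] span, so with no more rows than columns [A] is invertible, and a
    column of its inverse is the functional sought. *)
Lemma dual_free : (size S <= size G)%N -> forall p0, p0 \in S -> exists L : J -> rat,
  {in S, forall p, \sum_(g <- G) L g * F p g = (p == p0)%:R}.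
Proof.
move=> le p0 p0S; have /row_freeP[B AB] : row_free A.
  by rewrite /row_free eqn_leq rank_leq_row (eqP row_fullA).
exists (fun g => if insub (index g G) is Some j then B j (index_ord p0S) else 0) => p pS.
have := congr1 (fun w : 'M_(size S) => w (index_ord pS) (index_ord p0S)) AB; rewrite !mxE => e.
have -> : (p == p0) = (index_ord pS == index_ord p0S).
  apply/eqP/eqP => [pp|/(congr1 (tnth (in_tuple S)))]; last by rewrite !tnth_index_ord.
  by apply: ord_inj; rewrite /= pp.
rewrite -e gt2_tnthG; apply: eq_bigr => j _; rewrite mulrC !mxE tnth_index_ord; congr (_ * _).
rewrite (tnth_nth (tnth (in_tuple G) j)) /= index_uniq // insubT //= => h.
by congr (B _ _); apply: ord_inj.
Qed.

End Duality.

(** * Products of elementary functions acting on coefficients *)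

Lemma mulE_ext k c c' g : comp g ->
  (forall d, comp d -> (sumn d + k = sumn g)%N -> c d = c' d) -> mulE k c g = mulE k c' g.
Proof.
move=> cg e; rewrite /mulE big_seq [RHS]big_seq; apply: eq_bigr =>
  d /(lowerings_prop cg) [cd sd].
exact: e.
Qed.

Lemma mulE_sum k (I : Type) (r : seq I) (x : I -> rat) (F : I -> seq nat -> rat) g :
  mulE k (fun e => \sum_(i <- r) x i * F i e) g = \sum_(i <- r) x i * mulE k (F i) g.
Proof.
by rewrite /mulE exchange_big; apply: eq_bigr => i _; rewrite mulr_sumr.
Qed.

Definition mulEpred k c g := if k is k'.+1 then mulE k' c g else 0.

Lemma mulE_cons k c x g : mulE k c (x :: g) = mulE k (prepend x c) g + mulEpred k (prepend x.-1
  c) g.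
Proof.
rewrite /mulE /= big_cat big_map /=; congr (_ + _); first by apply: eq_bigr => d _;
  rewrite prependE.
by case: k => [|k]; rewrite /= ?big_nil // big_map; apply: eq_bigr => d _; rewrite prependE.
Qed.

Lemma mulED k c c' g : mulE k (fun e => c e + c' e) g = mulE k c g + mulE k c' g.
Proof. exact: big_split. Qed.

Lemma mulEpredD k c c' g : mulEpred k (fun e =>
  c e + c' e) g = mulEpred k c g + mulEpred k c' g.
Proof. by case: k => [|k]; rewrite /= ?addr0 // mulED. Qed.

Lemma prepend_eopS k c x : prepend x.+1 (mulE k c) = fun g =>
  mulE k (prepend x.+1 c) g + mulEpred k (prepend x c) g.
Proof. by apply: boolp.funext => g; rewrite -mulE_cons. Qed.

Lemma mulE_c0 k g : mulE k (fun=> 0) g = 0. Proof. exact: big1. Qed.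

(** In two rounds a part loses 0, 1 or 2, symmetrically in the rounds; only a part 1, erased by its
    first loss, is treated apart. *)
Lemma mulE_comm k l c g : comp g -> mulE k (mulE l c) g = mulE l (mulE k c) g.
Proof.
elim: g k l c => [|x g IH] k l c.
  by move=> _; case: k l => [|k] [|l]; rewrite /mulE /= ?big_nil // !big_seq1 /= ?big_nil.
move=> /andP[x0 cg]; case: x x0 => // x _.
have eopp0 m c' : mulEpred 0 c' = fun=> 0 by [].
have p0 m : mulEpred m (fun=> 0) = fun=> 0.
  by apply: boolp.funext => e; case: m => //= m; rewrite mulE_c0.
have H1 m n c' : mulE m (mulEpred n c') g = mulEpred n (mulE m c') g.
  by case: n => [|n]; [exact: mulE_c0|exact: IH].
have H2 m n c' : mulEpred m (mulEpred n c') g = mulEpred n (mulEpred m c') g.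
  by case: n => [|n]; case: m => [|m] //=; rewrite ?mulE_c0 // IH.
rewrite !mulE_cons !prepend_eopS !mulED.
case: x => [|x] /=.
  by rewrite !H1 (IH k l) // addrAC.
rewrite !prepend_eopS !mulEpredD !H1 (IH k l) // (H2 k l); ring.
Qed.

Definition mulEs (l : seq nat) c := foldr mulE c l.

Lemma mulEs_ext l c c' : (forall g, comp g -> c g = c' g) -> forall g, comp g ->
  mulEs l c g = mulEs l c' g.
Proof.
by elim: l => //= k l IH e g cg; apply: mulE_ext => // d cd _; apply: IH.
Qed.

Lemma mulEs_perm l l' c g : perm_eq l l' -> comp g -> mulEs l c g = mulEs l' c g.
Proof.
elim: l l' g => [|x l IH] l' g pl cg; first by move: pl; rewrite perm_sym => /perm_nilP ->.
have xl : x \in l' by rewrite -(perm_mem pl) inE eqxx.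
have pl' : perm_eq l (rem x l') by rewrite -(perm_cons x) (perm_trans pl) // perm_to_rem.
rewrite /= (mulE_ext (c' := mulEs (rem x l') c)) //; last by move=> d cd _; apply: IH.
elim: l' {IH pl pl'} xl g cg => //= y l' IH xl g cg.
case: eqVneq => [->//|yx] /=; rewrite mulE_comm //; apply: mulE_ext => // d cd _.
by apply: IH => //; move: xl; rewrite inE eq_sym (negbTE yx).
Qed.

Definition eRS (p : seq nat * seq nat) := mulEs p.1 (Rcoef p.2).

Lemma eRS_sum p g : comp g -> sumn g != (sumn p.1 + sumn p.2)%N -> eRS p g = 0.
Proof.
case: p => l b; rewrite /eRS /=; elim: l g => [|k l IH] g cg /= ng.
  by rewrite /Rcoef; move: ng; rewrite add0n; case: eqP.
rewrite /mulE big_seq big1 // => d /(lowerings_prop cg) [cd sd]; apply: IH => //.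
by apply: contra ng => /eqP e; rewrite -sd e addnC addnA.
Qed.

Lemma sort_geq k l : sorted geq (sort geq (k :: l)).
Proof. by apply: sort_sorted => x y; exact: leq_total. Qed.

Definition insert_part k (p : seq nat * seq nat) := (sort geq (k :: p.1), p.2).

Lemma insert_part_pi_pairs d k p : (0 < k <= d)%N -> p \in pi_pairs (d - k)%N ->
  insert_part k p \in pi_pairs d.
Proof.
case: p => l b /andP[k0 kd] /mem_pi_pairs [[cl cb] sl pb e]; apply/mem_pi_pairs; split=> //.
- by rewrite all_sort /= k0.
- exact: sort_geq.
- by rewrite (perm_sumn (permEl (perm_sort _ _))) /= -addnA e subnKC.
Qed.

Lemma mulE_eRS d k c x : (k <= d)%N ->
  {in comps (d - k)%N, forall g, c g = \sum_(p <- pi_pairs (d - k)%N) x p * eRS p g} ->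
  {in comps d, forall g, mulE k c g = \sum_(p <- pi_pairs (d - k)%N) x p * eRS (insert_part k
    p) g}.
Proof.
move=> kd xE g; rewrite mem_comps => /andP[cg /eqP sg].
rewrite (mulE_ext (c' := fun e => \sum_(p <- pi_pairs (d - k)%N) x p * eRS p e)) // =>
  [|e ce se]; last first.
  by apply: xE; rewrite mem_comps ce /= -sg -se addnK.
rewrite mulE_sum; apply: eq_bigr => p _; congr (_ * _).
rewrite -[LHS]/(mulEs (k :: p.1) _ g); apply: mulEs_perm => //.
by rewrite perm_sym perm_sort.
Qed.

Lemma pairing_scale d L a c : pairing d L (fun g => a * c g) = a * pairing d L c.
Proof. by rewrite /pairing mulr_sumr; apply: eq_bigr => g _; rewrite mulrCA. Qed.

Section Span.
Variable d : nat.
Hypothesis IHd : forall e, (e < d)%N ->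
  forall c, exists x, {in comps e, forall g, c g = \sum_(p <- pi_pairs e) x p * eRS p g}.

(** In [mulE k c] of degree [d], the factor [c] has degree [d - k < d] and is expanded by [IHd];
    multiplying by [e_k] inserts [k] into the partitions. So [L] kills the ideal and
    [pairing_vanish] applies. *)
Lemma eRS_full (L : seq nat ->
  rat) : {in pi_pairs d, forall p, \sum_(g <- comps d) L g * eRS p g = 0} ->
  {in comps d, forall g, L g = 0}.
Proof.
move=> h; have vanish : forall c, pairing d L c = 0.
  apply: (pairing_vanish (R := Rcoef)).
  - move=> k c k0; case: (leqP k d) => kd; last first.
      rewrite /pairing big_seq big1 // => g; rewrite mem_comps => /andP[cg /eqP sg].
      by rewrite /mulE lowerings_size ?big_nil ?mulr0 // (leq_ltn_trans (comp_size cg)) // sg.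
    have [|x xE] := @IHd (d - k)%N _ c.
      by move: k0 kd; clear; lia.
    rewrite (pairing_ext L (mulE_eRS kd xE)).
    rewrite pairing_sum big_seq big1 // => p pd; rewrite pairing_scale.
    by rewrite [pairing _ _ _]h ?mulr0 // insert_part_pi_pairs ?k0.
  - move=> b bd pb; apply: (h ([::], b)); apply/mem_pi_pairs; move: bd.
    by rewrite mem_comps => /andP[cb /eqP sb].
  - by move=> b; rewrite mem_comps => /andP[cb _]; exact: Rcoef_diag.
  - move=> b g; rewrite !mem_comps => /andP[cb /eqP sb] /andP[cg /eqP sg].
    by apply: Rcoef_lowerings => //; rewrite sb sg.
move=> g gd; have := vanish (fun e => (e == g)%:R).
rewrite /pairing (bigD1_seq g) ?uniq_comps //= eqxx mulr1 big1 ?addr0 // => e /negbTE ->.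
by rewrite mulr0.
Qed.

End Span.

Lemma eRS_span d c : exists x, {in comps d, forall g, c g = \sum_(p <- pi_pairs d) x p * eRS p
  g}.
Proof.
elim/ltn_ind: d c => d IHd c; apply: dual_span; rewrite ?uniq_pi_pairs ?uniq_comps //.
exact: eRS_full.
Qed.

Lemma eRS_dual d p0 : p0 \in pi_pairs d -> exists L,
  {in pi_pairs d, forall p, pairing d L (eRS p) = (p == p0)%:R}.
Proof.
move=> p0d; apply: dual_free => //; rewrite ?uniq_pi_pairs ?uniq_comps ?pi_pairs_comps //.
by apply: eRS_full => e _ c; exact: eRS_span.
Qed.

(** This is the dual basis vector of the pair [([::], b)]. It kills the ideal because there the
    expansion involves only pairs with a nonempty partition. *)
Lemma dual_functional b : comp b -> pure_inv_word b -> exists L,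
  (forall k c, (0 < k)%N -> pairing (sumn b) L (mulE k c) = 0) /\
  (forall b', comp b' -> pure_inv_word b' -> pairing (sumn b) L (Rcoef b') = (b' == b)%:R).
Proof.
move=> cb pb; set d := sumn b.
have [|L LE] := @eRS_dual d ([::], b); first by apply/mem_pi_pairs.
exists L; split=> [k c k0|b' cb' pb'].
  case: (leqP k d) => kd; last first.
    rewrite /pairing big_seq big1 // => g; rewrite mem_comps => /andP[cg /eqP sg].
    by rewrite /mulE lowerings_size ?big_nil ?mulr0 // (leq_ltn_trans (comp_size cg)) // sg.
  have [x xE] := eRS_span (d - k) c.
  rewrite (pairing_ext L (mulE_eRS kd xE)) pairing_sum big_seq big1 // => p pd;
    rewrite pairing_scale LE ?insert_part_pi_pairs ?k0 //.
  rewrite (_ : (_ == _) = false) ?mulr0 //; apply/negbTE; rewrite xpair_eqE negb_and -size_eq0.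
  by rewrite size_sort.
case: (sumn b' =P d) => sb'.
  by rewrite -[Rcoef b']/(eRS ([::], b')) LE ?xpair_eqE //; apply/mem_pi_pairs.
case: eqP => [e|_]; first by rewrite e in sb'.
rewrite /pairing big_seq big1 // => g; rewrite mem_comps => /andP[cg /eqP sg].
rewrite /Rcoef; case: eqP => [e|_]; last by rewrite mulr0.
by case: sb'; rewrite -e sg.
Qed.

(** * Quasisymmetric functions *)

Local Open Scope nat_scope.

Lemma elementaryE k (m : monomial) :
  elementary k m = ((uniq (enum_mset m) && (size (enum_mset m) == k))%:R)%R.
Proof.
have pm (s : {fset nat}) : seq_mset (enum_fset s) = m -> perm_eq (enum_mset m) (enum_fset s).
  by move=> <-; exact: perm_eq_seq_mset.
case: (boolP (_ && _)) => [/andP[um /eqP sm]|nm].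
  rewrite /elementary (@gen_series_count _ _ _ _ [:: [fset x in enum_mset m]%fset]) // => s.
  rewrite inE; split=> [[cs /pm p]|/eqP ->].
    by apply/eqP/fsetP => x; rewrite !inE (perm_mem p).
  have p : perm_eq (enum_fset [fset x in enum_mset m]%fset) (enum_mset m).
    by apply: uniq_perm => // x; rewrite !inE.
  split; first by rewrite /= (perm_size p).
  by rewrite -[RHS]seq_mset_id; apply/eq_seq_msetP.
rewrite /elementary (@gen_series_count _ _ _ _ [::]) // => s.
split=> // -[cs /pm p]; move: nm; rewrite (perm_uniq p) (perm_size p) fset_uniq /=.
by rewrite -cs eqxx.
Qed.

(* q.1 keeps the vanishing parts, and q.2 lists the variables of the lowered parts. *)
Fixpoint marked_lowerings k (i g : seq nat) : seq (seq nat * seq nat) :=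
  match i, g with
  | y :: i', x :: g' => [seq (x :: q.1, q.2) | q <- marked_lowerings k i' g'] ++
     (if k is k'.+1 then [seq (x.-1 :: q.1, y :: q.2) | q <- marked_lowerings k' i' g'] else
       [::])
  | _, _ => if k is 0 then [:: ([::], [::])] else [::]
  end.

Lemma index_word_cons y i x g : index_word (y :: i) (x :: g) = nseq x y ++ index_word i g.
Proof. by []. Qed.

Lemma marked_lowerings_prop k i g q : comp g -> size i = size g ->
  q \in marked_lowerings k i g ->
  [/\ perm_eq (index_word i q.1 ++ q.2) (index_word i g), size q.2 = k, subseq q.2 i & size q.1
    = size i].
Proof.
elim: i g k q => [|y i IH] [|x g] k q //; first by case: k => // _ _; rewrite inE => /eqP ->.
move=> /= /andP[x0 cg] [sz]; rewrite mem_cat =>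
  /orP[/mapP[q' /(IH _ _ _ cg sz) [p s sb s1] ->]|].
  split=> //=; last by rewrite s1.
    by rewrite !index_word_cons -catA perm_cat2l.
  by apply: subseq_trans sb (subseq_cons _ _).
case: k => // k /mapP[q' /(IH _ _ _ cg sz) [p s sb s1] ->]; split=> /=; rewrite ?eqxx ?s ?s1 //.
rewrite !index_word_cons; case: x x0 => // x _ /=.
rewrite -catA; apply/permP => a; have /permP/(_ a) := p; rewrite /= !count_cat /=; clear; lia.
Qed.

Lemma marked_lowerings_complete (a : pred nat) i g : size i = size g ->
  filter a i \in [seq q.2 | q <- marked_lowerings (count a i) i g].
Proof.
elim: i g => [|y i IH] [|x g] //= [sz]; have := IH g sz.
case: (a y) => /= /mapP[q ql e]; rewrite map_cat mem_cat -!map_comp; apply/orP; [right|left].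
  by apply/mapP; exists q; rewrite //= e.
by apply/mapP; exists q; rewrite //= e.
Qed.

Lemma marked_lowerings_uniq k i g : comp g -> size i = size g -> uniq i ->
  uniq [seq q.2 | q <- marked_lowerings k i g].
Proof.
elim: i g k => [|y i IH] [|x g] k //; first by case: k.
move=> /= /andP[x0 cg] [sz] /andP[yi ui].
have E1 l : [seq q.2 | q <- [seq (x :: q.1, q.2) | q : seq nat * seq nat <- l]] = [seq q.2 | q
  <- l].
  by rewrite -map_comp; apply: eq_map.
have E2 l : [seq q.2 | q <- [seq (x.-1 :: q.1, y :: q.2) | q : seq nat * seq nat <- l]] =
    [seq y :: s | s <- [seq q.2 | q <- l]].
  by rewrite -!map_comp; apply: eq_map.
rewrite map_cat cat_uniq E1 IH //=; case: k => [|k]; first by [].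
rewrite E2 map_inj_uniq ?IH ?andbT // => [|s t [] //].
apply/hasPn => s /mapP[t _ ->]; apply/mapP => -[q' /(marked_lowerings_prop cg sz) [_ _ sb _] e].
by move: yi; rewrite (mem_subseq sb) // -e inE eqxx.
Qed.

Lemma lowerings_marked k i g : comp g -> size i = size g ->
  lowerings k g = [seq [seq x <- q.1 | 0 < x] | q <- marked_lowerings k i g].
Proof.
elim: i g k => [|y i IH] [|x g] k //; first by case: k.
move=> /= /andP[x0 cg] [sz]; rewrite map_cat -map_comp; congr (_ ++ _).
  by rewrite (IH g k cg sz) -map_comp; apply: eq_map => q /=; case: x x0.
case: k => // k; rewrite (IH g k cg sz) -!map_comp; apply: eq_map => q /=.
by case: (x.-1).
Qed.

Lemma msetD_inj (a b c : monomial) : msetD a c = msetD b c -> a = b.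
Proof. by move=> e; apply/msetP => x; have /msetP/(_ x) := e; rewrite !msetE2 => /addIn. Qed.

Lemma seq_mset_cat (s t : seq nat) : seq_mset (s ++ t) = msetD (seq_mset s) (seq_mset t).
Proof. by apply/msetP => x; rewrite msetE2 !mset_seqE count_cat. Qed.

Local Open Scope ring_scope.

(** A factor with nonzero coefficient in [elementary k] is a product of [k] distinct variables of
    the monomial, that is, a choice of [k] parts to lower. *)
Lemma mul_elementary (f : fps) k i g : comp g -> sorted ltn i -> size i = size g ->
  (f * elementary k) (xpow i g) = \sum_(q <- marked_lowerings k i g) f (xpow i q.1).
Proof.
move=> cg si sz; have ui : uniq i by apply: sorted_uniq si; [exact: ltn_trans|exact: ltnn].
pose r : seq (monomial * monomial) := [seq (xpow i q.1, seq_mset q.2) | q <- marked_lowerings k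
  i g].
have srt q : q \in marked_lowerings k i g -> sorted ltn q.2.
  by move=> /(marked_lowerings_prop cg sz) [_ _ sb _]; exact: (subseq_sorted ltn_trans sb).
have ur : uniq r.
  have := marked_lowerings_uniq k cg sz ui.
  rewrite /r => u2; rewrite map_inj_in_uniq ?(map_uniq u2) // =>
    q q' ql ql' [_ /eq_seq_msetP p].
  have e2 : q.2 = q'.2 by apply: (irr_sorted_eq ltn_trans ltnn (srt _ ql) (srt _ ql') (perm_mem
    p)).
  rewrite -(nth_index q ql) -(nth_index q ql'); congr nth.
  have := nth_index q ql; have := nth_index q ql'.
  have ml := ql; have ml' := ql'; rewrite -index_mem in ml; rewrite -index_mem in ml'.
  move=> e1' e1; have /uniqP := u2 =>
    /(_ [::] (index q (marked_lowerings k i g)) (index q' (marked_lowerings k i g))).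
  rewrite !inE size_map ml ml' !(nth_map q) // e1 e1' => h; exact: h.
transitivity (\sum_(p <- r) f p.1 * elementary k p.2); last first.
  rewrite big_map big_seq [RHS]big_seq; apply: eq_bigr => q ql /=.
  have [_ s2 _ _] := marked_lowerings_prop cg sz ql.
  rewrite elementaryE (perm_uniq (perm_eq_seq_mset _)) (perm_size (perm_eq_seq_mset _)) s2 eqxx.
  by rewrite (sorted_uniq ltn_trans ltnn (srt _ ql)) mulr1.
rewrite -[LHS]/(fps_mul f (elementary k) (xpow i g)) /fps_mul (fsbig_seq _ _ ur); apply/esym.
apply: fsbig_widen => [p /= /mapP[q ql ->] /=|[a b] /= [above nr]].
  have [p1 _ _ _] := marked_lowerings_prop cg sz ql.
  by rewrite -seq_mset_cat; apply/eq_seq_msetP.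
rewrite elementaryE; case: (boolP (_ && _)) => [/andP[ub /eqP sb]|_]; last by rewrite mulr0.
case: nr; pose S := [seq x <- i | x \in enum_mset b].
have pS : perm_eq S (enum_mset b).
  apply: uniq_perm; rewrite ?filter_uniq // => x; rewrite mem_filter andb_idr // => xb.
  apply: (@index_word_mem i g); rewrite -has_pred1 has_count -mset_seqE -/(xpow i g) -above
    msetE2.
  by rewrite addn_gt0 orbC; move: xb; rewrite -has_pred1 has_count -mset_seqE seq_mset_id => ->.
have cS : count (fun x => x \in enum_mset b) i = k by rewrite -size_filter (perm_size pS).
have := marked_lowerings_complete (fun x => x \in enum_mset b) sz; rewrite cS =>
  /mapP[q ql eq2].
have bE : b = seq_mset q.2 by rewrite -eq2 -[LHS]seq_mset_id; apply/eq_seq_msetP;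
  rewrite perm_sym.
apply/mapP; exists q => //; congr pair => //; apply: (@msetD_inj _ _ b);
  rewrite above bE -seq_mset_cat.
have [p1 _ _ _] := marked_lowerings_prop cg sz ql.
by apply/eq_seq_msetP; rewrite perm_sym.
Qed.

Definition ccoef (f : fps) (g : seq nat) : rat := f (xpow (iota 0 (size g)) g).

Lemma QSym_ccoef f i g : QSym f -> comp g -> sorted ltn i -> size i = size g ->
  f (xpow i g) = ccoef f g.
Proof.
move=> [_ has_inv] cg si sz; apply: has_inv => //; rewrite ?size_iota //;
  exact: iota_ltn_sorted.
Qed.

Lemma xpow_nz i g : size i = size g ->
  exists j, [/\ subseq j i, size j = size [seq x <- g | 0 < x]%N & xpow i g = xpow j [seq x <-
    g | 0 < x]%N].
Proof.
elim: i g => [|y i IH] [|x g] //=; first by exists [::].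
move=> [/IH [j [sb sj e]]]; case: (posnP x) => [->|x0] /=.
  by exists j; split=> //; apply: subseq_trans sb (subseq_cons _ _).
exists (y :: j); split; rewrite /= ?eqxx ?sj //.
rewrite -[LHS]/(seq_mset (nseq x y ++ index_word i g)) -[RHS]/(seq_mset (nseq x y ++ index_word
  j _)).
rewrite !seq_mset_cat; congr msetD; exact: e.
Qed.

Lemma QSym_mul_elementary f k i g : QSym f -> comp g -> sorted ltn i -> size i = size g ->
  (f * elementary k) (xpow i g) = mulE k (ccoef f) g.
Proof.
move=> qf cg si sz; rewrite mul_elementary // /mulE (lowerings_marked k cg sz) big_map.
rewrite big_seq [RHS]big_seq; apply: eq_bigr => q /(marked_lowerings_prop cg sz) [_ _ _ s1].
have [j [sb sj ->]] := xpow_nz (esym s1).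
apply: QSym_ccoef => //; first by apply/allP => x; rewrite mem_filter => /andP[].
exact: (subseq_sorted ltn_trans sb).
Qed.

Lemma ccoef_mul_elementary f k g : QSym f -> comp g ->
  ccoef (f * elementary k) g = mulE k (ccoef f) g.
Proof.
by move=> qf cg; apply: QSym_mul_elementary; rewrite ?size_iota ?iota_ltn_sorted.
Qed.

Lemma QSym_mul f k : QSym f -> QSym (f * elementary k).
Proof.
move=> qf; split; last first.
  by move=> a i j ca si sj sza szj; rewrite !QSym_mul_elementary.
have [[D bD] _] := qf; exists (D + k)%N => m sm.
rewrite -[LHS]/(fps_mul f (elementary k) m) /fps_mul fsbig1 // => -[a b] /= above.
case: (ltnP D (size (enum_mset a))) => [/bD ->|sa]; first by rewrite mul0r.
rewrite elementaryE [X in _ && X](_ : _ = false) ?andbF ?mulr0 //; apply/negbTE/eqP => sb.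
have : size (enum_mset m) = (size (enum_mset a) + size (enum_mset b))%N.
  rewrite -size_cat; apply: perm_size.
  rewrite -above -[X in msetD X _]seq_mset_id -[X in msetD _ X]seq_mset_id -seq_mset_cat.
  exact: perm_eq_seq_mset.
by move: sm sa; rewrite sb; clear; lia.
Qed.

Lemma QSymD f g : QSym f -> QSym g -> QSym (f + g).
Proof.
move=> [[D1 b1] i1] [[D2 b2] i2]; split; last first.
  move=> a i j ca si sj sza szj; rewrite -[LHS]/(f _ + g _) -[RHS]/(f _ + g _).
  by rewrite (i1 a i j) // (i2 a i j).
exists (maxn D1 D2) => m; rewrite gtn_max => /andP[h1 h2].
by rewrite -[LHS]/(f m + g m) b1 // b2 // addr0.
Qed.

Lemma QSymZ (x : rat) f : QSym f -> QSym (x *: f).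
Proof.
move=> [[D b] has_inv]; split; last first.
  by move=> a i j ca si sj sza szj; rewrite -[LHS]/(x * f _) -[RHS]/(x * f _) (has_inv a i j).
by exists D => m h; rewrite -[LHS]/(x * f m) b // mulr0.
Qed.

Lemma QSym0 : QSym 0. Proof. by split=> //; exists 0%N. Qed.

Lemma QSym_sum (I : eqType) (r : seq I) (F : I -> fps) :
  (forall x, x \in r -> QSym (F x)) -> QSym (\sum_(x <- r) F x).
Proof.
elim: r => [|x r IH] h; first by rewrite big_nil; exact: QSym0.
rewrite big_cons; apply: QSymD; first by apply: h; rewrite inE eqxx.
by apply: IH => y yr; apply: h; rewrite inE yr orbT.
Qed.

Lemma RS_QSym al : comp al -> QSym (RS al).
Proof.
move=> ca; split; last by move=> a i j _ si sj sza szj; rewrite !RS_xpow.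
exists (sumn al) => m sm; rewrite /RS (@gen_series_count _ _ _ _ [::]) // => U.
split=> // -[[[sU _] _ _ _] cU]; move: sm; rewrite -cU (perm_size (perm_eq_seq_mset _)).
by rewrite size_map size_flatten sU ltnn.
Qed.

Lemma ccoef_RS al g : comp al -> ccoef (RS al) g = Rcoef al g.
Proof. by move=> ca; apply: RS_xpow; rewrite ?size_iota ?iota_ltn_sorted. Qed.

Lemma count_index_word (h : nat -> nat) i x : uniq i ->
  count_mem x (index_word i [seq h y | y <- i]) = if x \in i then h x else 0%N.
Proof.
elim: i => //= y i IH /andP[yi ui];
  rewrite index_word_cons count_cat count_nseq IH // [pred1 x y]/=.
have [->|xy] := eqVneq x y; first by rewrite inE eqxx (negbTE yi) mul1n addn0.
by rewrite mul0n inE (negbTE xy).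
Qed.

Lemma QSym_eq0 f : QSym f -> (forall g, comp g -> ccoef f g = 0) -> f = 0.
Proof.
move=> qf h; apply/funext => m; rewrite -[RHS]/(0 : rat).
pose i := sort leq (undup (enum_mset m)).
have ui : uniq i by rewrite sort_uniq undup_uniq.
have si : sorted ltn i by rewrite ltn_sorted_uniq_leq ui sort_sorted //; exact: leq_total.
have mi x : (x \in i) = (0 < m x)%N.
  by rewrite mem_sort mem_undup -[in RHS](seq_mset_id m) mset_seqE -has_count has_pred1.
have -> : m = xpow i [seq m x | x <- i].
  apply/msetP => x; rewrite /xpow mset_seqE count_index_word //; rewrite mi;
    case: (posnP (m x)) => //.
rewrite (QSym_ccoef qf) ?h ?size_map //; apply/allP => x /mapP[y yi ->].
  by rewrite /= -mi.
by rewrite /= -mi.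
Qed.

Local Open Scope classical_set_scope.
Local Open Scope ring_scope.

Lemma ccoef_sum (I : Type) (r : seq I) (x : I -> rat) (F : I -> fps) g :
  ccoef (\sum_(i <- r) x i *: F i) g = \sum_(i <- r) x i * ccoef (F i) g.
Proof.
elim: r => [|i r IH]; first by rewrite !big_nil.
by rewrite !big_cons -IH.
Qed.

Lemma ccoef_sum1 (I : Type) (r : seq I) (F : I -> fps) g :
  ccoef (\sum_(i <- r) F i) g = \sum_(i <- r) ccoef (F i) g.
Proof.
elim: r => [|i r IH]; first by rewrite !big_nil.
by rewrite !big_cons -IH.
Qed.

Fixpoint mul_elementaries (l : seq nat) (f : fps) : fps := if l is k :: l' then
  mul_elementaries l' f * elementary k else f.

Lemma mul_elementaries_QSym l f : QSym f -> QSym (mul_elementaries l f).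
Proof. by elim: l => //= k l IH qf; apply: QSym_mul; apply: IH. Qed.

Lemma ccoef_mul_elementaries l f g : QSym f -> comp g ->
  ccoef (mul_elementaries l f) g = mulEs l (ccoef f) g.
Proof.
move=> qf; elim: l g => //= k l IH g cg; rewrite ccoef_mul_elementary //;
  last exact: mul_elementaries_QSym.
by apply: mulE_ext => // d cd _; apply: IH.
Qed.

(** * Expansion of quasisymmetric functions and the basis of the quotient *)

Definition pi_pairs_le D := flatten [seq pi_pairs d | d <- iota 0 D.+1].

Lemma mem_pi_pairs_le D p : p \in pi_pairs_le D -> p \in pi_pairs (sumn p.1 + sumn p.2)%N.
Proof.
move=> /flattenP[s /mapP[d _ ->]]; case: p => l b pd.
by have /mem_pi_pairs [_ _ _ e] := pd; rewrite /= e.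
Qed.

Lemma QSym_expansion v : QSym v -> exists D (X : seq nat * seq nat -> rat),
  v = \sum_(p <- pi_pairs_le D) X p *: mul_elementaries p.1 (RS p.2).
Proof.
move=> qv; have [[D bD] _] := qv; exists D.
have [xx xE] := choice (fun d => eRS_span d (ccoef v)).
(* A pair determines its degree, so the coefficients from all degrees combine into one function. *)
pose X (p : seq nat * seq nat) := xx (sumn p.1 + sumn p.2)%N p; exists X.
have qp p : p \in pi_pairs_le D -> QSym (mul_elementaries p.1 (RS p.2)).
  case: p => l b /mem_pi_pairs_le /mem_pi_pairs [[cl cb] _ _ _].
  by apply: mul_elementaries_QSym; apply: RS_QSym.
apply/eqP; rewrite -subr_eq0; apply/eqP; apply: QSym_eq0.
  apply: QSymD => //; rewrite -scaleN1r; apply: QSymZ; apply: QSym_sum => p pD.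
  by apply: QSymZ; exact: qp.
move=> g cg; rewrite -[LHS]/(ccoef v g - ccoef _ g) ccoef_sum.
have E : \sum_(p <- pi_pairs_le D) X p * ccoef (mul_elementaries p.1 (RS p.2)) g = \sum_(p <-
  pi_pairs_le D) X p * eRS p g.
  rewrite big_seq [RHS]big_seq; apply: eq_bigr => p pD; congr (_ * _).
  case: p pD => l b /mem_pi_pairs_le /mem_pi_pairs [[cl cb] _ _ _];
    rewrite ccoef_mul_elementaries //; last exact: RS_QSym.
  by apply: mulEs_ext => // e ce; rewrite ccoef_RS.
rewrite E /pi_pairs_le big_flatten big_map.
have Z d : d != sumn g -> \sum_(p <- pi_pairs d) X p * eRS p g = 0.
  move=> ne; rewrite big_seq big1 // => -[l b] /mem_pi_pairs [_ _ _ e].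
  by rewrite eRS_sum ?mulr0 //= e eq_sym.
case: (leqP (sumn g) D) => gD; last first.
  rewrite [ccoef v g]bD; last first.
    by rewrite (perm_size (perm_eq_seq_mset _)) index_word_size ?size_iota.
  rewrite big_seq big1 ?subr0 // => d; rewrite mem_iota add0n ltnS => /= dD.
  by apply: Z; apply: contraTneq dD => ->; rewrite -ltnNge.
rewrite (bigD1_seq (sumn g)) ?iota_uniq ?mem_iota //= [X in _ - (_ + X)]big1 ?addr0 =>
  [|d /Z //].
rewrite [ccoef v g](xE (sumn g)) ?mem_comps ?cg ?eqxx //; apply/eqP; rewrite subr_eq0;
  apply/eqP.
by rewrite big_seq [RHS]big_seq; apply: eq_bigr => -[l b] /mem_pi_pairs [_ _ _ e];
  rewrite /X /= e.
Qed.

Theorem corollary2p4p4 :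
  quotient_basis QSym E_ideal
    [set al : seq nat | [/\ composition al, pure al & inverting al]] RS.
Proof.
have PI al : [/\ composition al, pure al & inverting al] <-> comp al /\ pure_inv_word al.
  by rewrite -pure_inv_wordP; split=> [[? ? ?]|[? [? ?]]].
split=> [al [cal _ _]|s c us sB [sp [spA e]] t ts|v qv].
- exact: RS_QSym.
- have [ct pt] := (PI t).1 (sB t ts).
  (* On the component of degree [sumn t], [L] kills the ideal and picks out the coefficient of
     [t]. *)
  have [L [Leop LR]] := dual_functional ct pt.
  have : pairing (sumn t) L (ccoef (\sum_(t <- s) c t *: RS t)) = 0.
    rewrite e; transitivity (\sum_(p <- sp) pairing (sumn t) L (ccoef (p.1 * p.2))).
      by rewrite -pairing_sum; apply: pairing_ext => g _; rewrite ccoef_sum1.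
    rewrite big_seq big1 // => p /spA [q1 [k k0 <-]].
    rewrite -(Leop k (ccoef p.1) k0); apply: pairing_ext => g; rewrite mem_comps => /andP[cg _].
    by rewrite ccoef_mul_elementary.
  transitivity (pairing (sumn t) L (ccoef (\sum_(t <- s) c t *: RS t))) => //.
  transitivity (\sum_(u <- s) c u * pairing (sumn t) L (Rcoef u)).
    rewrite (bigD1_seq t) //= LR // eqxx mulr1 big_seq_cond big1 ?addr0 // => u /andP[us' ut].
    have [cu pu] := (PI u).1 (sB u us').
    by rewrite LR // (negbTE ut) mulr0.
  transitivity (pairing (sumn t) L (fun g => \sum_(u <- s) c u * Rcoef u g)).
    by rewrite pairing_sum; apply: eq_bigr => u _; rewrite pairing_scale.
  apply: pairing_ext => g; rewrite mem_comps => /andP[cg _].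
  rewrite ccoef_sum big_seq [RHS]big_seq; apply: eq_bigr => u us'.
  by have [cu _] := (PI u).1 (sB u us'); rewrite ccoef_RS.
have [D [X ->]] := QSym_expansion qv.
(* The pairs with an empty partition give the combination sought. Every other term contains a factor
   [e_k] with [k > 0], which is split off to put it into the ideal. *)
pose S := [seq p <- pi_pairs_le D | p.1 == [::]].
exists [seq p.2 | p <- S], (fun t => X ([::], t)); split.
  move=> t /mapP[[l b]]; rewrite mem_filter =>
    /andP[_ /mem_pi_pairs_le /mem_pi_pairs [[_ cb] _ pb _]] ->.
  exact/PI.
have -> : \sum_(t <- [seq p.2 | p <- S]) X ([::], t) *: RS t =
    \sum_(p <- pi_pairs_le D | p.1 == [::]) X p *: mul_elementaries p.1 (RS p.2).
  rewrite big_map /S big_filter; apply: eq_bigr => -[l b] /= /eqP ->.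
  by [].
rewrite (bigID (fun p : seq nat * seq nat => p.1 == [::])) /= addrAC subrr add0r.
exists [seq (X p *: mul_elementaries (behead p.1) (RS p.2), elementary (head 0%N p.1)) | p <-
  pi_pairs_le D & p.1 != [::]].
split=> [_ /mapP[[l b] + ->]|] /=.
  rewrite mem_filter => /andP[l0 /mem_pi_pairs_le /mem_pi_pairs [[cl cb] _ _ _]].
  split; first by apply: QSymZ; apply: mul_elementaries_QSym; apply: RS_QSym.
  by case: l l0 cl => //= k l _ /andP[k0 _]; exists k.
rewrite big_map big_filter; apply: eq_bigr => -[[|k l] b] //= _.
by rewrite scalerAl.
Qed.
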